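(* For every $\phi\in Z^0(\Omega)$, $|z|^{1/2}\partial_z\phi\in L^2((-1,1);H^{1/2}(x_0,x_1))$ and $\big\||z|^{1/2}\partial_z\phi\big\|_{L^2_z(H^{1/2}_x)}\le C\|\phi\|_{Z^0}$ with $C$ depending only on $x_0,x_1$.
   Context: Fix $x_0<x_1$, $\Omega=(x_0,x_1)\times(-1,1)$ with coordinates $(x,z)$. $Z^0(\Omega)$ is the space of $\phi$ with $\phi,\partial_z\phi,\partial_{zz}\phi,z\partial_x\phi\in L^2(\Omega)$, normed by $\|z\partial_x\phi\|_{L^2}+\|\partial_{zz}\phi\|_{L^2}+\|\partial_z\phi\|_{L^2}+\|\phi\|_{L^2}$. *)

(* Defs.v *)
From HB Require Import structures.
From mathcomp Require Import all_boot all_order all_algebra.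
From mathcomp Require Import all_classical all_reals all_analysis.
From mathcomp Require Import measurable_realfun.
Set Implicit Arguments. Unset Strict Implicit. Unset Printing Implicit Defensive.
Import Order.TTheory GRing.Theory Num.Theory.
Import numFieldNormedType.Exports.
Local Open Scope classical_set_scope.
Local Open Scope ring_scope.

Section Defs.
Variable R : realType.

Definition leb : {measure set (measurableTypeR R) -> \bar R} := lebesgue_measure.
Definition leb2 := (@lebesgue_measure R \x @lebesgue_measure R)%E.

Definition Omega (x0 x1 : R) : set (R * R) :=
  [set p | x0 < p.1 < x1 /\ -1 < p.2 < 1].

Definition zI : set R := `]-1, 1[.

Definition dx (f : R * R -> R) : R * R -> R :=
  fun p => derive1 (fun t => f (t, p.2)) p.1.
Definition dz (f : R * R -> R) : R * R -> R :=
  fun p => derive1 (fun t => f (p.1, t)) p.2.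

Fixpoint Ck (k : nat) (f : R * R -> R) : Prop :=
  continuous f /\
  match k with
  | 0%N => True
  | k'.+1 => (forall p : R * R, derivable (fun t => f (t, p.2)) p.1 1 /\
                               derivable (fun t => f (p.1, t)) p.2 1)
             /\ Ck k' (dx f) /\ Ck k' (dz f)
  end.

(* test functions C_c^oo(Omega): smooth, with support in a compact subset of
   Omega (equivalently in some closed sub-rectangle) *)
Definition test_fun (x0 x1 : R) (psi : R * R -> R) : Prop :=
  (forall k, Ck k psi) /\
  exists d : R, 0 < d /\ forall p : R * R,
    ~ (x0 + d <= p.1 <= x1 - d /\ -1 + d <= p.2 <= 1 - d) -> psi p = 0.

Local Open Scope ereal_scope.

Definition L2_on (D : set (R * R)) (f : R * R -> R) : Prop :=
  measurable_fun D f /\ \int[leb2]_(p in D) ((f p ^+ 2)%R)%:E < +oo.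

Definition L2norm (D : set (R * R)) (f : R * R -> R) : \bar R :=
  Lnorm leb2 2%:E (EFin \o (f \_ D)).

Definition weak_dz (x0 x1 : R) (phi g : R * R -> R) : Prop :=
  forall psi, test_fun x0 x1 psi ->
    \int[leb2]_(p in Omega x0 x1) (phi p * dz psi p)%:E =
    - \int[leb2]_(p in Omega x0 x1) (g p * psi p)%:E.

Definition weak_dzz (x0 x1 : R) (phi h : R * R -> R) : Prop :=
  forall psi, test_fun x0 x1 psi ->
    \int[leb2]_(p in Omega x0 x1) (phi p * dz (dz psi) p)%:E =
    \int[leb2]_(p in Omega x0 x1) (h p * psi p)%:E.

(* k = z * d_x phi in the sense of distributions:
   <z d_x phi, psi> = <d_x phi, z psi> = - <phi, z d_x psi> *)
Definition weak_z_dx (x0 x1 : R) (phi k : R * R -> R) : Prop :=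
  forall psi, test_fun x0 x1 psi ->
    \int[leb2]_(p in Omega x0 x1) (phi p * (p.2 * dx psi p))%:E =
    - \int[leb2]_(p in Omega x0 x1) (k p * psi p)%:E.

Definition inZ0 (x0 x1 : R) (phi g h k : R * R -> R) : Prop :=
  [/\ L2_on (Omega x0 x1) phi, L2_on (Omega x0 x1) g,
      L2_on (Omega x0 x1) h, L2_on (Omega x0 x1) k &
      [/\ weak_dz x0 x1 phi g, weak_dzz x0 x1 phi h & weak_z_dx x0 x1 phi k]].

Definition Z0norm (x0 x1 : R) (phi g h k : R * R -> R) : \bar R :=
  L2norm (Omega x0 x1) k + L2norm (Omega x0 x1) h +
  L2norm (Omega x0 x1) g + L2norm (Omega x0 x1) phi.

(* squared H^{1/2}(a,b) norm (Sobolev--Slobodeckij):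
   ||f||_{L^2}^2 + int int |f x - f y|^2 / |x - y|^2 dx dy *)
Definition H12norm2 (a b : R) (f : R -> R) : \bar R :=
  \int[leb]_(x in `]a, b[) ((f x ^+ 2)%R)%:E +
  \int[leb]_(x in `]a, b[) \int[leb]_(y in `]a, b[)
     (((f x - f y) ^+ 2) / ((x - y) ^+ 2))%:E.

Definition inH12 (a b : R) (f : R -> R) : Prop :=
  measurable_fun `]a, b[ f /\ H12norm2 a b f < +oo.

End Defs.

(* Main.v *)
(* In the cosine basis of L^2(x0, x1), let u_n, g_n and h_n be the coefficients
   of phi, d_z phi and d_zz phi.  They satisfy u_n' = g_n and g_n' = h_n, and the
   coefficient of z d_x phi against the n-th sine is - n freq z u_n, because the
   sine vanishes at both end points.  The one-dimensional inequality
     n \int |z| g_n^2 <= C (n^2 \int z^2 u_n^2 + \int h_n^2)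
   is summed over n with Bessel's inequality.  It holds because on a cell of
   length (n |z|)^(-1/2) the ordinary interpolation inequality between u_n and
   h_n scales correctly.  The resulting bound on \sum n \int |z| g_n^2 controls
   the Slobodeckij seminorm by Parseval's identity for the Poisson kernel,
   which dominates 1 / (x - y)^2 in the limit r -> 1. *)
Require Import Defs.
From HB Require Import structures.
From mathcomp Require Import all_boot all_order all_algebra.
From mathcomp Require Import all_classical all_reals all_analysis.
From mathcomp Require Import measurable_realfun.
From mathcomp Require Import zify ring lra.
Import Order.TTheory GRing.Theory Num.Theory.
Import numFieldNormedType.Exports.
Local Open Scope classical_set_scope.
Local Open Scope ring_scope.
Set Implicit Arguments.
Unset Strict Implicit.
Unset Printing Implicit Defensive.

Lemma ler_sqr_norm (R : realDomainType) (a b : R) :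
  (a ^+ 2 <= b ^+ 2) = (`|a| <= `|b|).
Proof.
by rewrite -[a ^+ 2]real_normK ?num_real// -[b ^+ 2]real_normK ?num_real//
  ler_sqr ?nnegrE.
Qed.

Section SquareIntegrable.
Context {d : measure_display} {T : measurableType d} {R : realType}.
Variable mu : {measure set T -> \bar R}.
Variable D : set T.
Hypothesis mD : measurable D.
Implicit Types f g e : T -> R.

Definition Rintegrable f := mu.-integrable D (EFin \o f).

Lemma RintegrableP f : measurable_fun D f ->
  (\int[mu]_(x in D) (`|f x|)%:E < +oo)%E -> Rintegrable f.
Proof.
by move=> mf fi; apply/integrableP; split; [exact/measurable_EFinP|exact: fi].
Qed.

Lemma measurable_Rintegrable f : Rintegrable f -> measurable_fun D f.
Proof. by move=> /measurable_int/measurable_EFinP. Qed.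

Lemma le_Rintegrable f g : measurable_fun D f -> Rintegrable g ->
  (forall x, D x -> `|f x| <= g x) -> Rintegrable f.
Proof.
move=> mf ig fg; apply: le_integrable ig => //; first exact/measurable_EFinP.
by move=> x Dx /=; rewrite lee_fin (le_trans (fg x Dx))// ler_norm.
Qed.

Lemma RintegrableMb (M : R) f e : Rintegrable f -> measurable_fun D e ->
  (forall x, D x -> `|e x| <= M) -> Rintegrable (fun x => f x * e x).
Proof.
move=> fi me eM; have fM : Rintegrable (fun x => M * `|f x|).
  exact: (integrableZl mD M (integrable_norm fi)).
apply: le_Rintegrable fM _.
  by apply: measurable_funM => //; exact: measurable_Rintegrable.
by move=> x Dx; rewrite normrM mulrC ler_wpM2r// eM.
Qed.

Lemma Rintegral_indicM (A : set T) f : A `<=` D ->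
  \int[mu]_(x in D) (f x * \1_A x) = \int[mu]_(x in A) f x.
Proof.
move=> AD; rewrite -[in RHS](setIidr AD) Rintegral_mkcondr.
apply: eq_Rintegral => x _; rewrite patchE indicE.
by case: (x \in A); rewrite ?mulr1 ?mulr0.
Qed.

Lemma subset_Rintegral_support (A : set T) f : A `<=` D ->
  (forall x, D x -> ~ A x -> f x = 0) ->
  \int[mu]_(x in A) f x = \int[mu]_(x in D) f x.
Proof.
move=> AD f0; rewrite -Rintegral_indicM//; apply: eq_Rintegral => x /set_mem Dx.
rewrite indicE; have [_|xA] := boolP (x \in A); first by rewrite mulr1.
by rewrite f0 ?mul0r// => /mem_set; rewrite (negbTE xA).
Qed.

Lemma ae_le_Rintegral f g : Rintegrable f -> Rintegrable g ->
  {ae mu, forall x, D x -> f x <= g x} ->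
  \int[mu]_(x in D) f x <= \int[mu]_(x in D) g x.
Proof.
move=> fi gi fg; pose m x := Num.max (f x) (g x).
have mm : measurable_fun D m.
  by apply: measurable_maxr; exact: measurable_Rintegrable.
have im : Rintegrable m.
  have s : Rintegrable (fun x => `|f x| + `|g x|).
    exact: (integrableD mD (integrable_norm fi) (integrable_norm gi)).
  apply: le_Rintegrable s _ => // x _; rewrite /m.
  by case: (leP (f x) (g x)) => _; rewrite ?lerDl ?lerDr.
have -> : \int[mu]_(x in D) g x = \int[mu]_(x in D) m x.
  congr fine; apply: ae_eq_integral => //.
  - exact: measurable_int gi.
  - exact/measurable_EFinP.
  - apply: filterS fg => x fg Dx /=; congr EFin.
    by rewrite /m; apply/esym/max_idPr; exact: fg.
by apply: le_Rintegral => // x _; rewrite /m le_max lexx.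
Qed.

Lemma RintegrableD f g : Rintegrable f -> Rintegrable g ->
  Rintegrable (fun x => f x + g x).
Proof. by move=> intf intg; exact: (integrableD mD intf intg). Qed.

Lemma RintegrableB f g : Rintegrable f -> Rintegrable g ->
  Rintegrable (fun x => f x - g x).
Proof. by move=> intf intg; exact: (integrableB mD intf intg). Qed.

Lemma RintegrableZ c f : Rintegrable f -> Rintegrable (fun x => c * f x).
Proof. by move=> intf; exact: (integrableZl mD c intf). Qed.

Lemma eq_Rintegrable f g : (forall x, D x -> f x = g x) -> Rintegrable f ->
  Rintegrable g.
Proof. by move=> fg; apply: eq_integrable => // x /set_mem/fg /= ->. Qed.

Lemma Rintegrable_sum (I : Type) (s : seq I) (F : I -> T -> R) :
  (forall i, Rintegrable (F i)) -> Rintegrable (fun x => \sum_(i <- s) F i x).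
Proof.
move=> iF; elim: s => [|i s IH].
  apply: (@eq_Rintegrable (cst 0)); first by move=> x _; rewrite big_nil.
  exact: integrable0.
apply: (@eq_Rintegrable (fun x => F i x + \sum_(j <- s) F j x)).
  by move=> x _; rewrite big_cons.
exact: RintegrableD.
Qed.

Lemma Rintegral_sum (I : Type) (s : seq I) (F : I -> T -> R) :
  (forall i, Rintegrable (F i)) ->
  \int[mu]_(x in D) (\sum_(i <- s) F i x) =
  \sum_(i <- s) \int[mu]_(x in D) F i x.
Proof.
move=> iF; elim: s => [|i s IH].
  rewrite big_nil (@eq_Rintegral _ _ _ mu D (cst 0)); last by move=> x _; rewrite big_nil.
  by rewrite Rintegral_cst// mul0r.
rewrite big_cons -IH -RintegralD//; [|exact: iF|exact: Rintegrable_sum].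
by apply: eq_Rintegral => x _; rewrite big_cons.
Qed.

Lemma Rintegrable_fineK f : Rintegrable f ->
  (\int[mu]_(x in D) (f x)%:E)%E = (\int[mu]_(x in D) f x)%:E.
Proof. by move=> intf; rewrite fineK// integrable_fin_num. Qed.

Definition L2 f := measurable_fun D f /\ Rintegrable (fun x => f x ^+ 2).

Lemma L2P f : measurable_fun D f ->
  (\int[mu]_(x in D) (f x ^+ 2)%:E < +oo)%E -> L2 f.
Proof.
move=> mf fi; split=> //; apply: RintegrableP; first exact: measurable_funX.
by under eq_integral do rewrite ger0_norm ?sqr_ge0//.
Qed.

Lemma integral_sqr_lty f : L2 f -> (\int[mu]_(x in D) (f x ^+ 2)%:E < +oo)%E.
Proof. by move=> [_ /integrable_lty]; exact. Qed.

Lemma L2_le f g : measurable_fun D f -> L2 g ->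
  (forall x, D x -> `|f x| <= `|g x|) -> L2 f.
Proof.
move=> mf [mg ig] fg; split=> //; apply: le_Rintegrable ig _.
  exact: measurable_funX.
by move=> x Dx; rewrite ger0_norm ?sqr_ge0// ler_sqr_norm fg.
Qed.

Lemma Rintegrable_L2M f g : L2 f -> L2 g -> Rintegrable (fun x => f x * g x).
Proof.
move=> [mf if2] [mg ig2].
apply: (@le_Rintegrable _ (fun x => f x ^+ 2 + g x ^+ 2)).
- exact: measurable_funM.
- exact: RintegrableD.
by move=> x _; rewrite ler_norml; apply/andP; split; nra.
Qed.

Lemma Rintegrable_sqrMb (M : R) f e : L2 f -> measurable_fun D e ->
  (forall x, D x -> `|e x| <= M) -> Rintegrable (fun x => e x * f x ^+ 2).
Proof.
move=> [_ fi2] me eM; apply: eq_Rintegrable (RintegrableMb fi2 me eM) => x _.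
exact: mulrC.
Qed.

Lemma L2Z c f : L2 f -> L2 (fun x => c * f x).
Proof.
move=> [mf if2]; split; first exact: measurable_funM.
apply: (@eq_Rintegrable (fun x => c ^+ 2 * f x ^+ 2)).
  by move=> x _; rewrite exprMn.
exact: RintegrableZ.
Qed.

Lemma L2D f g : L2 f -> L2 g -> L2 (fun x => f x + g x).
Proof.
move=> [mf if2] [mg ig2]; split; first exact: measurable_funD.
apply: (@le_Rintegrable _ (fun x => 2 * (f x ^+ 2 + g x ^+ 2))).
- by apply: measurable_funX; exact: measurable_funD.
- exact/RintegrableZ/RintegrableD.
move=> x _; rewrite ger0_norm ?sqr_ge0// -subr_ge0.
by rewrite (_ : _ - _ = (f x - g x) ^+ 2) ?sqr_ge0//; ring.
Qed.

Lemma L2B f g : L2 f -> L2 g -> L2 (fun x => f x - g x).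
Proof.
move=> lf lg; rewrite (_ : (fun x => _) = fun x => f x + -1 * g x).
  by apply: L2D => //; exact: L2Z.
by apply/funext => x; rewrite mulN1r.
Qed.

(* discriminant of [t |-> \int (t f + g)^2] *)
Lemma Cauchy_Schwarz_Rintegral f g : L2 f -> L2 g ->
  (\int[mu]_(x in D) (f x * g x)) ^+ 2 <=
  (\int[mu]_(x in D) (f x ^+ 2)) * (\int[mu]_(x in D) (g x ^+ 2)).
Proof.
move=> lf lg; set B := \int[mu]_(x in D) _; set A := \int[mu]_(x in D) _.
set C := \int[mu]_(x in D) _.
have A0 : 0 <= A by apply: Rintegral_ge0 => x _; exact: sqr_ge0.
have quad t : 0 <= t ^+ 2 * A + (2 * t) * B + C.
  have if2 := lf.2; have ig2 := lg.2; have ifg := Rintegrable_L2M lf lg.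
  have i1 := RintegrableZ (t ^+ 2) if2; have i2 := RintegrableZ (2 * t) ifg.
  rewrite -(RintegralZl _ mD if2) -(RintegralZl _ mD ifg) -(RintegralD mD i1 i2).
  rewrite -(RintegralD mD (RintegrableD i1 i2) ig2).
  apply: Rintegral_ge0 => x _.
  by rewrite (_ : _ + _ = (t * f x + g x) ^+ 2) ?sqr_ge0//; ring.
have [A00|AN0] := eqVneq A 0.
  have [->|BN0] := eqVneq B 0; first by rewrite expr0n /= A00 mul0r.
  have := quad (- (C + 1) / (2 * B)).
  rewrite A00 mulr0 add0r (_ : 2 * _ * B = - (C + 1)); last by field.
  lra.
have {}A0 : 0 < A by rewrite lt_neqAle eq_sym AN0.
have := quad (- B / A).
rewrite (_ : _ + _ = (A * C - B ^+ 2) / A); last by field.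
by rewrite pmulr_lge0 ?invr_gt0// subr_ge0.
Qed.

Hypothesis finD : (mu D < +oo)%E.

Lemma L2_bounded (M : R) e : measurable_fun D e ->
  (forall x, D x -> `|e x| <= M) -> L2 e.
Proof.
move=> me eM; split=> //.
apply: (@le_Rintegrable _ (cst (M ^+ 2))); first exact: measurable_funX.
  apply: measurable_bounded_integrable => //.
  exists `|M ^+ 2|; split=> [|y /ltW ? x _]; first exact: num_real.
  exact: le_trans.
move=> x Dx; rewrite ger0_norm ?sqr_ge0// ler_sqr_norm (le_trans (eM x Dx))//.
exact: ler_norm.
Qed.

Lemma L2_cst c : L2 (cst c).
Proof. exact: (@L2_bounded `|c|). Qed.

Lemma L2_Rintegrable f : L2 f -> Rintegrable f.
Proof.
move=> lf; apply: (@eq_Rintegrable (fun x => f x * cst 1 x)).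
  by move=> x _; rewrite mulr1.
by apply: Rintegrable_L2M => //; exact: L2_cst.
Qed.

Lemma Rintegrable_bounded (M : R) e : measurable_fun D e ->
  (forall x, D x -> `|e x| <= M) -> Rintegrable e.
Proof. by move=> me eM; apply: L2_Rintegrable; exact: L2_bounded eM. Qed.

End SquareIntegrable.

#[global] Arguments Rintegrable {d T R} mu D f.
#[global] Arguments L2 {d T R} mu D f.

Section SquareIntegrableSubset.
Context {d : measure_display} {T : measurableType d} {R : realType}.
Variable mu : {measure set T -> \bar R}.
Variables (A B : set T).
Hypotheses (mA : measurable A) (mB : measurable B) (AB : A `<=` B).
Implicit Types f : T -> R.

Lemma RintegrableS f : Rintegrable mu B f -> Rintegrable mu A f.
Proof. exact: integrableS. Qed.

Lemma L2S f : L2 mu B f -> L2 mu A f.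
Proof.
move=> [mf fi]; split; last exact: RintegrableS.
exact: measurable_funS mf.
Qed.

Lemma subset_Rintegral f : (forall x, B x -> 0 <= f x) -> Rintegrable mu B f ->
  \int[mu]_(x in A) f x <= \int[mu]_(x in B) f x.
Proof.
move=> f0 fi; rewrite -lee_fin -!Rintegrable_fineK//; last exact: RintegrableS.
apply: ge0_subset_integral => //.
exact: measurable_int fi.
Qed.

End SquareIntegrableSubset.

Section DominatedConvergence.
Context {d : measure_display} {T : measurableType d} {R : realType}.
Variable mu : {measure set T -> \bar R}.
Variable D : set T.
Hypothesis mD : measurable D.

Lemma dominated_cvg_Rintegral (f_ : nat -> T -> R) (f G : T -> R) :
  (forall n, measurable_fun D (f_ n)) -> Rintegrable mu D G ->
  (forall x, D x -> f_ n x @[n --> \oo] --> f x) ->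
  (forall n x, D x -> `|f_ n x| <= G x) ->
  \int[mu]_(x in D) f_ n x @[n --> \oo] --> \int[mu]_(x in D) f x.
Proof.
move=> mf_ iG f_f f_G.
have mf : measurable_fun D f by exact: (measurable_fun_cvg mf_).
have f_Gi n : Rintegrable mu D (f_ n) by apply: le_Rintegrable iG _ => //; exact: f_G.
have fi : Rintegrable mu D f.
  apply: le_Rintegrable iG _ => // x Dx.
  apply: (@closed_cvg _ _ \oo eventually_filter (fun n => `|f_ n x|) [set y | y <= G x]).
  - exact: closed_le.
  - by apply: nearW => n; exact: f_G.
  - by apply: cvg_norm; exact: f_f.
have [] := @dominated_convergence _ _ _ mu D mD (fun n => EFin \o f_ n)
  (EFin \o f) (EFin \o G) _ _ _ iG _.
- by move=> n; exact/measurable_EFinP.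
- exact/measurable_EFinP.
- by apply: aeW => x Dx; apply: cvg_EFin; [exact: nearW|exact: f_f].
- by apply: aeW => x n Dx; rewrite lee_fin f_G.
move=> _ _; rewrite /= Rintegrable_fineK// => /fine_cvg.
by rewrite /Rintegral.
Qed.

End DominatedConvergence.

Lemma ge0_le_integral_nonmeasurable d (T : measurableType d) (R : realType)
    (mu : {measure set T -> \bar R}) (D : set T) (f g : T -> \bar R) :
  (forall x, D x -> (0 <= f x)%E) -> (forall x, D x -> (f x <= g x)%E) ->
  (\int[mu]_(x in D) f x <= \int[mu]_(x in D) g x)%E.
Proof.
move=> f0 fg; rewrite !ge0_integralE//; last first.
  by move=> x Dx; exact: le_trans (f0 x Dx) (fg x Dx).
apply: ge_ereal_sup => _ [h hf <-]; apply: ereal_sup_ubound.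
exists h => // x; apply: le_trans (hf x) _; rewrite !patchE.
by case: ifPn => // /set_mem; exact: fg.
Qed.

Lemma integralT_support d (T : measurableType d) (R : realType)
    (mu : {measure set T -> \bar R}) (D : set T) (f : T -> \bar R) :
  (forall x, ~ D x -> f x = 0%E) ->
  (\int[mu]_x f x = \int[mu]_(x in D) f x)%E.
Proof.
move=> f0; rewrite [RHS]integral_mkcond; apply: eq_integral => x _.
by rewrite patchE; case: ifPn => // /negP xD; rewrite f0// => /mem_set.
Qed.

Section IteratedIntegrals.
Context {d1 d2 : measure_display} {T1 : measurableType d1} {T2 : measurableType d2}.
Context {R : realType}.
Local Open Scope ereal_scope.
Variables (m1 : {sigma_finite_measure set T1 -> \bar R}).
Variables (m2 : {sigma_finite_measure set T2 -> \bar R}).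
Variables (A : set T1) (B : set T2).
Hypotheses (mA : measurable A) (mB : measurable B).

Lemma measurable_section_integral (F : T1 * T2 -> \bar R) :
  measurable_fun setT F -> (forall p, 0 <= F p) ->
  measurable_fun setT (fun x => \int[m2]_(y in B) F (x, y)).
Proof.
move=> mF F0; pose G (p : T1 * T2) := F p * (\1_B p.2)%:E.
have mG : measurable_fun setT G.
  apply: emeasurable_funM => //; apply/measurable_EFinP.
  by apply: measurableT_comp; [exact: measurable_indic|exact: measurable_snd].
have -> : (fun x => \int[m2]_(y in B) F (x, y)) = (fun x => \int[m2]_y G (x, y)).
  apply/funext => x; rewrite integral_mkcond; apply: eq_integral => y _.
  by rewrite patchE /G /= indicE; case: (y \in B); rewrite ?mule1 ?mule0.
have := @measurable_fun_fubini_tonelli_F _ _ _ _ R m2 G mG.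
by apply=> p; rewrite mule_ge0// lee_fin.
Qed.

Lemma iterated_integral_lim_le (F : nat -> T1 * T2 -> \bar R) (c : \bar R) :
  (forall n, measurable_fun setT (F n)) -> (forall n p, 0 <= F n p) ->
  (forall p, nondecreasing_seq (F ^~ p)) ->
  (forall n, \int[m1]_(x in A) \int[m2]_(y in B) F n (x, y) <= c) ->
  \int[m1]_(x in A) \int[m2]_(y in B) limn (F ^~ (x, y)) <= c.
Proof.
move=> mF F0 ndF Fc.
have ndI x : nondecreasing_seq (fun n => \int[m2]_(y in B) F n (x, y)).
  by move=> n m nm; apply: ge0_le_integral_nonmeasurable => // y _; exact: ndF.
have mI n : measurable_fun A (fun x => \int[m2]_(y in B) F n (x, y)).
  by apply: measurable_funTS; exact: measurable_section_integral.
have limI x : \int[m2]_(y in B) limn (F ^~ (x, y)) =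
    limn (fun n => \int[m2]_(y in B) F n (x, y)).
  apply: (monotone_convergence m2 mB) => // n.
  by apply: measurable_funTS; apply: measurableT_comp => //; exact: pair1_measurable.
under eq_integral do rewrite limI.
rewrite (monotone_convergence m1 mA)//; last by move=> n x _; exact: integral_ge0.
apply: lime_le; last exact: nearW.
apply: ereal_nondecreasing_is_cvgn => n m nm.
apply: ge0_le_integral_nonmeasurable => x _; first exact: integral_ge0.
exact: ndI.
Qed.

End IteratedIntegrals.

Lemma measurable_fun_inv (R : realType) : measurable_fun setT (@GRing.inv R).
Proof.
have <- : [set 0 : measurableTypeR R] `|` ~` [set 0] = setT by rewrite setUv.
apply/measurable_funU => //; first exact: measurableC.
split; first exact: measurable_fun_set1.
apply: open_continuous_measurable_fun.
  by rewrite openC; exact: closed_eq.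
by move=> x /set_mem/= /eqP x0; exact: inv_continuous.
Qed.

Section OrthogonalSystem.
Context {d : measure_display} {T : measurableType d} {R : realType}.
Variable mu : {measure set T -> \bar R}.
Variable D : set T.
Hypothesis mD : measurable D.
Variables (e : nat -> T -> R) (c : nat -> R).
Hypotheses (Le : forall n, L2 mu D (e n)) (c_gt0 : forall n, 0 < c n).
Hypothesis orthogonal_e :
  forall m n, \int[mu]_(x in D) (e m x * e n x) = c n *+ (m == n).
Implicit Types f g : T -> R.

Definition fourier_coef f n : R := \int[mu]_(x in D) (f x * e n x).

Definition mode_energy f n : R := fourier_coef f n ^+ 2 / c n.

Definition fourier_remainder f M (x : T) : R :=
  f x - \sum_(n < M) fourier_coef f n / c n * e n x.

Definition Bessel_defect f M : R :=
  \int[mu]_(x in D) (f x ^+ 2) - \sum_(n < M) mode_energy f n.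

Lemma mode_energy_ge0 f n : 0 <= mode_energy f n.
Proof. by rewrite divr_ge0 ?sqr_ge0// ltW. Qed.

Lemma fourier_coefD f g n : L2 mu D f -> L2 mu D g ->
  fourier_coef (fun x => f x + g x) n = fourier_coef f n + fourier_coef g n.
Proof.
move=> Lf Lg; rewrite /fourier_coef -RintegralD//; try exact: Rintegrable_L2M.
by apply: eq_Rintegral => x _; rewrite mulrDl.
Qed.

Lemma fourier_remainderS f M x : fourier_remainder f M.+1 x =
  fourier_remainder f M x - fourier_coef f M / c M * e M x.
Proof. by rewrite /fourier_remainder big_ord_recr/= opprD addrA. Qed.

Lemma fourier_remainderD f g M x : L2 mu D f -> L2 mu D g ->
  fourier_remainder (fun x => f x + g x) M x =
  fourier_remainder f M x + fourier_remainder g M x.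
Proof.
move=> Lf Lg; elim: M => [|M IH]; first by rewrite /fourier_remainder !big_ord0; ring.
by rewrite !fourier_remainderS IH fourier_coefD//; ring.
Qed.

Lemma L2_fourier_remainder f M : L2 mu D f -> L2 mu D (fourier_remainder f M).
Proof.
move=> Lf; elim: M => [|M IH].
  rewrite (_ : fourier_remainder f 0 = f)//.
  by apply/funext => x; rewrite /fourier_remainder big_ord0 subr0.
rewrite (_ : fourier_remainder f M.+1 =
    fun x => fourier_remainder f M x - fourier_coef f M / c M * e M x).
  by apply: L2B => //; exact: L2Z.
by apply/funext => x; exact: fourier_remainderS.
Qed.

Lemma fourier_coef_remainder f M n : L2 mu D f -> (M <= n)%N ->
  fourier_coef (fourier_remainder f M) n = fourier_coef f n.
Proof.
move=> Lf; elim: M => [_|M IH Mn].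
  by apply: eq_Rintegral => x _; rewrite /fourier_remainder big_ord0 subr0.
have ir := Rintegrable_L2M mD (L2_fourier_remainder M Lf) (Le n).
have ie := Rintegrable_L2M mD (Le M) (Le n).
rewrite -[RHS](IH (ltnW Mn)) /fourier_coef; transitivity (\int[mu]_(x in D)
    (fourier_remainder f M x * e n x - fourier_coef f M / c M * (e M x * e n x))).
  by apply: eq_Rintegral => x _; rewrite fourier_remainderS mulrBl mulrA.
rewrite (RintegralB mD ir (RintegrableZ mD _ ie)) (RintegralZl _ mD ie).
by rewrite orthogonal_e (ltn_eqF Mn) mulr0n mulr0 subr0.
Qed.

Lemma Rintegral_sqr_remainder f M : L2 mu D f ->
  \int[mu]_(x in D) (fourier_remainder f M x ^+ 2) = Bessel_defect f M.
Proof.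
move=> Lf; elim: M => [|M IH].
  rewrite /Bessel_defect big_ord0 subr0; apply: eq_Rintegral => x _.
  by rewrite /fourier_remainder big_ord0 subr0.
set t := fourier_coef f M / c M; have Lr := L2_fourier_remainder M Lf.
have ire := Rintegrable_L2M mD Lr (Le M).
transitivity (\int[mu]_(x in D) (fourier_remainder f M x ^+ 2 -
    2 * t * (fourier_remainder f M x * e M x) + t ^+ 2 * e M x ^+ 2)).
  by apply: eq_Rintegral => x _; rewrite fourier_remainderS -/t; ring.
have ie := (Le M).2; have it := RintegrableZ mD (2 * t) ire.
rewrite (RintegralD mD (RintegrableB mD Lr.2 it) (RintegrableZ mD _ ie)).
rewrite (RintegralB mD Lr.2 it) !RintegralZl// IH.
rewrite -/(fourier_coef _ M) fourier_coef_remainder//.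
have -> : \int[mu]_(x in D) (e M x ^+ 2) = c M.
  by rewrite -[RHS](mulrb _ true) -[in RHS](eqxx M) -orthogonal_e.
rewrite /Bessel_defect big_ord_recr/= /mode_energy /t.
by field; rewrite gt_eqF.
Qed.

Lemma Bessel_defect_ge0 f M : L2 mu D f -> 0 <= Bessel_defect f M.
Proof.
move=> Lf; rewrite -Rintegral_sqr_remainder//.
by apply: Rintegral_ge0 => x _; exact: sqr_ge0.
Qed.

Lemma Bessel f M : L2 mu D f ->
  \sum_(n < M) mode_energy f n <= \int[mu]_(x in D) (f x ^+ 2).
Proof. by move=> Lf; rewrite -subr_ge0; exact: Bessel_defect_ge0. Qed.

Lemma Bessel_defect_nonincreasing f : nonincreasing_seq (Bessel_defect f).
Proof.
move=> M N MN; rewrite /Bessel_defect lerD2l lerN2.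
rewrite -(subnKC MN) big_split_ord/= lerDl.
by apply: sumr_ge0 => i _; exact: mode_energy_ge0.
Qed.

Lemma Bessel_defect_le f M : Bessel_defect f M <= \int[mu]_(x in D) (f x ^+ 2).
Proof. by rewrite gerBl; apply: sumr_ge0 => n _; exact: mode_energy_ge0. Qed.

Lemma Bessel_defect_perturb f g M : L2 mu D f -> L2 mu D g ->
  Bessel_defect f M <=
  2 * Bessel_defect g M + 2 * \int[mu]_(x in D) ((f x - g x) ^+ 2).
Proof.
move=> Lf Lg; have Lfg := L2B mD Lf Lg.
have Lrg := L2_fourier_remainder M Lg; have Lrfg := L2_fourier_remainder M Lfg.
have rE x : fourier_remainder f M x =
    fourier_remainder g M x + fourier_remainder (fun x => f x - g x) M x.
  rewrite -fourier_remainderD//; congr (fourier_remainder _ _ _).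
  by apply/funext => y; rewrite addrC subrK.
apply: (@le_trans _ _ (2 * Bessel_defect g M +
    2 * Bessel_defect (fun x => f x - g x) M)); last first.
  by rewrite lerD2l ler_wpM2l// Bessel_defect_le.
rewrite -!Rintegral_sqr_remainder// -!RintegralZl//; [|exact: Lrfg.2|exact: Lrg.2].
have ig := RintegrableZ mD 2 Lrg.2; have ifg := RintegrableZ mD 2 Lrfg.2.
rewrite -(RintegralD mD ig ifg); apply: le_Rintegral => //.
- exact: (L2_fourier_remainder M Lf).2.
- exact: RintegrableD.
move=> x _; rewrite rE; set a := fourier_remainder g M x.
set b := fourier_remainder _ M x; rewrite -subr_ge0.
by rewrite (_ : _ - _ = (a - b) ^+ 2) ?sqr_ge0//; ring.
Qed.

Hypothesis finD : (mu D < +oo)%E.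
Hypothesis e_le1 : forall n x, D x -> `|e n x| <= 1.
Hypothesis e0 : forall x, D x -> e 0 x = 1.
Variables (rho : nat -> R) (M : nat).

Definition multiplier_kernel x y : R :=
  \sum_(i < M.+1) rho i / c i * (e i x * e i y).

Definition multiplier f x : R :=
  \sum_(i < M.+1) rho i / c i * fourier_coef f i * e i x.

Lemma RintegrableMe f n : Rintegrable mu D f -> Rintegrable mu D (fun x => f x * e n x).
Proof. by move=> fi; apply: (RintegrableMb mD fi (Le n).1) => x; exact: e_le1. Qed.

Let RintegrableZMe f (t : nat -> R) (i : 'I_M.+1) : Rintegrable mu D f ->
  Rintegrable mu D (fun x => t i * (f x * e i x)).
Proof. by move=> fi; apply: RintegrableZ => //; exact: RintegrableMe. Qed.

Let mulr_suml_e f (t : nat -> R) x :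
  f x * (\sum_(i < M.+1) t i * e i x) = \sum_(i < M.+1) t i * (f x * e i x).
Proof. by rewrite mulr_sumr; apply: eq_bigr => i _; rewrite mulrCA. Qed.

Let Rintegrable_mul_sum_e f (t : nat -> R) : Rintegrable mu D f ->
  Rintegrable mu D (fun x => f x * (\sum_(i < M.+1) t i * e i x)).
Proof.
move=> fi; apply: (@eq_Rintegrable _ _ _ mu D mD
  (fun x => \sum_(i < M.+1) t i * (f x * e i x))) => [x _|].
  by rewrite mulr_suml_e.
by apply: Rintegrable_sum => // i; exact: RintegrableZMe.
Qed.

Let Rintegral_mul_sum_e f (t : nat -> R) : Rintegrable mu D f ->
  \int[mu]_(x in D) (f x * (\sum_(i < M.+1) t i * e i x)) =
  \sum_(i < M.+1) t i * fourier_coef f i.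
Proof.
move=> fi; transitivity (\int[mu]_(x in D) (\sum_(i < M.+1) t i * (f x * e i x))).
  by apply: eq_Rintegral => x _; rewrite mulr_suml_e.
rewrite Rintegral_sum//; last by move=> i; exact: RintegrableZMe.
by apply: eq_bigr => i _; rewrite RintegralZl//; exact: RintegrableMe.
Qed.

Let multiplier_kernelE x y :
  multiplier_kernel x y = \sum_(i < M.+1) (rho i / c i * e i x) * e i y.
Proof. by apply: eq_bigr => i _; rewrite mulrA. Qed.

Lemma Rintegrable_multiplier_kernel f x : Rintegrable mu D f ->
  Rintegrable mu D (fun y => f y * multiplier_kernel x y).
Proof.
move=> fi; apply: (eq_Rintegrable mD) (Rintegrable_mul_sum_e
  (fun i => rho i / c i * e i x) fi) => y _.
by rewrite multiplier_kernelE.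
Qed.

Lemma Rintegral_multiplier_kernel f x : Rintegrable mu D f ->
  \int[mu]_(y in D) (f y * multiplier_kernel x y) = multiplier f x.
Proof.
move=> fi; under eq_Rintegral do rewrite multiplier_kernelE.
rewrite (Rintegral_mul_sum_e (fun i => rho i / c i * e i x) fi).
by apply: eq_bigr => i _; rewrite mulrAC.
Qed.

Lemma Rintegrable_multiplier f g : Rintegrable mu D f ->
  Rintegrable mu D (fun x => f x * multiplier g x).
Proof. exact: (Rintegrable_mul_sum_e (fun i => rho i / c i * fourier_coef g i)). Qed.

Lemma Rintegral_multiplier f g : Rintegrable mu D f ->
  \int[mu]_(x in D) (f x * multiplier g x) =
  \sum_(i < M.+1) rho i / c i * (fourier_coef g i * fourier_coef f i).
Proof.
move=> fi; rewrite (Rintegral_mul_sum_e (fun i => rho i / c i * fourier_coef g i) fi).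
by apply: eq_bigr => i _; rewrite mulrA.
Qed.

Lemma fourier_coef_cst (k : R) n : fourier_coef (cst k) n = k * c 0 *+ (n == 0).
Proof.
rewrite -mulrnAr; have [->|n0] := eqVneq n 0.
  rewrite mulr1n -[c 0]mulr1n -(orthogonal_e 0 0) -RintegralZl//.
    by apply: eq_Rintegral => x /set_mem Dx; rewrite !e0// !mulr1.
  exact: Rintegrable_L2M.
rewrite /fourier_coef RintegralZl//; last exact: L2_Rintegrable.
have := orthogonal_e n 0; rewrite (negbTE n0) !mulr0n => <-; congr (_ * _).
by apply: eq_Rintegral => x /set_mem Dx; rewrite e0// mulr1.
Qed.

Lemma multiplier_cst (k : R) x : D x -> multiplier (cst k) x = rho 0 * k.
Proof.
move=> Dx; rewrite /multiplier big_ord_recl big1 ?addr0 => [|i _].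
  rewrite fourier_coef_cst e0//= mulr1n mulr1.
  by field; rewrite gt_eqF.
by rewrite fourier_coef_cst/= mulr0n mulr0 mul0r.
Qed.

Definition kernel_variation f x : R :=
  rho 0 * f x ^+ 2 - 2 * (f x * multiplier f x) + multiplier (fun y => f y ^+ 2) x.

Definition dirichlet_form f : R :=
  2 * (rho 0 * (\int[mu]_(x in D) (f x ^+ 2)) -
       \sum_(i < M.+1) rho i * mode_energy f i).

Lemma Rintegrable_sqrB_kernel f x : L2 mu D f ->
  Rintegrable mu D (fun y => (f x - f y) ^+ 2 * multiplier_kernel x y).
Proof.
move=> Lf; apply: Rintegrable_multiplier_kernel.
suff [_] : L2 mu D (fun y => f x - f y) by [].
by apply: L2B => //; exact: L2_cst.
Qed.

Lemma Rintegral_sqrB_kernel f x : L2 mu D f -> D x ->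
  \int[mu]_(y in D) ((f x - f y) ^+ 2 * multiplier_kernel x y) =
  kernel_variation f x.
Proof.
move=> Lf Dx; have fi := L2_Rintegrable mD finD Lf; have [_ f2i] := Lf.
have i1 := Rintegrable_multiplier_kernel x (L2_Rintegrable mD finD (L2_cst mD finD 1)).
have i2 := Rintegrable_multiplier_kernel x fi.
have i3 := Rintegrable_multiplier_kernel x f2i.
have i1' := RintegrableZ mD (f x ^+ 2) i1.
have i2' := RintegrableZ mD (2 * f x) i2.
transitivity (\int[mu]_(y in D) (f x ^+ 2 * (cst 1 y * multiplier_kernel x y) -
    2 * f x * (f y * multiplier_kernel x y) + f y ^+ 2 * multiplier_kernel x y)).
  by apply: eq_Rintegral => y _ /=; ring.
rewrite (RintegralD mD (RintegrableB mD i1' i2') i3) (RintegralB mD i1' i2').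
rewrite (RintegralZl _ mD i1) (RintegralZl _ mD i2).
rewrite !Rintegral_multiplier_kernel//; last exact/L2_Rintegrable/L2_cst.
by rewrite multiplier_cst// /kernel_variation; ring.
Qed.

Lemma Rintegrable_kernel_variation f : L2 mu D f ->
  Rintegrable mu D (kernel_variation f).
Proof.
move=> Lf; have fi := L2_Rintegrable mD finD Lf; have [_ f2i] := Lf.
apply: RintegrableD => //.
  apply: RintegrableB => //; first exact: RintegrableZ.
  by apply: RintegrableZ => //; exact: Rintegrable_multiplier.
have := Rintegrable_multiplier (fun y => f y ^+ 2)
  (L2_Rintegrable mD finD (L2_cst mD finD 1)).
by apply: eq_Rintegrable => // x _; rewrite mul1r.
Qed.

Lemma Rintegral_kernel_variation f : L2 mu D f ->
  \int[mu]_(x in D) kernel_variation f x = dirichlet_form f.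
Proof.
move=> Lf; have fi := L2_Rintegrable mD finD Lf; have [_ f2i] := Lf.
have i1 := RintegrableZ mD (rho 0) f2i.
have i2 := RintegrableZ mD 2 (Rintegrable_multiplier f fi).
have ci := L2_Rintegrable mD finD (L2_cst mD finD 1).
have i3 := Rintegrable_multiplier (fun y => f y ^+ 2) ci.
transitivity (\int[mu]_(x in D) (rho 0 * f x ^+ 2 - 2 * (f x * multiplier f x) +
    cst 1 x * multiplier (fun y => f y ^+ 2) x)).
  by apply: eq_Rintegral => x _; rewrite /kernel_variation mul1r.
rewrite (RintegralD mD (RintegrableB mD i1 i2) i3) (RintegralB mD i1 i2).
rewrite (RintegralZl _ mD f2i) (RintegralZl _ mD (Rintegrable_multiplier f fi)).
rewrite !Rintegral_multiplier// [X in _ + X]big_ord_recl/=.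
rewrite [X in _ + (_ + X)]big1 ?addr0 => [|i _]; last first.
  by rewrite fourier_coef_cst/= mulr0n !mulr0.
have -> : fourier_coef (fun y => f y ^+ 2) 0 = \int[mu]_(x in D) (f x ^+ 2).
  by apply: eq_Rintegral => x /set_mem Dx; rewrite e0// mulr1.
rewrite fourier_coef_cst /dirichlet_form /mode_energy mulr1n mul1r.
have -> : \sum_(i < M.+1) rho i / c i * (fourier_coef f i * fourier_coef f i) =
    \sum_(i < M.+1) rho i * (fourier_coef f i ^+ 2 / c i).
  by apply: eq_bigr => i _; rewrite -expr2 mulrAC mulrA.
by field; rewrite gt_eqF.
Qed.

Lemma dirichlet_form_le f q (r n : R) : L2 mu D f -> L2 mu D q ->
  (forall x y, D x -> D y -> 0 <= multiplier_kernel x y) ->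
  (forall x y, D x -> D y -> (f x - f y) ^+ 2 <= r + n * (q x - q y) ^+ 2) ->
  dirichlet_form f <= r * rho 0 * c 0 + n * dirichlet_form q.
Proof.
move=> Lf Lq k0 fq; have ci := L2_Rintegrable mD finD (L2_cst mD finD 1).
have variation_le x : D x ->
    kernel_variation f x <= r * rho 0 + n * kernel_variation q x.
  move=> Dx; rewrite -!Rintegral_sqrB_kernel//.
  have i1 := RintegrableZ mD r (Rintegrable_multiplier_kernel x ci).
  have i2 := RintegrableZ mD n (Rintegrable_sqrB_kernel x Lq).
  rewrite -[rho 0]mulr1 -(multiplier_cst 1 Dx) -Rintegral_multiplier_kernel//.
  rewrite -!RintegralZl//;
    [|exact: Rintegrable_sqrB_kernel|exact: Rintegrable_multiplier_kernel].
  rewrite -(RintegralD mD i1 i2); apply: le_Rintegral => //.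
  - exact: Rintegrable_sqrB_kernel.
  - exact: RintegrableD.
  by move=> y Dy; rewrite mul1r mulrA -mulrDl ler_wpM2r ?k0// fq.
have cD : \int[mu]_(x in D) cst 1 x = c 0.
  rewrite -[RHS]mul1r -[RHS](mulrb _ true) -(fourier_coef_cst 1 0).
  by apply: eq_Rintegral => x /set_mem Dx; rewrite e0// mulr1.
have iq := RintegrableZ mD n (Rintegrable_kernel_variation Lq).
have i1 := RintegrableZ mD (r * rho 0) ci.
rewrite -cD -!Rintegral_kernel_variation// -!RintegralZl//; last first.
  exact: Rintegrable_kernel_variation.
rewrite -(RintegralD mD i1 iq); apply: le_Rintegral => //.
- exact: Rintegrable_kernel_variation.
- exact: RintegrableD.
by move=> x Dx; rewrite /= mulr1; exact: variation_le.
Qed.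

End OrthogonalSystem.

Section SmoothFunctions.
Variable R : realType.
Implicit Types (f g : R -> R) (x a b c : R).

Lemma derivable_continuous f : (forall x, derivable f x 1) -> continuous f.
Proof. by move=> df x; exact/differentiable_continuous/derivable1_diffP/df. Qed.

Lemma is_derive1_affine a b x : is_derive x 1 (fun x => a * x + b) a.
Proof.
rewrite -[X in is_derive _ _ _ X]addr0; apply: is_deriveD.
by rewrite -[X in is_derive _ _ _ X]mulr1; exact: is_deriveZ.
Qed.

Lemma is_derive1_comp_affine f a b x (df : R) : is_derive (a * x + b) 1 f df ->
  is_derive x 1 (fun x => f (a * x + b)) (df * a).
Proof.
move=> fdf; have daff := is_derive1_affine a b x.
exact: (@is_derive1_comp _ f (fun x => a * x + b)).
Qed.

Lemma derive1_comp_affine f a b x : derivable f (a * x + b) 1 ->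
  derive1 (fun x => f (a * x + b)) x = a * derive1 f (a * x + b).
Proof.
move=> /derivableP/is_derive1_comp_affine dfE.
by rewrite derive1E (@derive_val _ _ _ _ _ _ _ dfE) derive1E mulrC.
Qed.

Lemma near_cst_derive1 f c x : (\forall t \near x, f t = c) -> derive1 f x = 0.
Proof.
move=> fc; rewrite derive1E (@near_eq_derive _ _ _ _ (cst c))//.
exact: derive_cst.
Qed.

Fixpoint Cn_fun (k : nat) f : Prop :=
  if k is k'.+1 then (forall x, derivable f x 1) /\ Cn_fun k' (derive1 f)
  else continuous f.

Definition smooth f := forall k, Cn_fun k f.

Lemma is_derive_Cn_fun k f (df : R -> R) : (forall x, is_derive x 1 f (df x)) ->
  Cn_fun k df -> Cn_fun k.+1 f.
Proof.
move=> fdf dfk; split; first by move=> x; have [] := fdf x.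
by rewrite (_ : derive1 f = df)//; apply/funext => x; rewrite derive1E derive_val.
Qed.

Lemma Cn_fun_is_derive k f x : Cn_fun k.+1 f -> is_derive x 1 f (derive1 f x).
Proof. by move=> [df _]; rewrite derive1E; exact/derivableP. Qed.

Lemma Cn_funW k f : Cn_fun k.+1 f -> Cn_fun k f.
Proof.
elim: k f => [|k IH] f [df fk]; first exact: derivable_continuous.
by split=> //; exact: IH.
Qed.

Lemma Cn_fun_cst k c : Cn_fun k (cst c).
Proof.
elim: k c => [|k IH] c; first by move=> x; exact: cst_continuous.
by apply: (@is_derive_Cn_fun _ _ (cst 0)).
Qed.

Lemma Cn_funD k f g : Cn_fun k f -> Cn_fun k g -> Cn_fun k (fun x => f x + g x).
Proof.
elim: k f g => [|k IH] f g.
  by move=> cf cg x; apply: continuousD; [exact: cf|exact: cg].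
move=> fk gk; apply: (@is_derive_Cn_fun _ _ (fun x => derive1 f x + derive1 g x)).
  by move=> x; exact: (is_deriveD (Cn_fun_is_derive x fk) (Cn_fun_is_derive x gk)).
by apply: IH; [case: fk|case: gk].
Qed.

Lemma Cn_funM k f g : Cn_fun k f -> Cn_fun k g -> Cn_fun k (fun x => f x * g x).
Proof.
elim: k f g => [|k IH] f g.
  by move=> cf cg x; apply: continuousM; [exact: cf|exact: cg].
move=> fk gk.
apply: (@is_derive_Cn_fun _ _ (fun x => f x * derive1 g x + g x * derive1 f x)).
  by move=> x; exact: (is_deriveM (Cn_fun_is_derive x fk) (Cn_fun_is_derive x gk)).
by apply: Cn_funD; apply: IH; [exact: Cn_funW|case: gk|exact: Cn_funW|case: fk].
Qed.

Lemma Cn_fun_affine k f a b : Cn_fun k f -> Cn_fun k (fun x => f (a * x + b)).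
Proof.
elim: k f => [f cf x|k IH f fk].
  have [daff _] := is_derive1_affine a b x.
  apply: (@continuous_comp _ _ _ (fun x => a * x + b) f); last exact: cf.
  exact/differentiable_continuous/derivable1_diffP.
have dfa x : is_derive x 1 (fun x => f (a * x + b)) (derive1 f (a * x + b) * a).
  by apply: is_derive1_comp_affine; exact: Cn_fun_is_derive fk.
apply: is_derive_Cn_fun dfa _.
by apply: Cn_funM; [apply: IH; case: fk|exact: Cn_fun_cst].
Qed.

Lemma Cn_funV k f : (forall x, f x != 0) -> Cn_fun k f ->
  Cn_fun k (fun x => (f x)^-1).
Proof.
move=> f0; elim: k => [|k IH]; first by move=> cf x; apply: continuousV => //; exact: cf.
move=> fk; have ifk := IH (Cn_funW fk).
have dfV x : is_derive x 1 (fun x => (f x)^-1)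
    (-1 * derive1 f x * ((f x)^-1 * (f x)^-1)).
  have := is_deriveV (f0 x) (Cn_fun_is_derive x fk).
  move=> /is_derive_eq; apply.
  by rewrite /GRing.scale /= mulN1r -exprVn expr2 mulNr mulrC mulrN.
apply: is_derive_Cn_fun dfV _.
apply: (Cn_funM (Cn_funM (Cn_fun_cst k (-1)) _) (Cn_funM ifk ifk)).
by case: fk.
Qed.

Lemma smooth_stable (S : (R -> R) -> Prop) :
  (forall f, S f -> exists2 df, S df & forall x, is_derive x 1 f (df x)) ->
  forall f, S f -> smooth f.
Proof.
move=> SS f Sf k; elim: k f Sf => [|k IH] f Sf.
  have [df _ dfP] := SS _ Sf.
  by apply: derivable_continuous => x; have [] := dfP x.
by have [df /IH ? dfP] := SS _ Sf; exact: is_derive_Cn_fun dfP _.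
Qed.

Lemma smooth_derive1 f : smooth f -> smooth (derive1 f).
Proof. by move=> sf k; have [] := sf k.+1. Qed.

Lemma smooth_derivable f x : smooth f -> derivable f x 1.
Proof. by move=> /(_ 1%N)[+ _]; exact. Qed.

Lemma smooth_is_derive f x : smooth f -> is_derive x 1 f (derive1 f x).
Proof. by move=> sf; exact: Cn_fun_is_derive (sf 1%N). Qed.

Lemma smooth_continuous f : smooth f -> continuous f.
Proof. by move=> /(_ 0%N). Qed.

Lemma smooth_cst c : smooth (cst c).
Proof. by move=> k; exact: Cn_fun_cst. Qed.

Lemma smooth_id : smooth (@id R).
Proof.
move=> [|k]; first by move=> x; exact: cvg_id.
apply: is_derive_Cn_fun (fun x => is_derive_id x 1) _; exact: Cn_fun_cst.
Qed.

Lemma smoothD f g : smooth f -> smooth g -> smooth (fun x => f x + g x).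
Proof. by move=> sf sg k; exact: Cn_funD. Qed.

Lemma smoothM f g : smooth f -> smooth g -> smooth (fun x => f x * g x).
Proof. by move=> sf sg k; exact: Cn_funM. Qed.

Lemma smoothB f g : smooth f -> smooth g -> smooth (fun x => f x - g x).
Proof.
move=> sf sg; rewrite (_ : (fun x => _) = (fun x => f x + cst (-1) x * g x)).
  by apply: smoothD => //; apply: smoothM => //; exact: smooth_cst.
by apply/funext => x; rewrite mulN1r.
Qed.

Lemma smooth_affine f a b : smooth f -> smooth (fun x => f (a * x + b)).
Proof. by move=> sf k; exact: Cn_fun_affine. Qed.

Lemma smooth_sin_cos : smooth (@sin R) /\ smooth (@cos R).
Proof.
pose S f := exists a b : R, f = (fun x => a * sin x + b * cos x).
have Ssm f : S f -> smooth f.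
  apply: (@smooth_stable S) => {f} _ [a [b ->]].
  exists (fun x => - b * sin x + a * cos x); first by exists (- b), a.
  move=> x.
  have := is_deriveD (@is_deriveZ _ _ _ _ a _ _ _ (is_derive_sin x))
                     (@is_deriveZ _ _ _ _ b _ _ _ (is_derive_cos x)).
  by move=> /is_derive_eq; apply; rewrite /GRing.scale /= mulrN mulNr addrC.
split; apply: Ssm.
  by exists 1, 0; apply/funext => x; rewrite mul1r mul0r addr0.
by exists 0, 1; apply/funext => x; rewrite mul1r mul0r add0r.
Qed.

End SmoothFunctions.

Section SmoothCutoffs.
Variable R : realType.
Implicit Types (p : {poly R}) (f b q : R -> R) (x t l r e : R).

(* [p(1/t) exp(-1/t)] extended by [0]: with [p] arbitrary, the family is stable
   under derivation *)
Definition flat p t : R := if 0 < t then p.[t^-1] * expR (- t^-1) else 0.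

Lemma flat_le0 p t : t <= 0 -> flat p t = 0.
Proof. by move=> t0; rewrite /flat ltNge t0. Qed.

Lemma flat1_gt0 t : 0 < t -> 0 < flat 1 t.
Proof. by move=> t0; rewrite /flat t0 hornerE mul1r expR_gt0. Qed.

Lemma flat1_ge0 t : 0 <= flat 1 t.
Proof. by have [/flat1_gt0/ltW//|/flat_le0 ->] := ltP 0 t. Qed.

Lemma exprn_expRN_le (n : nat) (s : R) : 0 <= s -> s ^+ n * expR (- s) <= n`!%:R.
Proof.
move=> s0; rewrite expRN ler_pdivrMr ?expR_gt0//.
case: n => [|n].
  by rewrite expr0 fact0 mul1r (le_trans _ (expR_ge1Dx s))// lerDl.
rewrite mulrC -ler_pdivrMr ?ltr0n ?fact_gt0//.
by apply: le_trans (expR_ge1Dxn n s0); rewrite lerDr ler01.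
Qed.

Lemma flat_le_sqr p : exists2 C : R, 0 <= C & forall t, `|flat p t| <= C * t ^+ 2.
Proof.
exists (\sum_(i < size p) `|p`_i| * (i.+2)`!%:R).
  by apply: sumr_ge0 => i _; rewrite mulr_ge0.
move=> t; rewrite /flat; case: ifPn => t0; last first.
  rewrite normr0 mulr_ge0 ?sqr_ge0//.
  by apply: sumr_ge0 => i _; rewrite mulr_ge0.
rewrite horner_coef mulr_suml mulr_suml.
apply: le_trans (ler_norm_sum _ _ _) _; apply: ler_sum => i _.
rewrite !normrM -!mulrA ler_wpM2l//.
rewrite -ler_pdivrMr ?exprn_gt0// ger0_norm ?exprn_ge0 ?invr_ge0 ?(ltW t0)//.
rewrite ger0_norm ?expR_ge0// -mulrA [_ / _]mulrC mulrA -exprVn -exprD addn2.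
by apply: exprn_expRN_le; rewrite invr_ge0 ltW.
Qed.

Lemma is_derive_flat_gt0 p x : 0 < x ->
  is_derive x 1 (flat p) (flat ('X^2 * (p - p^`())) x).
Proof.
move=> x0; apply: (@near_eq_is_derive _ _ _ (fun t => p.[t^-1] * expR (- t^-1))).
  near=> t; rewrite /flat ifT//.
  by near: t; exact: lt_nbhsr.
have dV : is_derive x 1 (fun t : R => t^-1) (- x ^- 2).
  have := @is_deriveV _ id x _ _ (lt0r_neq0 x0) (is_derive_id x 1).
  by move=> /is_derive_eq; apply; rewrite /GRing.scale/= mulr1.
have dp := @is_derive1_comp _ (horner p) _ _ _ _ (is_derive_poly p x^-1) dV.
have de := @is_derive1_comp _ expR _ _ _ _ (is_derive_expR _) (is_deriveN dV).
have := is_deriveM dp de => /is_derive_eq; apply.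
rewrite /flat x0 hornerM hornerXn hornerD hornerN.
rewrite opprK -[(- _) x]/(- x^-1) /GRing.scale /=.
by rewrite exprVn; ring.
Unshelve. all: by end_near. Qed.

Lemma is_derive_flat0 p : is_derive (0 : R) 1 (flat p) 0.
Proof.
have [C C0 fC] := flat_le_sqr p; have C10 : 0 < C + 1 by rewrite ltr_wpDl.
have flat0 : flat p 0 = 0 by exact: flat_le0.
have cv : h^-1 *: ((flat p \o shift 0) (h *: 1) - flat p 0) @[h --> 0^'] --> (0 : R).
  rewrite flat0; apply/cvgr0Pnorm_le => e e0.
  near=> h; rewrite /= subr0 /GRing.scale/= mulr1 addr0 normrM normfV.
  have h0 : 0 < `|h| by rewrite normr_gt0; near: h; exact: nbhs_dnbhs_neq.
  rewrite mulrC ler_pdivrMr//; apply: le_trans (fC h) _.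
  rewrite -real_normK ?num_real// expr2 mulrA ler_wpM2r//.
  apply: (@le_trans _ _ ((C + 1) * `|h|)); first by rewrite ler_wpM2r ?lerDl.
  rewrite -ler_pdivlMl// mulrC.
  by near: h; apply: dnbhs0_le; rewrite divr_gt0.
apply: DeriveDef; first by apply/cvg_ex; exists 0.
exact: (cvg_lim _ cv).
Unshelve. all: by end_near. Qed.

Lemma is_derive_flat p x : is_derive x 1 (flat p) (flat ('X^2 * (p - p^`())) x).
Proof.
have [x0|x0|->] := ltgtP x 0.
- apply: (@near_eq_is_derive _ _ _ (cst 0)); last first.
    by rewrite flat_le0 ?ltW//; exact: is_derive_cst.
  near=> t; rewrite flat_le0//; apply: ltW.
  by near: t; exact: lt_nbhsl.
- exact: is_derive_flat_gt0.
- by rewrite [X in is_derive _ _ _ X]flat_le0//; exact: is_derive_flat0.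
Unshelve. all: by end_near. Qed.

Lemma smooth_flat p : smooth (flat p).
Proof.
apply: (@smooth_stable _ (fun f => exists p, f = flat p)); last by exists p.
move=> _ [q ->]; exists (flat ('X^2 * (q - q^`()))); first by eexists.
by move=> x; exact: is_derive_flat.
Qed.

Definition smooth_step t : R := flat 1 t / (flat 1 t + flat 1 (-1 * t + 1)).

Lemma smooth_step_denom_gt0 t : 0 < flat 1 t + flat 1 (-1 * t + 1).
Proof.
have [t0|t0] := ltP 0 t; first by rewrite ltr_pwDl ?flat1_gt0 ?flat1_ge0.
by rewrite ltr_wpDl ?flat1_ge0// flat1_gt0// mulN1r; lra.
Qed.

Lemma smooth_smooth_step : smooth smooth_step.
Proof.
move=> k; apply: Cn_funM; first exact: smooth_flat.
apply: Cn_funV => [x|]; first by rewrite gt_eqF// smooth_step_denom_gt0.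
by apply: Cn_funD; [exact: smooth_flat|apply: Cn_fun_affine; exact: smooth_flat].
Qed.

Lemma smooth_step_le0 t : t <= 0 -> smooth_step t = 0.
Proof. by move=> t0; rewrite /smooth_step flat_le0// mul0r. Qed.

Lemma smooth_step_ge1 t : 1 <= t -> smooth_step t = 1.
Proof.
move=> t1; rewrite /smooth_step [X in _ + X]flat_le0 ?addr0; last by lra.
by rewrite divff// gt_eqF// flat1_gt0//; lra.
Qed.

Lemma smooth_step_itv t : 0 <= smooth_step t <= 1.
Proof.
rewrite divr_ge0 ?(ltW (smooth_step_denom_gt0 t)) ?flat1_ge0//=.
by rewrite ler_pdivrMr ?smooth_step_denom_gt0// mul1r lerDl flat1_ge0.
Qed.

Lemma derive1_smooth_step_out t : ~~ (0 <= t <= 1) -> derive1 smooth_step t = 0.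
Proof.
rewrite negb_and -!ltNge => /orP[t0|t1].
  apply: (@near_cst_derive1 _ _ 0); near=> s; apply: smooth_step_le0.
  by apply: ltW; near: s; exact: lt_nbhsl.
apply: (@near_cst_derive1 _ _ 1); near=> s; apply: smooth_step_ge1.
by apply: ltW; near: s; exact: lt_nbhsr.
Unshelve. all: by end_near. Qed.

Lemma continuous_itv_support_bounded f l r : l <= r -> continuous f ->
  (forall t, ~~ (l <= t <= r) -> f t = 0) ->
  exists2 M : R, 0 < M & forall t, `|f t| <= M.
Proof.
move=> lr cf fout; have cnf : {within `[l, r], continuous (fun t => `|f t|)}.
  by apply: continuous_subspaceT => t; apply: cvg_norm; exact: cf.
have [c _ cmax] := EVT_max lr cnf.
exists (`|f c| + 1); first by rewrite ltr_wpDl.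
move=> t; have [tlr|tlr] := boolP (l <= t <= r).
  by rewrite (le_trans (cmax t _)) ?lerDl// in_itv.
by rewrite fout// normr0 addr_ge0.
Qed.

Definition ramp x e t : R := smooth_step (e^-1 * t + - (e^-1 * x)).

Lemma smooth_ramp x e : smooth (ramp x e).
Proof. exact/smooth_affine/smooth_smooth_step. Qed.

Lemma ramp_itv x e t : 0 <= ramp x e t <= 1.
Proof. exact: smooth_step_itv. Qed.

Lemma ramp_le x e t : 0 < e -> t <= x -> ramp x e t = 0.
Proof.
move=> e0 tx; apply: smooth_step_le0.
by rewrite -mulrN -mulrDr pmulr_rle0 ?invr_gt0// subr_le0.
Qed.

Lemma ramp_ge x e t : 0 < e -> x + e <= t -> ramp x e t = 1.
Proof.
move=> e0 tx; apply: smooth_step_ge1.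
by rewrite -mulrN -mulrDr mulrC ler_pdivlMr// mul1r lerBrDl.
Qed.

Lemma derive1_rampE x e t :
  derive1 (ramp x e) t = e^-1 * derive1 smooth_step (e^-1 * t + - (e^-1 * x)).
Proof. exact/derive1_comp_affine/smooth_derivable/smooth_smooth_step. Qed.

Lemma derive1_ramp_out x e t : 0 < e -> ~~ (x <= t <= x + e) ->
  derive1 (ramp x e) t = 0.
Proof.
move=> e0 tx; rewrite derive1_rampE derive1_smooth_step_out ?mulr0//.
apply: contra tx => /andP[]; rewrite -mulrN -mulrDr pmulr_rge0 ?invr_gt0//.
by rewrite subr_ge0 mulrC ler_pdivrMr// mul1r lerBlDl => -> ->.
Qed.

Lemma derive1_ramp_bounded : exists2 M : R, 0 < M &
  forall x e t, 0 < e -> `|derive1 (ramp x e) t| <= M / e.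
Proof.
have cd := smooth_continuous (smooth_derive1 smooth_smooth_step).
have [M M0 stepM] := continuous_itv_support_bounded ler01 cd derive1_smooth_step_out.
exists M => // x e t e0; rewrite derive1_rampE normrM.
by rewrite ger0_norm ?invr_ge0 ?(ltW e0)// mulrC ler_wpM2r ?invr_ge0 ?(ltW e0).
Qed.

Definition plateau l r e t : R := ramp l e t - ramp r e t.

Lemma smooth_plateau l r e : smooth (plateau l r e).
Proof. by apply: smoothB; exact: smooth_ramp. Qed.

Lemma plateau_le1 l r e t : `|plateau l r e t| <= 1.
Proof.
have /andP[? ?] := ramp_itv l e t; have /andP[? ?] := ramp_itv r e t.
by rewrite ler_norml /plateau; lra.
Qed.

Lemma plateau_out l r e t : 0 < e -> l <= r -> ~~ (l <= t <= r + e) ->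
  plateau l r e t = 0.
Proof.
move=> e0 lr; rewrite negb_and -!ltNge => /orP[tl|tr]; rewrite /plateau.
  by rewrite !ramp_le ?subrr//; lra.
by rewrite !ramp_ge ?subrr//; lra.
Qed.

Lemma plateau_in l r e t : 0 < e -> l + e <= t <= r -> plateau l r e t = 1.
Proof.
by move=> e0 /andP[lt tr]; rewrite /plateau ramp_ge// ramp_le// subr0.
Qed.

Lemma derive1_plateauE l r e t :
  derive1 (plateau l r e) t = derive1 (ramp l e) t - derive1 (ramp r e) t.
Proof.
have := is_deriveB (smooth_is_derive t (smooth_ramp l e))
  (smooth_is_derive t (smooth_ramp r e)).
by move=> dB; rewrite derive1E (@derive_val _ _ _ _ _ _ _ dB).
Qed.

Lemma near_natSinv_lt (d : R) : 0 < d -> \forall n \near \oo, n.+1%:R^-1 < d.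
Proof. by move=> d0; exact: (near_infty_natSinv_lt (PosNum d0)). Qed.

Lemma plateau_cvg l r t : l < r ->
  plateau l r n.+1%:R^-1 t @[n --> \oo] --> (\1_(`]l, r]%classic : set R) t : R).
Proof.
move=> lr; apply: cvg_near_cst.
have inv_gt0 n : 0 < n.+1%:R^-1 :> R by rewrite invr_gt0.
have [tl|lt] := leP t l.
  near=> n; rewrite indicE memNset/= ?in_itv/= ?ltNge ?tl//.
  by rewrite /plateau !ramp_le ?subrr// (le_trans tl)// ltW.
have [tr|rt] := leP t r.
  near=> n; rewrite indicE mem_set/= ?in_itv/= ?lt//.
  rewrite plateau_in// tr andbT -lerBrDl ltW//; near: n.
  by apply: near_natSinv_lt; rewrite subr_gt0.
near=> n; rewrite indicE memNset/= ?in_itv/= ?lt ?leNgt ?rt//.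
rewrite /plateau !ramp_ge ?subrr// -lerBrDl.
  by apply: ltW; near: n; apply: near_natSinv_lt; rewrite subr_gt0.
apply: (@le_trans _ _ (t - r)); last by rewrite lerB// ltW.
by apply: ltW; near: n; apply: near_natSinv_lt; rewrite subr_gt0.
Unshelve. all: by end_near. Qed.

Definition test_fun_itv l r b := smooth b /\
  exists2 d : R, 0 < d & forall t, ~~ (l + d <= t <= r - d) -> b t = 0.

Lemma test_fun_itv_support l r l' r' b : smooth b -> l < l' -> r' < r ->
  (forall t, ~~ (l' <= t <= r') -> b t = 0) -> test_fun_itv l r b.
Proof.
move=> sb ll rr bout; split=> //.
exists (Num.min (l' - l) (r - r')); first by rewrite lt_min !subr_gt0 ll.
move=> t; have ml : Num.min (l' - l) (r - r') <= l' - l by rewrite ge_min lexx.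
have mr : Num.min (l' - l) (r - r') <= r - r' by rewrite ge_min lexx orbT.
by move=> td; apply: bout; apply: contra td => /andP[? ?]; apply/andP; split; lra.
Qed.

Lemma test_fun_itvS l r l' r' b : l <= l' -> r' <= r ->
  test_fun_itv l' r' b -> test_fun_itv l r b.
Proof.
move=> ll rr [sb [d d0 bout]]; split=> //; exists d => // t td; apply: bout.
by apply: contra td => /andP[? ?]; apply/andP; split; lra.
Qed.

Lemma test_fun_itv_out l r b t : test_fun_itv l r b -> ~~ (l < t < r) -> b t = 0.
Proof.
move=> [_ [d d0 bout]] tlr; apply: bout.
by apply: contra tlr => /andP[? ?]; apply/andP; split; lra.
Qed.

Lemma test_fun_itv_derive1 l r b : test_fun_itv l r b ->
  test_fun_itv l r (derive1 b).
Proof.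
move=> [sb [d d0 bout]]; split; first exact: smooth_derive1.
exists d => // t; rewrite negb_and -!ltNge => /orP[tl|tr];
  apply: (@near_cst_derive1 _ _ 0); near=> s; apply: bout.
  rewrite negb_and -!ltNge; apply/orP; left.
  by near: s; exact: lt_nbhsl.
rewrite negb_and -!ltNge; apply/orP; right.
by near: s; exact: lt_nbhsr.
Unshelve. all: by end_near. Qed.

Lemma test_fun_itvM l r q b : smooth q -> test_fun_itv l r b ->
  test_fun_itv l r (fun t => q t * b t).
Proof.
move=> sq [sb [d d0 bout]]; split; first exact: smoothM.
by exists d => // t /bout ->; rewrite mulr0.
Qed.

Lemma test_fun_itv_bounded l r b : l <= r -> test_fun_itv l r b ->
  exists2 B : R, 0 < B & forall t, `|b t| <= B.
Proof.
move=> lr tb; apply: (continuous_itv_support_bounded lr) => [|t tlr].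
  by case: tb => /smooth_continuous.
by apply: test_fun_itv_out tb _; apply: contra tlr => /andP[/ltW -> /ltW ->].
Qed.

Lemma test_fun_itv_derive1_ramp l r x e : 0 < e -> l < x -> x + e < r ->
  test_fun_itv l r (derive1 (ramp x e)).
Proof.
move=> e0 lx xr; apply: (test_fun_itv_support _ lx xr).
  exact/smooth_derive1/smooth_ramp.
by move=> t; exact: derive1_ramp_out.
Qed.

Lemma test_fun_itv_plateau l r x y e : 0 < e -> x <= y -> l < x -> y + e < r ->
  test_fun_itv l r (plateau x y e).
Proof.
move=> e0 xy lx yr; apply: (test_fun_itv_support _ lx yr).
  exact: smooth_plateau.
by move=> t; exact: plateau_out.
Qed.

End SmoothCutoffs.

Section LebesgueIntervals.
Variable R : realType.
Notation mu := (@lebesgue_measure R).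
Implicit Types (f : R -> R) (a b c k x : R) (D : set R).

Lemma lebesgue_measure_itv_lty a b (ba bb : bool) :
  (mu [set` Interval (BSide ba a) (BSide bb b)] < +oo)%E.
Proof.
by rewrite lebesgue_measure_itv /=; case: ifP => // _; rewrite -EFinB ltry.
Qed.

Lemma filterS_ae (P Q : R -> Prop) : (forall x, P x -> Q x) ->
  {ae mu, forall x, P x} -> {ae mu, forall x, Q x}.
Proof. exact: (@filterS _ _ (ae_filter_ringOfSetsType mu)). Qed.

Lemma measurable_fun_continuous D f : continuous f -> measurable_fun D f.
Proof. by move=> /continuous_measurable_fun; exact: measurable_funTS. Qed.

Lemma measurable_fun_smooth D f : smooth f -> measurable_fun D f.
Proof. by move=> /smooth_continuous; exact: measurable_fun_continuous. Qed.

Lemma L2_itv_Rintegrable a b f : L2 mu `]a, b[ f -> Rintegrable mu `]a, b[ f.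
Proof. by apply: L2_Rintegrable => //; exact: lebesgue_measure_itv_lty. Qed.

Lemma Rintegrable_itv_cst a b k : Rintegrable mu `]a, b[ (cst k).
Proof. by apply/L2_itv_Rintegrable/L2_cst => //; exact: lebesgue_measure_itv_lty. Qed.

Lemma Rintegral_itv_cst a b k : a <= b -> \int[mu]_(z in `]a, b[) k = k * (b - a).
Proof.
move=> ab; rewrite Rintegral_cst//= lebesgue_measure_itv/= lte_fin.
by case: ltgtP ab => // -> _; rewrite subrr.
Qed.

Lemma Rintegral_itv_split f a b c : a < b -> b < c ->
  Rintegrable mu `]a, c[ f ->
  \int[mu]_(z in `]a, c[) f z =
  \int[mu]_(z in `]a, b[) f z + \int[mu]_(z in `]b, c[) f z.
Proof.
move=> ab bc fi; have fi' : Rintegrable mu `]a, b[ f.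
  by apply: RintegrableS fi => //; apply: subset_itvl; rewrite bnd_simp ltW.
rewrite (Rintegral_itv_bndo_bndc fi').
by rewrite -(Rintegral_itvB fi (x := b)) ?bnd_simp ?ltW// addrC subrK.
Qed.

Lemma ae_ge_Rintegral_itv f a b k : a <= b -> Rintegrable mu `]a, b[ f ->
  {ae mu, forall z, `]a, b[%classic z -> k <= f z} ->
  k * (b - a) <= \int[mu]_(z in `]a, b[) f z.
Proof.
move=> ab fi kf; rewrite -(Rintegral_itv_cst k ab).
by apply: ae_le_Rintegral => //; exact: Rintegrable_itv_cst.
Qed.

Lemma Rintegral_derive1_smooth f a b : a < b -> smooth f ->
  \int[mu]_(z in `]a, b[) derive1 f z = f b - f a.
Proof.
move=> ab sf; have sf' := smooth_derive1 sf; have cf := smooth_continuous sf.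
rewrite /Rintegral -(@integral_itv_bndoo _ _ _ _ true false); last first.
  by apply/measurable_EFinP; exact: measurable_fun_smooth.
rewrite (@continuous_FTC2 _ _ f)//; first exact/continuous_subspaceT/smooth_continuous.
split; first by move=> x _; exact: smooth_derivable.
- by apply: cvg_at_right_filter; exact: cf.
- by apply: cvg_at_left_filter; exact: cf.
Qed.

End LebesgueIntervals.

Section LebesguePoints.
Variable R : realType.
Notation mu := (@lebesgue_measure R).
Variables l r : R.
Notation I := (`]l, r[%classic : set R).
Variables (f : R -> R) (x : R).
Hypothesis fi : Rintegrable mu I f.

Definition lebesgue_pt_itv (g : R -> R) y := l < y < r /\ lebesgue_pt (g \_ I) y.

Lemma ae_lebesgue_pt_itv : {ae mu, forall y, I y -> lebesgue_pt_itv f y}.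
Proof.
have := lebesgue_differentiation (integrable_locally (measurable_itv _) fi).
by apply: filterS_ae => y ly; rewrite /= in_itv.
Qed.

Lemma Rintegrable_ball_sub d : 0 < d -> ball x d `<=` I ->
  Rintegrable mu (ball x d) (fun z => f z - f x).
Proof.
move=> d0 BI; have mB : measurable (ball x d : set R) by exact: measurable_ball.
have finB : (mu (ball x d) < +oo)%E by rewrite lebesgue_measure_ball ?ltry// ltW.
apply: RintegrableB => //; first exact: RintegrableS fi.
by apply: L2_Rintegrable => //; exact: L2_cst.
Qed.

Lemma Rintegral_ball_davg d : 0 < d -> ball x d `<=` I ->
  ((\int[mu]_(z in ball x d) `|f z - f x|)%:E =
   (d *+ 2)%:E * davg (f \_ I) x d)%E.
Proof.
move=> d0 BI; have mB : measurable (ball x d : set R) by exact: measurable_ball.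
have Ix : I x by apply: BI; exact: ballxx.
have muB : mu (ball x d) = (d *+ 2)%:E by rewrite lebesgue_measure_ball// ltW.
rewrite -Rintegrable_fineK//; last exact: integrable_norm (Rintegrable_ball_sub d0 BI).
have d20 : d *+ 2 != 0 by rewrite gt_eqF// mulrn_wgt0.
rewrite /davg /iavg muB inver (negbTE d20) muleA -EFinM divff//.
rewrite mul1e; apply: eq_integral => z /set_mem/BI Iz.
by rewrite /= !patchE !mem_set.
Qed.

Lemma approximate_identity_le (k : R -> R) M d : 0 < d -> 0 <= M ->
  ball x d `<=` I -> measurable_fun I k -> (forall z, `|k z| <= M / d) ->
  (forall z, I z -> ~ ball x d z -> k z = 0) -> \int[mu]_(z in I) k z = 1 ->
  (`|\int[mu]_(z in I) (f z * k z) - f x|%:E <= (M *+ 2)%:E * davg (f \_ I) x d)%E.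
Proof.
move=> d0 M0 BI mk kM kout k1; have mB : measurable (ball x d : set R).
  exact: measurable_ball.
have If := lebesgue_measure_itv_lty l r false true.
have ki : Rintegrable mu I k by apply: (@Rintegrable_bounded _ _ _ _ _ _ _ (M / d)).
have ifk : Rintegrable mu I (fun z => f z * k z).
  by apply: (@RintegrableMb _ _ _ _ _ _ (M / d)).
have iB := Rintegrable_ball_sub d0 BI.
have inB := integrable_norm iB.
have -> : \int[mu]_(z in I) (f z * k z) - f x =
    \int[mu]_(z in ball x d) ((f z - f x) * k z).
  have fxk : \int[mu]_(z in I) (f x * k z) = f x by rewrite RintegralZl// k1 mulr1.
  rewrite -{1}fxk -RintegralB//; last exact: RintegrableZ.
  rewrite (@subset_Rintegral_support _ _ _ mu _ _ _ BI) => [|z Iz Bz]; last first.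
    by rewrite kout ?mulr0.
  by apply: eq_Rintegral => z _; rewrite mulrBl.
have mkB : measurable_fun (ball x d) k by exact: measurable_funS mk.
have ifkB : Rintegrable mu (ball x d) (fun z => (f z - f x) * k z).
  by apply: (@RintegrableMb _ _ _ _ _ _ (M / d)).
apply: (@le_trans _ _ (M / d * \int[mu]_(z in ball x d) `|f z - f x|)%:E).
  rewrite lee_fin; apply: le_trans (le_normr_Rintegral _ _) _ => //.
  rewrite -RintegralZl//; apply: le_Rintegral => //.
  - exact: integrable_norm ifkB.
  - exact: RintegrableZ.
  by move=> z _; rewrite normrM mulrC ler_wpM2r.
rewrite EFinM (Rintegral_ball_davg d0 BI) muleA -EFinM.
by rewrite mulrnAr divfK ?gt_eqF.
Qed.

Lemma approximate_identity_cvg (k : nat -> R -> R) (d : nat -> R) M :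
  0 < M -> (forall n, 0 < d n) -> d n @[n --> \oo] --> (0 : R) ->
  (forall n, measurable_fun I (k n)) -> (forall n z, `|k n z| <= M / d n) ->
  (forall n z, I z -> ~ ball x (d n) z -> k n z = 0) ->
  (\forall n \near \oo, \int[mu]_(z in I) k n z = 1) -> lebesgue_pt_itv f x ->
  \int[mu]_(z in I) (f z * k n z) @[n --> \oo] --> f x.
Proof.
move=> M0 d_gt0 d0 mk kM kout k1 [/andP[lx xr] xleb].
apply/cvgrPdist_le => eps eps0.
have e0 : (0 < (eps / (M *+ 2))%:E)%E by rewrite lte_fin divr_gt0// mulrn_wgt0.
have [del/= del0 xdel] : \forall s \near 0^'+,
    (davg (f \_ I) x s < (eps / (M *+ 2))%:E)%E.
  exact: (xleb _ (open_ereal_lt' e0)).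
near=> n; have BI : ball x (d n) `<=` I.
  have dl : d n < x - l by near: n; apply: cvgr_lt d0 _ _; rewrite subr_gt0.
  have dr : d n < r - x by near: n; apply: cvgr_lt d0 _ _; rewrite subr_gt0.
  by move=> z; rewrite ball_itv/= !in_itv/= => /andP[? ?]; apply/andP; split; lra.
have kn1 : \int[mu]_(z in I) k n z = 1 by near: n.
have := approximate_identity_le (d_gt0 n) (ltW M0) BI (mk n) (kM n) (kout n) kn1.
rewrite distrC -lee_fin => /le_trans; apply.
have M2 : 0 < M *+ 2 by rewrite mulrn_wgt0.
rewrite muleC -lee_pdivlMr// -EFinM; apply: ltW.
apply: xdel => //=; rewrite /ball_ sub0r normrN gtr0_norm//.
by near: n; exact: cvgr_lt d0 _ del0.
Unshelve. all: by end_near. Qed.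

End LebesguePoints.

Section WeakDerivative.
Variable R : realType.
Notation mu := (@lebesgue_measure R).
Implicit Types (f g b : R -> R) (l r x y e : R).

Definition weak_deriv l r f g := forall b, test_fun_itv l r b ->
  \int[mu]_(z in `]l, r[) (f z * derive1 b z) = - \int[mu]_(z in `]l, r[) (g z * b z).

Lemma weak_derivS l r l' r' f g : l <= l' -> r' <= r ->
  weak_deriv l r f g -> weak_deriv l' r' f g.
Proof.
move=> ll rr fg b tb; have sub : `]l', r'[ `<=` `]l, r[.
  by apply: subset_itvW.
rewrite !(@subset_Rintegral_support _ _ _ mu _ _ _ sub); last 2 first.
- move=> z _; rewrite /= in_itv /= => /negP zlr.
  by rewrite (test_fun_itv_out tb zlr) mulr0.
- move=> z _; rewrite /= in_itv /= => /negP zlr.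
  by rewrite (test_fun_itv_out (test_fun_itv_derive1 tb) zlr) mulr0.
exact/fg/(test_fun_itvS ll rr tb).
Qed.

Variables l r : R.
Notation I := (`]l, r[%classic : set R).

Lemma derive1_ramp_cvg f x : Rintegrable mu I f -> lebesgue_pt_itv l r f x ->
  \int[mu]_(z in I) (f z * derive1 (ramp x n.+1%:R^-1) z) @[n --> \oo] --> f x.
Proof.
move=> fi xleb; have [M M0 rampM] := derive1_ramp_bounded R.
have [/andP[lx xr] _] := xleb.
have inv_gt0 n : 0 < n.+1%:R^-1 :> R by rewrite invr_gt0.
have M20 : 0 < M *+ 2 by rewrite mulrn_wgt0.
apply: (@approximate_identity_cvg _ l r f x fi
  (fun n => derive1 (ramp x n.+1%:R^-1)) (fun n => n.+1%:R^-1 *+ 2) (M *+ 2)) => //.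
- by rewrite -[X in _ --> X](mul0rn _ 2); apply: cvgMn; exact: cvg_harmonic.
- by move=> n; apply: measurable_fun_smooth; exact/smooth_derive1/smooth_ramp.
- move=> n z; have -> : M *+ 2 / (n.+1%:R^-1 *+ 2) = M / n.+1%:R^-1 by field.
  exact: rampM.
- move=> n z _ zB; apply: derive1_ramp_out => //; apply/negP => /andP[xz zx].
  have := inv_gt0 n; move: (n.+1%:R^-1 : R) zx zB => e zx zB e0; apply: zB.
  by rewrite ball_itv/= in_itv/=; apply/andP; split; lra.
- have rx : 0 < r - x by rewrite subr_gt0.
  near=> n; have nr : n.+1%:R^-1 < r - x by near: n; exact: near_natSinv_lt.
  rewrite Rintegral_derive1_smooth ?(lt_trans lx)//; last exact: smooth_ramp.
  by rewrite ramp_ge ?ramp_le ?subr0 ?(ltW lx)// -lerBrDl ltW.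
Unshelve. all: by end_near. Qed.

Lemma ae_eq0_test_fun f : Rintegrable mu I f ->
  (forall b, test_fun_itv l r b -> \int[mu]_(z in I) (f z * b z) = 0) ->
  {ae mu, forall z, I z -> f z = 0}.
Proof.
move=> fi f0; apply: filterS_ae (ae_lebesgue_pt_itv fi) => z zleb Iz.
have {zleb Iz}zleb := zleb Iz; have [/andP[lz zr] _] := zleb.
apply: (cvg_unique _ (derive1_ramp_cvg fi zleb)) => //; apply: cvg_near_cst.
have rz : 0 < r - z by rewrite subr_gt0.
near=> n; apply: f0; apply: test_fun_itv_derive1_ramp => //.
by rewrite -ltrBrDl; near: n; exact: near_natSinv_lt.
Unshelve. all: by end_near. Qed.

Lemma Rintegral_plateau_cvg g x y : Rintegrable mu I g -> l < x -> x < y -> y < r ->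
  \int[mu]_(z in I) (g z * plateau x y n.+1%:R^-1 z) @[n --> \oo] -->
  \int[mu]_(z in `]x, y[) g z.
Proof.
move=> gi lx xy yr; have mg := measurable_Rintegrable gi.
have xyI : `]x, y] `<=` I.
  move=> z /=; rewrite !in_itv/= => /andP[xz zy].
  by rewrite (lt_trans lx xz) (le_lt_trans zy yr).
rewrite (Rintegral_itv_bndo_bndc (RintegrableS _ _ _ gi))//; last first.
  by apply: subset_trans xyI; apply: subset_itvl; rewrite bnd_simp.
rewrite -(@Rintegral_indicM _ _ _ mu _ _ _ xyI).
apply: (@dominated_cvg_Rintegral _ _ _ mu I _ _ _ (fun z => `|g z|)) => //.
- move=> n; apply: measurable_funM => //.
  by apply: measurable_fun_smooth; exact: smooth_plateau.
- exact: integrable_norm.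
- by move=> z _; apply: cvgM; [exact: cvg_cst|exact: plateau_cvg].
- by move=> n z _; rewrite normrM ler_piMr// plateau_le1.
Qed.

Lemma weak_deriv_increment f g x y : Rintegrable mu I f -> Rintegrable mu I g ->
  weak_deriv l r f g -> lebesgue_pt_itv l r f x -> lebesgue_pt_itv l r f y ->
  x < y -> f y - f x = \int[mu]_(z in `]x, y[) g z.
Proof.
move=> fi gi fg xleb yleb xy.
have [/andP[lx _] _] := xleb; have [/andP[_ yr] _] := yleb.
pose ramp_avg c n := \int[mu]_(z in I) (f z * derive1 (ramp c n.+1%:R^-1) z).
have cvgf : ramp_avg y n - ramp_avg x n @[n --> \oo] --> f y - f x.
  by apply: cvgB; exact: derive1_ramp_cvg.
apply: (cvg_unique _ cvgf) => //.
apply: cvg_trans (Rintegral_plateau_cvg gi lx xy yr); apply: near_eq_cvg.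
have ry : 0 < r - y by rewrite subr_gt0.
near=> n; have yn : n.+1%:R^-1 < r - y by near: n; exact: near_natSinv_lt.
have : 0 < n.+1%:R^-1 :> R by rewrite invr_gt0.
rewrite /ramp_avg; move: (n.+1%:R^-1 : R) yn => e ye e0.
have [M M0 rampM] := derive1_ramp_bounded R.
have ir c : Rintegrable mu I (fun z => f z * derive1 (ramp c e) z).
  apply: (@RintegrableMb _ _ _ _ _ _ (M / e)) => //.
    by apply: measurable_fun_smooth; apply: smooth_derive1; exact: smooth_ramp.
  by move=> z _; exact: rampM.
have /fg : test_fun_itv l r (plateau x y e).
  by apply: test_fun_itv_plateau => //; lra.
move=> /(congr1 -%R); rewrite opprK => <-.
rewrite -[RHS]opprB -(RintegralB _ (ir x) (ir y))//; congr -%R.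
by apply: eq_Rintegral => z _; rewrite derive1_plateauE mulrBr.
Unshelve. all: by end_near. Qed.

End WeakDerivative.

Lemma sqr_add3_le (R : realDomainType) (x y z : R) :
  (x + y + z) ^+ 2 <= 3 * (x ^+ 2 + y ^+ 2 + z ^+ 2).
Proof.
rewrite -subr_ge0 (_ : _ - _ = (x - y) ^+ 2 + (x - z) ^+ 2 + (y - z) ^+ 2).
  by rewrite !addr_ge0 ?sqr_ge0.
by ring.
Qed.

Section IntervalInterpolation.
Variable R : realType.
Notation mu := (@lebesgue_measure R).
Implicit Types (a b s t z : R).

Lemma outer_thirds_average_le (v : R -> R) (P : R -> Prop) a b k : a < b ->
  Rintegrable mu `]a, b[ v -> (forall z, 0 <= v z) ->
  {ae mu, forall z, `]a, b[%classic z -> P z} ->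
  (forall s t, P s -> P t -> a < s < a + (b - a) / 3 -> b - (b - a) / 3 < t < b ->
    k <= v s + v t) ->
  k <= 6 / (b - a) * \int[mu]_(z in `]a, b[) v z.
Proof.
move=> ab vi v0 aeP kv; pose th := (b - a) / 3.
have th0 : 0 < th by rewrite divr_gt0// subr_gt0.
have [a_th b_th] : a + th < b /\ a < b - th by rewrite /th; lra.
set U := \int[mu]_(z in _) _.
have third_le k' (x y : R) : a <= x -> y <= b -> y = x + th ->
    (forall z, P z -> x < z < y -> k' <= v z) -> k' <= U / th.
  move=> ax yb yE k'v; rewrite ler_pdivlMr//.
  have sub : `]x, y[ `<=` `]a, b[ by exact: subset_itvW.
  have vxy : Rintegrable mu `]x, y[ v by exact: RintegrableS vi.
  apply: (@le_trans _ _ (\int[mu]_(z in `]x, y[) v z)); last first.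
    exact: subset_Rintegral.
  have -> : th = y - x by rewrite yE addrC addKr.
  apply: ae_ge_Rintegral_itv vxy _; first by rewrite yE lerDl ltW.
  apply: filterS_ae aeP => z Pz zxy; apply: k'v; first exact/Pz/sub.
  by move: zxy; rewrite /= in_itv.
have first_le t : P t -> b - th < t < b -> k - U / th <= v t.
  move=> Pt tb; rewrite lerBlDr -lerBlDl.
  apply: (third_le _ a (a + th)) => // [|s Ps sa]; first exact: ltW.
  by rewrite lerBlDl addrC; exact: kv.
have : k - U / th <= U / th.
  by apply: (third_le _ (b - th) b) => //; [exact: ltW|rewrite subrK].
rewrite (_ : 6 / (b - a) * U = U / th + U / th) ?lerBlDr//.
by rewrite /th; field; rewrite subr_eq0 gt_eqF.
Qed.

Variables c d : R.
Notation J := (`]c, d[%classic : set R).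
Variables u g h : R -> R.
Hypotheses (Lu : L2 mu J u) (Lg : L2 mu J g) (Lh : L2 mu J h).
Hypotheses (ug : weak_deriv c d u g) (gh : weak_deriv c d g h).

Let ui := L2_itv_Rintegrable Lu.
Let gi := L2_itv_Rintegrable Lg.
Let hi := L2_itv_Rintegrable Lh.

Lemma weak_deriv_increment_le s t :
  lebesgue_pt_itv c d g s -> lebesgue_pt_itv c d g t ->
  `|g s - g t| <= \int[mu]_(z in J) `|h z|.
Proof.
wlog st : s t / s < t => [hwlog gs gt|gs gt].
  have [st|ts|->] := ltgtP s t; first exact: hwlog.
    by rewrite distrC; exact: hwlog.
  by rewrite subrr normr0 Rintegral_ge0.
rewrite distrC (weak_deriv_increment gi hi gh gs gt st).
have [/andP[cs _] _] := gs; have [/andP[_ td] _] := gt.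
have sub : `]s, t[ `<=` J by apply: subset_itvW; exact: ltW.
have hst : Rintegrable mu `]s, t[ h by exact: RintegrableS hi.
apply: le_trans (le_normr_Rintegral _ hst) _ => //.
by apply: subset_Rintegral => //; exact: integrable_norm.
Qed.

Lemma secant_slope_error_le s t z : lebesgue_pt_itv c d u s ->
  lebesgue_pt_itv c d u t -> lebesgue_pt_itv c d g z -> s < t ->
  `|(t - s) * g z - (u t - u s)| <= (t - s) * \int[mu]_(y in J) `|h y|.
Proof.
move=> us ut gz st; have [/andP[cs _] _] := us; have [/andP[_ td] _] := ut.
have sub : `]s, t[ `<=` J by apply: subset_itvW; exact: ltW.
have gst : Rintegrable mu `]s, t[ g by exact: RintegrableS gi.
have ic := Rintegrable_itv_cst s t (g z).
have igz : Rintegrable mu `]s, t[ (fun y => g z - g y) by exact: (RintegrableB _ ic gst).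
rewrite mulrC -(Rintegral_itv_cst (g z) (ltW st)).
rewrite (weak_deriv_increment ui gi ug us ut st) -(RintegralB _ ic gst)//.
apply: le_trans (le_normr_Rintegral _ igz) _ => //.
rewrite mulrC -(Rintegral_itv_cst _ (ltW st)).
apply: ae_le_Rintegral => //; [exact: integrable_norm|exact: Rintegrable_itv_cst|].
apply: filterS_ae (ae_lebesgue_pt_itv gi) => y gy yst.
by apply: weak_deriv_increment_le => //; exact/gy/sub.
Qed.

Lemma sqr_Rintegral_norm_le :
  (\int[mu]_(z in J) `|h z|) ^+ 2 <= (d - c) * \int[mu]_(z in J) (h z ^+ 2).
Proof.
have [cd|dc] := leP c d; last first.
  by rewrite set_itv_ge ?bnd_simp -?leNgt ?(ltW dc)// !Rintegral_set0 expr0n mulr0.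
have mJ : measurable (J : set (measurableTypeR R)) by exact: measurable_itv.
have L1 : L2 mu J (cst 1) by apply: L2_cst => //; exact: lebesgue_measure_itv_lty.
have Lnh : L2 mu J (fun z => `|h z|).
  apply: (L2_le mJ _ Lh) => [|z _]; last by rewrite normr_id.
  by apply: measurableT_comp => //; case: Lh.
have := Cauchy_Schwarz_Rintegral mJ L1 Lnh.
under eq_Rintegral do rewrite mul1r.
under [X in _ <= X * _ -> _]eq_Rintegral do rewrite expr1n.
rewrite Rintegral_itv_cst// mul1r.
by under [X in _ <= _ * X -> _]eq_Rintegral do rewrite real_normK ?num_real//.
Qed.

Lemma pointwise_interpolation a b z : c <= a -> a < b -> b <= d ->
  lebesgue_pt_itv c d g z ->
  g z ^+ 2 <= 162 / (b - a) ^+ 3 * \int[mu]_(t in `]a, b[) (u t ^+ 2) +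
    27 * (d - c) * \int[mu]_(t in J) (h t ^+ 2).
Proof.
move=> ca ab bd gz; have sub : `]a, b[ `<=` J by exact: subset_itvW.
set U := \int[mu]_(t in _) (u t ^+ 2); set H2 := \int[mu]_(t in _) (h t ^+ 2).
pose H := \int[mu]_(t in J) `|h t|; pose w := b - a.
have w0 : 0 < w by rewrite subr_gt0.
have sqr_slope_le s t : lebesgue_pt_itv c d u s -> lebesgue_pt_itv c d u t ->
    a < s < a + w / 3 -> b - w / 3 < t < b ->
    w ^+ 2 / 27 * g z ^+ 2 - w ^+ 2 * H ^+ 2 <= u s ^+ 2 + u t ^+ 2.
  move=> us ut sa tb; have wE : w = b - a by [].
  have [ts1 ts2] : w / 3 <= t - s /\ t - s <= w by lra.
  have st : s < t by lra.
  have := secant_slope_error_le us ut gz st; rewrite -/H.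
  have H0 : 0 <= H by exact: Rintegral_ge0.
  move: (t - s) ts1 ts2 => v v1 v2 errle.
  have slope_le : w / 3 * `|g z| <= `|u s| + `|u t| + w * H.
    apply: le_trans (ler_wpM2r _ v1) _ => //.
    have v0 : 0 <= v by apply: le_trans v1; rewrite divr_ge0 ?ltW.
    rewrite -(ger0_norm v0) -normrM -[v * g z](subrK (u t - u s)) addrC.
    apply: le_trans (ler_normD _ _) _; rewrite lerD//.
      by rewrite [leRHS]addrC ler_normB.
    exact: le_trans errle (ler_wpM2r H0 v2).
  have : (w / 3 * `|g z|) ^+ 2 <= (`|u s| + `|u t| + w * H) ^+ 2.
    by rewrite ler_sqr ?nnegrE// ?addr_ge0// mulr_ge0// ?divr_ge0// (ltW w0).
  move=> /le_trans/(_ (sqr_add3_le _ _ _)).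
  rewrite !exprMn !real_normK ?num_real//; lra.
have u2i : Rintegrable mu `]a, b[ (fun t => u t ^+ 2).
  by have [_] := Lu; exact: RintegrableS.
have ul : {ae mu, forall t, `]a, b[%classic t -> lebesgue_pt_itv c d u t}.
  by apply: filterS_ae (ae_lebesgue_pt_itv ui) => t ut /sub/ut.
have := outer_thirds_average_le ab u2i (fun t => sqr_ge0 (u t)) ul sqr_slope_le.
rewrite -/U -/w lerBlDr => gU.
have w2 : 0 < w ^+ 2 / 27 by rewrite divr_gt0 ?exprn_gt0.
rewrite -(ler_pM2l w2); apply: le_trans gU _.
have := ler_wpM2l (sqr_ge0 w) sqr_Rintegral_norm_le; rewrite -/H -/H2.
move=> /(lerD (lexx (6 / w * U))) /le_trans; apply.
by rewrite le_eqVlt; apply/orP; left; apply/eqP; field; rewrite gt_eqF.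
Qed.

Lemma Rintegrable_weighted_sqr (e v : R -> R) M : L2 mu J v -> continuous e ->
  (forall z, c < z < d -> `|e z| <= M) -> Rintegrable mu J (fun z => e z * v z ^+ 2).
Proof.
move=> Lv ce eM; apply: (@Rintegrable_sqrMb _ _ _ mu _ _ M) => //.
exact: measurable_fun_continuous.
Qed.

Lemma sqr_weight_subinterval_le m al a b : c <= a -> b <= d -> 0 <= m -> 0 <= al ->
  (forall z, c < z < d -> `|z| <= m) -> (forall z, a < z < b -> al <= `|z|) ->
  al ^+ 2 * \int[mu]_(z in `]a, b[) (u z ^+ 2) <=
  \int[mu]_(z in J) (z ^+ 2 * u z ^+ 2).
Proof.
move=> ca bd m0 al0 zm zal; have sub : `]a, b[ `<=` J by exact: subset_itvW.
have iu : Rintegrable mu `]a, b[ (fun z => u z ^+ 2).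
  by have [_] := Lu; exact: RintegrableS.
have iuz : Rintegrable mu J (fun z => z ^+ 2 * u z ^+ 2).
  apply: (@Rintegrable_weighted_sqr _ _ (m ^+ 2)) => // [z|z /zm zm'].
    exact: exprn_continuous.
  by rewrite normrX lerXn2r ?nnegrE.
apply: (@le_trans _ _ (\int[mu]_(z in `]a, b[) (z ^+ 2 * u z ^+ 2))); last first.
  by apply: subset_Rintegral => // z _; exact: mulr_ge0 (sqr_ge0 _) (sqr_ge0 _).
rewrite -RintegralZl//; apply: le_Rintegral => //; first exact: RintegrableZ.
  exact: RintegrableS iuz.
move=> z /=; rewrite in_itv/= => zab; rewrite ler_wpM2r ?sqr_ge0//.
by rewrite ler_sqr_norm ger0_norm// zal.
Qed.

(* the numeric hypotheses hold when [d - c], [b - a] are comparable to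
   [(nu * m) ^-(1/2)] and [al] to [m]: the scale at which the interpolation
   inequality balances its two terms *)
Lemma weighted_interpolation nu m al C a b : c <= a -> a < b -> b <= d ->
  0 <= nu -> 0 <= al -> 0 <= C ->
  (forall z, c < z < d -> `|z| <= m) -> (forall z, a < z < b -> al <= `|z|) ->
  nu * m * (d - c) * (162 / (b - a) ^+ 3) <= C * nu ^+ 2 * al ^+ 2 ->
  nu * m * (d - c) * (27 * (d - c)) <= C ->
  nu * \int[mu]_(z in J) (`|z| * g z ^+ 2) <=
  C * (nu ^+ 2 * \int[mu]_(z in J) (z ^+ 2 * u z ^+ 2) +
       \int[mu]_(z in J) (h z ^+ 2)).
Proof.
move=> ca ab bd nu0 al0 C0 zm zal CU CH.
have cd : c < d by exact: le_lt_trans ca (lt_le_trans ab bd).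
have m0 : 0 <= m.
  have [cmid midd] := midf_lt cd.
  by apply: le_trans (zm ((c + d) / 2) _); rewrite ?cmid.
have UV := sqr_weight_subinterval_le ca bd m0 al0 zm zal.
set V := \int[mu]_(z in J) (z ^+ 2 * _) in UV *.
set U := \int[mu]_(z in _) _ in UV; set H2 := \int[mu]_(z in J) (h z ^+ 2).
have H20 : 0 <= H2 by apply: Rintegral_ge0 => z _; exact: sqr_ge0.
have U0 : 0 <= U by apply: Rintegral_ge0 => z _; exact: sqr_ge0.
pose B := 162 / (b - a) ^+ 3 * U + 27 * (d - c) * H2.
have gB : \int[mu]_(z in J) (`|z| * g z ^+ 2) <= m * B * (d - c).
  rewrite -(Rintegral_itv_cst (m * B) (ltW cd)); apply: ae_le_Rintegral => //.
  - apply: (@Rintegrable_weighted_sqr _ _ m) => // [z|z /zm]; last by rewrite normr_id.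
    exact: norm_continuous.
  - exact: Rintegrable_itv_cst.
  apply: filterS_ae (ae_lebesgue_pt_itv gi) => z gz zcd.
  apply: ler_pM => //; [exact: sqr_ge0| |exact: pointwise_interpolation (gz zcd)].
  by apply: zm; move: zcd; rewrite /= in_itv.
apply: le_trans (ler_wpM2l nu0 gB) _.
rewrite (_ : nu * _ = nu * m * (d - c) * (162 / (b - a) ^+ 3) * U +
  nu * m * (d - c) * (27 * (d - c)) * H2); last by rewrite /B; ring.
rewrite [leRHS]mulrDr lerD//; last exact: ler_wpM2r.
apply: le_trans (ler_wpM2r U0 CU) _.
by rewrite -[C * _ * _ * _]mulrA -mulrA; do 2 rewrite ler_wpM2l ?sqr_ge0//.
Qed.

End IntervalInterpolation.

Section BalancedCells.
Variable R : realType.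
Implicit Types (nu a b A B : R) (N j : nat).

Definition interpolation_cst : R := 500 ^+ 2.

Lemma interpolation_cst_ge0 : 0 <= interpolation_cst.
Proof. exact: sqr_ge0. Qed.

(* [b - a] is comparable to [(nu * a) ^-(1/2)] *)
Definition balanced_cell nu a b := [/\ 0 < a, a < b, b <= 2 * a,
  nu * (a * (b - a) ^+ 2) <= 1 & 1 <= 49 * nu * (a * (b - a) ^+ 2)].

Definition cell_cst_bounds nu c a b :=
  nu * b * (b - c) * (162 / (b - a) ^+ 3) <= interpolation_cst * nu ^+ 2 * a ^+ 2 /\
  nu * b * (b - c) * (27 * (b - c)) <= interpolation_cst.

Lemma balanced_cell_bounds nu a b : 0 < nu -> balanced_cell nu a b ->
  cell_cst_bounds nu a a b.
Proof.
move=> n0 [a0 ab ba u1 l1]; have l0 : 0 < b - a by lra.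
have KE : interpolation_cst = 500 * 500 by rewrite /interpolation_cst expr2.
split.
  rewrite (_ : _ * (162 / _) = 162 * (nu * b) / (b - a) ^+ 2); last first.
    by field; rewrite gt_eqF.
  rewrite ler_pdivrMr ?exprn_gt0// KE.
  have na0 : 0 <= 324 * (nu * a) by have := mulr_gt0 n0 a0; lra.
  have na_le := ler_wpM2l na0 l1; have nb_le := ler_wpM2l (ltW n0) ba.
  have := mulr_ge0 (mulr_ge0 (sqr_ge0 nu) (sqr_ge0 a)) (sqr_ge0 (b - a)).
  nra.
rewrite (_ : _ * (27 * _) = 27 * (nu * (b - a) ^+ 2 * b)); last by ring.
have nl0 : 0 <= nu * (b - a) ^+ 2 by rewrite mulr_ge0 ?sqr_ge0 ?ltW.
have := ler_wpM2l nl0 ba; rewrite KE; nra.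
Qed.

Lemma balanced_cell_bounds_from0 nu a b : 0 < nu -> nu * a ^+ 3 <= 1 ->
  balanced_cell nu a b -> cell_cst_bounds nu 0 a b.
Proof.
move=> n0 na3 [a0 ab ba _ l1]; have l0 : 0 < b - a by lra.
have KE : interpolation_cst = 500 * 500 by rewrite /interpolation_cst expr2.
have b0 : 0 < b by lra.
have b2 : b ^+ 2 <= 4 * a ^+ 2.
  rewrite (_ : 4 * _ = (2 * a) ^+ 2); last by rewrite exprMn -natrX.
  by rewrite ler_sqr ?nnegrE ?mulr_ge0 ?(ltW a0) ?(ltW b0).
have na0 : 0 <= nu * a by rewrite mulr_ge0 ?ltW.
rewrite /cell_cst_bounds subr0; split.
  rewrite (_ : _ * (162 / _) = 162 * (nu * b ^+ 2) / (b - a) ^+ 3); last first.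
    by field; rewrite gt_eqF.
  rewrite ler_pdivrMr ?exprn_gt0// KE.
  have a_le : a <= 7 * (b - a).
    rewrite -ler_sqr ?nnegrE ?mulr_ge0 ?(ltW a0) ?(ltW l0)// exprMn.
    by rewrite -(ler_pM2l (mulr_gt0 n0 a0)); lra.
  have naa_le : nu * a * a <=
      49 * nu * (a * (b - a) ^+ 2) * (nu * a * (7 * (b - a))).
    rewrite -[leLHS]mul1r; apply: ler_pM => //; first by rewrite mulr_ge0// ltW.
    by rewrite ler_wpM2l.
  have na2 : 0 <= nu * a ^+ 2 by rewrite mulr_ge0 ?sqr_ge0 ?ltW.
  have nb_le := ler_wpM2l (ltW n0) b2.
  rewrite (_ : 500 * 500 * _ * _ * _ = 500 * 500 / 343 *
    (49 * nu * (a * (b - a) ^+ 2) * (nu * a * (7 * (b - a))))); last by field.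
  lra.
rewrite (_ : _ * (27 * _) = 27 * (nu * b ^+ 2 * b)); last by ring.
have nb0 : 0 <= nu * b ^+ 2 by rewrite mulr_ge0 ?sqr_ge0 ?ltW.
have := ler_wpM2l nb0 ba; have := ler_wpM2l na0 b2; rewrite KE; nra.
Qed.

Lemma sqr_le_double_sqr A B : 0 <= A -> 0 <= B -> B ^+ 3 <= 2 * A ^+ 3 ->
  B ^+ 2 <= 2 * A ^+ 2.
Proof.
move=> A0 B0 BA3.
rewrite -(@ler_pXn2r _ 3) ?nnegrE ?mulr_ge0 ?sqr_ge0//.
rewrite [(2 * _) ^+ 3]exprMn [B ^+ 2 ^+ 3]exprAC [A ^+ 2 ^+ 3]exprAC.
apply: (@le_trans _ _ ((2 * A ^+ 3) ^+ 2)).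
  by rewrite ler_sqr ?nnegrE ?mulr_ge0 ?exprn_ge0.
by rewrite exprMn ler_wpM2r ?sqr_ge0// -!natrX ler_nat.
Qed.

Lemma balanced_cell_sqr (m : R) nu A B : 0 < m -> 0 < nu -> nu <= m ^+ 2 ->
  m ^+ 2 <= 4 * nu -> 0 < A -> A < B -> 1 <= m * A ^+ 3 ->
  m * B ^+ 3 = m * A ^+ 3 + 1 -> balanced_cell nu (A ^+ 2) (B ^+ 2).
Proof.
move=> m0 n0 nm mn A0 AB mA mB; have B0 : 0 < B by lra.
pose X := A * (B ^+ 2 - A ^+ 2).
have XE : A ^+ 2 * (B ^+ 2 - A ^+ 2) ^+ 2 = X ^+ 2 by rewrite /X exprMn.
have mBA : m * (B - A) * (A ^+ 2 + A * B + B ^+ 2) = 1.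
  by rewrite -[RHS](addrK (m * A ^+ 3)) [1 + _]addrC -mB; ring.
have mBA0 : 0 < m * (B - A) by rewrite mulr_gt0// subr_gt0.
have mXE : m * X = m * (B - A) * (A ^+ 2 + A * B) by rewrite /X; ring.
have mX1 : m * X <= 1 by rewrite -mBA mXE ler_pM2l// lerDl sqr_ge0.
have BA2 : B ^+ 2 <= 2 * A ^+ 2.
  by apply: sqr_le_double_sqr; rewrite ?(ltW A0) ?(ltW B0)// -(ler_pM2l m0); lra.
have mX2 : 2 <= 7 * (m * X).
  have : 2 * (A ^+ 2 + A * B + B ^+ 2) <= 7 * (A ^+ 2 + A * B).
    by have := mulr_gt0 A0 B0; have := exprn_gt0 2 A0; lra.
  move=> /(ler_wpM2l (ltW mBA0)).
  by rewrite mXE mulrCA mBA mulr1 [leRHS]mulrCA.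
have X0 : 0 <= X by rewrite /X mulr_ge0 ?subr_ge0 ?ler_sqr ?nnegrE ?ltW.
split; rewrite ?exprn_gt0// ?XE//.
- by rewrite ltr_sqr ?nnegrE ?ltW.
- apply: (@le_trans _ _ (m ^+ 2 * X ^+ 2)); first by rewrite ler_wpM2r ?sqr_ge0.
  by rewrite -exprMn; exact: exprn_ile1 (mulr_ge0 (ltW m0) X0) mX1.
have : (2 : R) ^+ 2 <= (7 * (m * X)) ^+ 2.
  by apply: lerXn2r => //; rewrite nnegrE; lra.
rewrite (_ : (7 * _) ^+ 2 = 49 * (m ^+ 2 * X ^+ 2)); last by ring.
by have := ler_wpM2r (sqr_ge0 X) mn; lra.
Qed.

Lemma cbrt_exp3 N j : ((j%:R / N%:R) `^ 3^-1 : R) ^+ 3 = j%:R / N%:R.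
Proof.
by rewrite -powR_mulrn ?powR_ge0// -powRrM mulVf ?pnatr_eq0// powRr1.
Qed.

Definition cell_node N j : R := ((j%:R / N%:R) `^ 3^-1) ^+ 2.

Lemma cell_node_lt N i j : (0 < N)%N -> (i < j)%N -> cell_node N i < cell_node N j.
Proof.
move=> N0 ij; rewrite ltr_pXn2r ?nnegrE ?powR_ge0//.
rewrite -(@ltr_pXn2r _ 3) ?nnegrE ?powR_ge0// !cbrt_exp3.
by rewrite ltr_pM2r ?invr_gt0 ?ltr0n// ltr_nat.
Qed.

Lemma cell_node_last N : (0 < N)%N -> cell_node N N = 1.
Proof. by move=> N0; rewrite /cell_node divff ?powR1 ?expr1n// pnatr_eq0 -lt0n. Qed.

Lemma cell_node_le1 N j : (0 < N)%N -> (j <= N)%N -> cell_node N j <= 1.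
Proof.
move=> N0; rewrite leq_eqVlt => /predU1P[->|jN]; first by rewrite cell_node_last.
by rewrite -(cell_node_last N0) ltW// cell_node_lt.
Qed.

Lemma cell_node_exp3 N j : cell_node N j ^+ 3 = (j%:R / N%:R) ^+ 2.
Proof. by rewrite /cell_node exprAC cbrt_exp3. Qed.

Lemma balanced_cell_node N nu j : (0 < N)%N -> 0 < nu -> nu <= N%:R ^+ 2 ->
  N%:R ^+ 2 <= 4 * nu -> (0 < j)%N ->
  balanced_cell nu (cell_node N j) (cell_node N j.+1).
Proof.
move=> N0 n0 nN Nn j0; have NR0 : 0 < N%:R :> R by rewrite ltr0n.
have cbrtE i : N%:R * ((i%:R / N%:R) `^ 3^-1 : R) ^+ 3 = i%:R.
  by rewrite cbrt_exp3 mulrC divfK// gt_eqF.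
apply: (@balanced_cell_sqr N%:R) => //; rewrite ?cbrtE ?natr1//.
- by rewrite powR_gt0// divr_gt0 ?ltr0n.
- have := @cell_node_lt N j j.+1 N0 (ltnSn j).
  by rewrite ltr_sqr ?nnegrE ?powR_ge0.
- by rewrite ler1n.
Qed.

Lemma exists_sqr_ge nu : 1 <= nu ->
  exists N : nat, [/\ (1 < N)%N, nu <= N%:R ^+ 2 & N%:R ^+ 2 <= 4 * nu].
Proof.
move=> n1; pose P N := (1 < N)%N && (nu <= N%:R ^+ 2).
have exP : exists N, P N.
  exists (Num.truncn nu).+2; rewrite /P /= (le_trans (ltW (truncnS_gt nu)))//.
  rewrite -natrX ler_nat -mulnn; move: (Num.truncn nu) => t.
  by rewrite (leq_trans (leqnSn _))// leq_pmulr.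
exists (ex_minn exP); case: ex_minnP => N /andP[N1 nN] minN; split=> //.
have [->|N2] := eqVneq N 2; first by rewrite expr2; lra.
have : ~~ P N.-1 by apply/negP => /minN; lia.
rewrite /P; have -> /= : (1 < N.-1)%N by lia.
rewrite -ltNge => /ltW N1nu.
apply: le_trans (_ : 4 * N.-1%:R ^+ 2 <= _); last by rewrite ler_wpM2l.
by rewrite -!natrX -natrM ler_nat -!mulnn; nia.
Qed.

End BalancedCells.

Section DegenerateInterpolation.
Variable R : realType.
Notation mu := (@lebesgue_measure R).
Notation I := (`]-1, 1[%classic : set R).
Implicit Types (s : bool) (a b c nu z : R).

Definition half_itv s a b : set R := if s then `]a, b[%classic else `]-b, -a[%classic.

Lemma Rintegral_half_itv_split s (f : R -> R) a b c : a < b -> b < c ->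
  Rintegrable mu (half_itv s a c) f ->
  \int[mu]_(z in half_itv s a c) f z =
  \int[mu]_(z in half_itv s a b) f z + \int[mu]_(z in half_itv s b c) f z.
Proof.
move=> ab bc; case: s => /= fi; first exact: Rintegral_itv_split.
by rewrite (@Rintegral_itv_split _ _ (- c) (- b) (- a)) ?ltrN2// addrC.
Qed.

Variables u g h : R -> R.
Hypotheses (Lu : L2 mu I u) (Lg : L2 mu I g) (Lh : L2 mu I h).
Hypotheses (ug : weak_deriv (-1) 1 u g) (gh : weak_deriv (-1) 1 g h).

Lemma Rintegrable_norm_sqr (v : R -> R) : L2 mu I v ->
  Rintegrable mu I (fun z => `|z| * v z ^+ 2).
Proof.
move=> Lv; apply: (@Rintegrable_weighted_sqr _ _ _ _ _ 1) => //.
  by move=> z; exact: norm_continuous.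
by move=> z /andP[? ?]; rewrite normr_id ler_norml; lra.
Qed.

Lemma Rintegrable_sqr_sqr (v : R -> R) : L2 mu I v ->
  Rintegrable mu I (fun z => z ^+ 2 * v z ^+ 2).
Proof.
move=> Lv; apply: (@Rintegrable_weighted_sqr _ _ _ _ _ 1) => //.
  exact: exprn_continuous.
by move=> z /andP[? ?]; rewrite normrX exprn_ile1// ler_norml; lra.
Qed.

Definition interpolates_on (D : set R) nu : Prop :=
  nu * \int[mu]_(z in D) (`|z| * g z ^+ 2) <=
  interpolation_cst R * (nu ^+ 2 * \int[mu]_(z in D) (z ^+ 2 * u z ^+ 2) +
    \int[mu]_(z in D) (h z ^+ 2)).

Let L2_subitv l r v : -1 <= l -> r <= 1 -> L2 mu I v -> L2 mu `]l, r[ v.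
Proof. by move=> l1 r1; apply: L2S => //; exact: subset_itvW. Qed.

Lemma interpolates_half_cell s nu c a b : 0 <= c -> c <= a -> 0 < a -> a < b ->
  b <= 1 -> 0 <= nu -> cell_cst_bounds nu c a b ->
  interpolates_on (half_itv s c b) nu.
Proof.
move=> c0 ca a0 ab b1 n0 [CU CH]; have K0 := interpolation_cst_ge0 R.
case: s => /=.
  have [c1 b1'] : -1 <= c /\ b <= 1 by split=> //; lra.
  apply: (@weighted_interpolation _ c b u g h _ _ _ _ _ nu b a _ a b) => //;
    rewrite ?(ltW a0)//; try exact: L2_subitv; try exact: weak_derivS ug;
    try exact: weak_derivS gh.
  - by move=> z /andP[? ?]; rewrite ger0_norm; lra.
  - by move=> z /andP[? ?]; rewrite ger0_norm; lra.
have [b1' c1] : -1 <= - b /\ - c <= 1 by split; lra.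
apply: (@weighted_interpolation _ (- b) (- c) u g h _ _ _ _ _ nu b a _ (- b) (- a)) => //;
  rewrite ?ltrN2 ?lerN2 ?(ltW a0)//; try exact: L2_subitv; try exact: weak_derivS ug;
    try exact: weak_derivS gh.
- by move=> z /andP[? ?]; rewrite ler_norml; lra.
- by move=> z /andP[? ?]; rewrite ltr0_norm; lra.
- by rewrite !opprK [- c + b]addrC [- a + b]addrC.
- by rewrite !opprK [- c + b]addrC.
Qed.

Let measurable_half_itv s a b : measurable (half_itv s a b : set (measurableTypeR R)).
Proof. by rewrite /half_itv; case: s. Qed.

Let subset_half_itv s a b : 0 <= a -> b <= 1 -> half_itv s a b `<=` I.
Proof.
by move=> a0 b1; case: s => /=; apply: subset_itvW; rewrite ?lerN2//; lra.
Qed.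

Lemma interpolates_on_split s nu a b c : 0 <= a -> a < b -> b < c -> c <= 1 ->
  interpolates_on (half_itv s a b) nu -> interpolates_on (half_itv s b c) nu ->
  interpolates_on (half_itv s a c) nu.
Proof.
move=> a0 ab bc c1 Qab Qbc; rewrite /interpolates_on.
have iS (v : R -> R) : Rintegrable mu I v -> Rintegrable mu (half_itv s a c) v.
  by apply: RintegrableS => //; exact: subset_half_itv.
rewrite !(Rintegral_half_itv_split ab bc); first last.
- exact/iS/Rintegrable_norm_sqr.
- exact/iS/Rintegrable_sqr_sqr.
- by apply: iS; case: Lh.
by move: Qab Qbc; rewrite /interpolates_on; move: (interpolation_cst R) => K; lra.
Qed.

Lemma interpolates_on_half s nu : 1 <= nu -> interpolates_on (half_itv s 0 1) nu.
Proof.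
move=> n1; have n0 : 0 < nu by exact: lt_le_trans n1.
have [N [N1 nN Nn]] := exists_sqr_ge n1; have N0 := ltnW N1.
suff upto M : (1 < M)%N -> (M <= N)%N ->
    interpolates_on (half_itv s 0 (cell_node R N M)) nu.
  by rewrite -(cell_node_last R N0); exact: upto.
elim: M => // M IH; rewrite ltnS leq_eqVlt => /predU1P[<- _|M1 MN].
  have cell := balanced_cell_node N0 n0 nN Nn (ltn0Sn 0).
  have [a0 ab _ _ _] := cell.
  apply: interpolates_half_cell (balanced_cell_bounds_from0 n0 _ cell) => //.
  - exact: ltW.
  - exact: cell_node_le1.
  - exact: ltW.
  - by rewrite cell_node_exp3 expr_div_n expr1n mul1r ler_pdivrMr ?mul1r ?exprn_gt0 ?ltr0n.
have cell := balanced_cell_node N0 n0 nN Nn (ltnW M1).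
have [a0 ab _ _ _] := cell.
apply: (interpolates_on_split (lexx 0) a0 ab); first exact: cell_node_le1.
  exact: IH (ltnW MN).
apply: interpolates_half_cell (balanced_cell_bounds n0 cell) => //; try exact: ltW.
exact: cell_node_le1.
Qed.

Lemma degenerate_interpolation nu : 1 <= nu -> interpolates_on I nu.
Proof.
move=> n1; have Qpos := interpolates_on_half true n1.
have := interpolates_on_half false n1; move: Qpos.
rewrite /interpolates_on /half_itv oppr0.
have N10 : (-1 : R) < 0 by rewrite ltrN10.
rewrite !(Rintegral_itv_split N10 ltr01).
- by move: (interpolation_cst R) => K; lra.
- by case: Lh.
- exact: Rintegrable_sqr_sqr.
- exact: Rintegrable_norm_sqr.
Qed.

End DegenerateInterpolation.

Section TrigonometricSystem.
Variable R : realType.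
Notation mu := (@lebesgue_measure R).
Variables x0 x1 : R.
Hypothesis x01 : x0 < x1.
Notation D := (`]x0, x1[%classic : set R).
Notation L := (x1 - x0).
Implicit Types (x : R) (m n : nat).

Definition freq : R := pi / L.

Definition ecos n x : R := cos (n%:R * freq * x + - (n%:R * freq * x0)).

Definition esin n x : R := sin (n%:R * freq * x + - (n%:R * freq * x0)).

Definition ecos_norm2 n : R := if n is 0 then L else L / 2.

Lemma length_gt0 : 0 < L. Proof. by rewrite subr_gt0. Qed.

Lemma freq_gt0 : 0 < freq.
Proof. by rewrite divr_gt0 ?pi_gt0 ?length_gt0. Qed.

Lemma ecos_norm2_gt0 n : 0 < ecos_norm2 n.
Proof. by case: n => [|n]; rewrite ?divr_gt0 ?length_gt0. Qed.

Lemma ecosE n x : ecos n x = cos (n%:R * (freq * (x - x0))).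
Proof. by rewrite /ecos; congr cos; ring. Qed.

Lemma esinE n x : esin n x = sin (n%:R * (freq * (x - x0))).
Proof. by rewrite /esin; congr sin; ring. Qed.

Lemma ecos0 x : ecos 0 x = 1.
Proof. by rewrite ecosE mul0r cos0. Qed.

Lemma smooth_ecos n : smooth (ecos n).
Proof. by apply: smooth_affine; have [] := smooth_sin_cos R. Qed.

Lemma smooth_esin n : smooth (esin n).
Proof. by apply: smooth_affine; have [] := smooth_sin_cos R. Qed.

Lemma ecos_le1 n x : `|ecos n x| <= 1.
Proof. exact: cos_max. Qed.

Lemma esin_le1 n x : `|esin n x| <= 1.
Proof. exact: sin_max. Qed.

Lemma derive1_esin n x : derive1 (esin n) x = n%:R * freq * ecos n x.
Proof.
rewrite derive1_comp_affine; last first.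
  by have [_] := is_derive_sin (n%:R * freq * x + - (n%:R * freq * x0)).
by rewrite derive1E derive_val.
Qed.

Lemma sin_natpi n : sin (n%:R * pi) = 0 :> R.
Proof.
elim: n => [|n IH]; first by rewrite mul0r sin0.
by rewrite -natr1 mulrDl mul1r sinDpi IH oppr0.
Qed.

Lemma esin_left n : esin n x0 = 0.
Proof. by rewrite esinE subrr !mulr0 sin0. Qed.

Lemma esin_right n : esin n x1 = 0.
Proof. by rewrite esinE /freq divfK ?gt_eqF ?length_gt0// sin_natpi. Qed.

Let L2_smooth_le1 (q : R -> R) : smooth q -> (forall x, `|q x| <= 1) -> L2 mu D q.
Proof.
move=> sq q1; apply: (@L2_bounded _ _ _ mu _ _ _ 1) => //.
  exact: lebesgue_measure_itv_lty.
exact: measurable_fun_smooth.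
Qed.

Lemma L2_ecos n : L2 mu D (ecos n).
Proof. by apply: L2_smooth_le1; [exact: smooth_ecos|exact: ecos_le1]. Qed.

Lemma Rintegral_ecos n : \int[mu]_(x in D) ecos n x = L *+ (n == 0).
Proof.
have [->|n0] := eqVneq n 0.
  rewrite mulr1n -[RHS]mul1r -(Rintegral_itv_cst 1 (ltW x01)).
  by apply: eq_Rintegral => x _; rewrite ecos0.
have nf0 : n%:R * freq != 0.
  by rewrite mulf_neq0 ?pnatr_eq0// gt_eqF ?freq_gt0.
have := Rintegral_derive1_smooth x01 (smooth_esin n).
rewrite esin_left esin_right subrr; under eq_Rintegral do rewrite derive1_esin.
rewrite (RintegralZl _ _ (L2_itv_Rintegrable (L2_ecos n)))//.
by move=> /eqP; rewrite mulf_eq0 (negbTE nf0) => /eqP.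
Qed.

Lemma ecosM m n x : (n <= m)%N ->
  ecos m x * ecos n x = (ecos (m - n) x + ecos (m + n) x) / 2.
Proof.
move=> nm; rewrite !ecosE; move: (freq * (x - x0)) => t.
rewrite natrB// natrD [(m%:R - n%:R) * t]mulrBl [(m%:R + n%:R) * t]mulrDl.
by rewrite cosB cosD; field.
Qed.

Lemma esinM m n x : (n <= m)%N ->
  esin m x * esin n x = (ecos (m - n) x - ecos (m + n) x) / 2.
Proof.
move=> nm; rewrite !ecosE !esinE; move: (freq * (x - x0)) => t.
rewrite natrB// natrD [(m%:R - n%:R) * t]mulrBl [(m%:R + n%:R) * t]mulrDl.
by rewrite cosB cosD; field.
Qed.

Let Rintegral_half_sum (s : bool) m n : (n <= m)%N -> (0 < m)%N ->
  \int[mu]_(x in D) ((ecos (m - n) x + (-1) ^+ s * ecos (m + n) x) / 2) =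
  (L / 2) *+ (m == n).
Proof.
move=> nm m0; have i1 := L2_itv_Rintegrable (L2_ecos (m - n)).
have i2 := L2_itv_Rintegrable (L2_ecos (m + n)).
have i2' : Rintegrable mu D (fun x => (-1) ^+ s * ecos (m + n) x).
  exact: RintegrableZ.
rewrite (RintegralZr _ _ (RintegrableD _ i1 i2'))//.
rewrite (RintegralD _ i1 i2')// (RintegralZl _ _ i2)// !Rintegral_ecos.
rewrite addn_eq0 (gtn_eqF m0) subn_eq0 /= mulr0 addr0.
by rewrite eqn_leq nm andbT mulrnAl.
Qed.

Let orthogonal_wlog (e : nat -> R -> R) : (forall m n, (n <= m)%N -> (0 < m)%N ->
    \int[mu]_(x in D) (e m x * e n x) = (L / 2) *+ (m == n)) ->
  forall m n, (0 < maxn m n)%N ->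
    \int[mu]_(x in D) (e m x * e n x) = (L / 2) *+ (m == n).
Proof.
move=> orth m n; have [mn|nm] := leqP m n => mn0; last exact/orth/mn0/ltnW.
by rewrite eq_sym -orth//; apply: eq_Rintegral => x _; rewrite mulrC.
Qed.

Lemma ecos_orthogonal m n :
  \int[mu]_(x in D) (ecos m x * ecos n x) = ecos_norm2 n *+ (m == n).
Proof.
have [mn0|] := posnP (maxn m n).
  have [-> ->] : m = 0 /\ n = 0 by lia.
  rewrite -[RHS](Rintegral_ecos 0); apply: eq_Rintegral => x _.
  by rewrite ecos0 mulr1.
move=> mn0; rewrite (orthogonal_wlog _ mn0) => [|{mn0}m' n' nm m0].
  by case: n mn0 => //; rewrite maxn0 => m0; rewrite (gtn_eqF m0).
rewrite -(Rintegral_half_sum false nm m0); apply: eq_Rintegral => x _.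
by rewrite ecosM// expr0 mul1r.
Qed.

Lemma esin_orthogonal m n :
  \int[mu]_(x in D) (esin m.+1 x * esin n.+1 x) = (L / 2) *+ (m == n).
Proof.
rewrite -eqSS orthogonal_wlog ?leq_max// => {}m {}n nm m0.
rewrite -(Rintegral_half_sum true nm m0); apply: eq_Rintegral => x _.
by rewrite esinM// expr1 mulN1r.
Qed.

Lemma ecos1_inj : {in `[x0, x1] &, injective (ecos 1)}.
Proof.
have f0 := freq_gt0; have L0 := length_gt0.
have phase z : z \in `[x0, x1] -> freq * (z - x0) \in `[0, pi].
  rewrite !in_itv/= => /andP[z0 z1]; rewrite mulr_ge0 ?(ltW f0) ?subr_ge0//=.
  by rewrite /freq mulrAC ler_pdivrMr// ler_wpM2l ?pi_ge0// lerD2r.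
move=> x y xI yI; rewrite !ecosE !mul1r => /cos_inj eqxy.
by have := eqxy (phase _ xI) (phase _ yI) => /(mulfI (lt0r_neq0 f0)) /addIr.
Qed.

End TrigonometricSystem.

Section PoissonKernel.
Variable R : realType.
Implicit Types (r t x y : R) (M : nat).

Definition poisson_den r t : R := 1 - 2 * r * cos t + r ^+ 2.

Lemma poisson_den_ge r t : 0 <= r -> (1 - r) ^+ 2 <= poisson_den r t.
Proof.
move=> r0; have := ler_wpM2l r0 (cos_le1 t); rewrite /poisson_den => rcos.
by rewrite sqrrB expr1n mul1r -mulr_natl; lra.
Qed.

Lemma poisson_den_gt0 r t : 0 < r < 1 -> 0 < poisson_den r t.
Proof.
move=> /andP[r0 r1]; apply: lt_le_trans (poisson_den_ge t (ltW r0)).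
by rewrite exprn_gt0// subr_gt0.
Qed.

Lemma norm_sin_le t : `|sin t| <= `|t|.
Proof.
wlog t0 : t / 0 <= t => [hwlog|].
  have [/hwlog//|t0] := leP 0 t.
  by rewrite -normrN -sinN -[leRHS]normrN hwlog// oppr_ge0 ltW.
move: t0; rewrite le_eqVlt => /predU1P[<-|t0]; first by rewrite sin0 normr0.
have [c _] := @MVT R sin cos 0 t t0 (fun x _ => is_derive_sin x)
  (continuous_subspaceT (@continuous_sin R)).
rewrite sin0 !subr0 => ->; rewrite normrM.
by rewrite ler_piMl ?cos_max.
Qed.

Lemma poisson_den_le r t : 0 < r < 1 -> poisson_den r t <= (1 - r) ^+ 2 + t ^+ 2.
Proof.
move=> /andP[r0 r1]; have cos_ge : 2 * (1 - cos t) <= t ^+ 2.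
  have -> : cos t = 1 - 2 * sin (t / 2) ^+ 2.
    by rewrite {1}[t]splitr cosD -!expr2 cos2sin2; ring.
  have := norm_sin_le (t / 2); rewrite -ler_sqr_norm expr_div_n; lra.
have cos0 : 0 <= 2 * (1 - cos t) by have := cos_le1 t; lra.
have := ler_wpM2r cos0 (ltW r1); rewrite mul1r => rcos.
rewrite /poisson_den (_ : (1 - r) ^+ 2 = 1 - 2 * r + r ^+ 2); last by ring.
lra.
Qed.

Definition poisson_sum r M t : R :=
  1 + 2 * \sum_(i < M) r ^+ i.+1 * cos (i.+1%:R * t).

Lemma poisson_sumE r M t : poisson_den r t * poisson_sum r M t =
  1 - r ^+ 2 - 2 * r ^+ M.+1 * cos (M.+1%:R * t) + 2 * r ^+ M.+2 * cos (M%:R * t).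
Proof.
elim: M => [|M IH].
  by rewrite /poisson_sum big_ord0 /poisson_den mul0r cos0 mul1r; ring.
have -> : poisson_sum r M.+1 t =
    poisson_sum r M t + 2 * r ^+ M.+1 * cos (M.+1%:R * t).
  by rewrite /poisson_sum big_ord_recr/=; ring.
rewrite mulrDr IH.
have -> : cos (M%:R * t) = cos (M.+1%:R * t) * cos t + sin (M.+1%:R * t) * sin t.
  by rewrite -cosB; congr cos; rewrite -natr1; ring.
have -> : cos (M.+2%:R * t) = cos (M.+1%:R * t) * cos t - sin (M.+1%:R * t) * sin t.
  by rewrite -cosD; congr cos; rewrite -(natr1 M.+1); ring.
by rewrite /poisson_den !exprS; ring.
Qed.

Definition poisson_error r M : R := 4 * r ^+ M.+1 / (1 - r) ^+ 2.

Lemma poisson_error_ge0 r M : 0 < r < 1 -> 0 <= poisson_error r M.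
Proof.
by move=> /andP[r0 _]; rewrite divr_ge0 ?sqr_ge0// mulr_ge0// exprn_ge0 ?ltW.
Qed.

Lemma near_poisson_error_le r e : 0 < r < 1 -> 0 < e ->
  \forall M \near \oo, poisson_error r M <= e.
Proof.
move=> /andP[r0 r1] e0; have s0 : 0 < (1 - r) ^+ 2 by rewrite exprn_gt0// subr_gt0.
have d0 : 0 < e * (1 - r) ^+ 2 / 4 by rewrite divr_gt0// mulr_gt0.
have nr : `|r| < 1 by rewrite gtr0_norm.
have /cvgr0Pnorm_le/(_ _ d0) := @cvg_expr _ r nr.
apply: filterS => M; rewrite ger0_norm ?exprn_ge0 ?(ltW r0)// => rM.
rewrite /poisson_error ler_pdivrMr// mulrC -ler_pdivlMr//.
by apply: le_trans rM; rewrite exprS ler_piMl ?exprn_ge0 ?(ltW r0) ?(ltW r1).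
Qed.

Lemma poisson_sum_ge r M t : 0 < r < 1 ->
  (1 - r ^+ 2) / poisson_den r t - poisson_error r M <= poisson_sum r M t.
Proof.
move=> r01; have /andP[r0 r1] := r01; have d1 := poisson_den_ge t (ltW r0).
have d0 := poisson_den_gt0 t r01.
have rM0 : 0 <= r ^+ M.+1 by rewrite exprn_ge0// ltW.
have rM1 : r ^+ M.+2 <= r ^+ M.+1 by rewrite exprS ler_piMl// ltW.
have tail_ge : - (4 * r ^+ M.+1) <= - (2 * r ^+ M.+1 * cos (M.+1%:R * t)) +
    2 * r ^+ M.+2 * cos (M%:R * t).
  have cos1 := ler_wpM2l rM0 (cos_le1 (M.+1%:R * t)).
  have rM2 : 0 <= r ^+ M.+2 by rewrite exprn_ge0// ltW.
  have cos2 := ler_wpM2l rM2 (cos_geN1 (M%:R * t)).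
  rewrite -![2 * _ * cos _]mulrA; move: cos1 cos2 rM0 rM1 rM2.
  by move: (r ^+ M.+1) (r ^+ M.+2) (cos _) (cos _) => a b u v; lra.
have -> : poisson_sum r M t = (1 - r ^+ 2) / poisson_den r t +
   (- (2 * r ^+ M.+1 * cos (M.+1%:R * t)) + 2 * r ^+ M.+2 * cos (M%:R * t)) /
     poisson_den r t.
  apply: (mulfI (lt0r_neq0 d0)); rewrite poisson_sumE mulrDr.
  by rewrite ![poisson_den _ _ * _]mulrC !divfK ?lt0r_neq0//; ring.
rewrite lerD2l; apply: (@le_trans _ _ (- (4 * r ^+ M.+1) / poisson_den r t)).
  rewrite mulNr lerN2 ler_wpM2l//; first by rewrite mulr_ge0.
  by rewrite lef_pV2 ?posrE// exprn_gt0// subr_gt0.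
by rewrite ler_wpM2r// invr_ge0 ltW.
Qed.

Definition poisson_multiplier r M (i : nat) : R :=
  if i is 0 then 1 + poisson_error r M else r ^+ i.

Variables x0 x1 : R.
Hypothesis x01 : x0 < x1.
Notation L := (x1 - x0).
Notation ec := (ecos x0 x1).

Definition poisson_kernel r M :=
  multiplier_kernel ec (ecos_norm2 x0 x1) (poisson_multiplier r M) M.

Lemma poisson_kernelE r M x y : 2 * L * poisson_kernel r M x y =
  2 * poisson_error r M + poisson_sum r M (freq x0 x1 * (x - y)) +
  poisson_sum r M (freq x0 x1 * (x - x0) + freq x0 x1 * (y - x0)).
Proof.
have L0 := lt0r_neq0 (length_gt0 x01).
rewrite /poisson_kernel /multiplier_kernel big_ord_recl/= !ecos0.
have -> : freq x0 x1 * (x - y) = freq x0 x1 * (x - x0) - freq x0 x1 * (y - x0).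
  by ring.
have -> : \sum_(i < M) r ^+ bump 0 i / (L / 2) * (ec (bump 0 i) x * ec (bump 0 i) y) =
    L^-1 * (\sum_(i < M) r ^+ i.+1 *
      cos (i.+1%:R * (freq x0 x1 * (x - x0) - freq x0 x1 * (y - x0))) +
    \sum_(i < M) r ^+ i.+1 *
      cos (i.+1%:R * (freq x0 x1 * (x - x0) + freq x0 x1 * (y - x0)))).
  rewrite -big_split/= mulr_sumr; apply: eq_bigr => i _; rewrite !ecosE /bump/= add1n.
  move: (freq x0 x1 * (x - x0)) (freq x0 x1 * (y - x0)) => u v.
  by rewrite [_ * (u - v)]mulrBr [_ * (u + v)]mulrDr cosB cosD; field.
by rewrite /poisson_sum; field.
Qed.

Lemma poisson_kernel_ge r M x y : 0 < r < 1 ->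
  (1 - r ^+ 2) / poisson_den r (freq x0 x1 * (x - y)) <= 2 * L * poisson_kernel r M x y.
Proof.
move=> r01; rewrite poisson_kernelE.
set t1 := freq x0 x1 * (x - y); set t2 := _ + freq x0 x1 * (y - x0).
have := poisson_sum_ge M t1 r01; have := poisson_sum_ge M t2 r01.
have : 0 <= (1 - r ^+ 2) / poisson_den r t2.
  have /andP[r0 r1] := r01.
  by rewrite divr_ge0 ?(ltW (poisson_den_gt0 _ r01))// subr_ge0 exprn_ile1 ?ltW.
lra.
Qed.

Lemma poisson_kernel_ge0 r M x y : 0 < r < 1 -> 0 <= poisson_kernel r M x y.
Proof.
move=> r01; have /andP[r0 r1] := r01.
have L0 : 0 < 2 * L by rewrite mulr_gt0 ?length_gt0.
rewrite -(pmulr_rge0 _ L0); apply: le_trans (poisson_kernel_ge M x y r01).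
by rewrite divr_ge0 ?(ltW (poisson_den_gt0 _ r01))// subr_ge0 exprn_ile1 ?ltW.
Qed.

End PoissonKernel.

(* Korovkin's argument: a function separating the points of a compact set
   controls the oscillation of every continuous function *)
Lemma compact_oscillation_le (R : realType) (T : topologicalType) (K : set T)
    (f q : T -> R) (e : R) :
  compact K -> continuous f -> continuous q -> {in K &, injective q} -> 0 < e ->
  exists n : nat, forall x y, K x -> K y ->
    (f x - f y) ^+ 2 <= e + n%:R * (q x - q y) ^+ 2.
Proof.
move=> cK cf cq injq e0.
have csqr (v : T -> R) : continuous v ->
    continuous (fun p : T * T => (v p.1 - v p.2) ^+ 2).
  move=> cv p; apply: (@continuous_comp _ _ _ (fun p : T * T => v p.1 - v p.2)
    (fun t => t ^+ 2)); last exact: exprn_continuous.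
  apply: (@continuousB _ _ _ (v \o fst) (v \o snd)).
    by apply: continuous_comp; [exact: cvg_fst|exact: cv].
  by apply: continuous_comp; [exact: cvg_snd|exact: cv].
pose P (n : nat) (p : T * T) :=
  (f p.1 - f p.2) ^+ 2 <= e + n%:R * (q p.1 - q p.2) ^+ 2.
suff [n _ PK] : \forall n \near \oo, K `*` K `<=` P n.
  by exists n => x y Kx Ky; exact: (PK n (leqnn n) (x, y)).
apply: ((compact_near_coveringP _).1 (compact_setX cK cK)) => -[x y] [/= Kx Ky].
have [qxy|qxy] := eqVneq (q x) (q y).
  have xy : x = y by apply: injq => //; exact: mem_set.
  exists ([set p | (f p.1 - f p.2) ^+ 2 < e], setT) => /=.
    split; last exact: filterT.
    have fxy : (f x - f y) ^+ 2 < e by rewrite xy subrr expr0n.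
    exact: (csqr f cf (x, y) _ (lt_nbhsl fxy)).
  by move=> [p n] /= [pe _]; rewrite /P (le_trans (ltW pe))// lerDl mulr_ge0 ?sqr_ge0.
pose k := (q x - q y) ^+ 2 / 2; pose G := (f x - f y) ^+ 2 + 1.
have qxy0 : 0 < (q x - q y) ^+ 2 by rewrite exprn_even_gt0//= subr_eq0.
have k0 : 0 < k by rewrite divr_gt0.
exists ([set p | (f p.1 - f p.2) ^+ 2 < G /\ k < (q p.1 - q p.2) ^+ 2],
  [set n | G / k <= n%:R]) => /=.
  split; last exact: nbhs_infty_ger.
  apply: filterI.
    have fG : (f x - f y) ^+ 2 < G by rewrite ltrDl.
    exact: (csqr f cf (x, y) _ (lt_nbhsl fG)).
  have qk : k < (q x - q y) ^+ 2 by rewrite ltr_pdivrMr// ltr_pMr// ltr1n.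
  exact: (csqr q cq (x, y) _ (lt_nbhsr qk)).
move=> [p n] /= [[pG pk]]; rewrite ler_pdivrMr// => nG.
rewrite /P (le_trans (ltW pG))// (le_trans nG)// -[leLHS]add0r lerD ?(ltW e0)//.
by rewrite ler_wpM2l// ltW.
Qed.

Section Clamp.
Variable R : realType.
Implicit Types (m x y : R).

Definition clamp m x : R := Num.max (- m) (Num.min m x).

Lemma clampP m x : 0 <= m -> [\/ clamp m x = m /\ m <= x,
  clamp m x = - m /\ x <= - m | clamp m x = x /\ - m <= x <= m].
Proof.
move=> m0; rewrite /clamp; case: (leP m x) => mx.
  by case: (leP (- m) m) => m_m; [constructor 1|lra].
by case: (leP (- m) x) => m_x; [constructor 3|constructor 2]; split=> //; lra.
Qed.

Lemma clamp_le m x : 0 <= m -> `|clamp m x| <= m.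
Proof. by move=> m0; case: (clampP x m0) => -[-> ?]; rewrite ler_norml; lra. Qed.

Lemma clamp_id m x : `|x| <= m -> clamp m x = x.
Proof.
rewrite ler_norml => /andP[mx xm]; have m0 : 0 <= m by lra.
by case: (clampP x m0) => -[-> ?]; lra.
Qed.

Lemma clamp_lipschitz m x y : 0 <= m -> `|clamp m x - clamp m y| <= `|x - y|.
Proof.
move=> m0; have := ler_norm (x - y); have := ler_norm (y - x).
rewrite distrC => xy yx.
by case: (clampP x m0) => -[-> ?]; case: (clampP y m0) => -[-> ?];
  rewrite ler_norml; lra.
Qed.

Lemma norm_sub_clamp_le m x : 0 <= m -> `|x - clamp m x| <= `|x|.
Proof.
move=> m0; have := ler_norm x; have := ler_norm (- x); rewrite normrN => ? ?.
by case: (clampP x m0) => -[-> ?]; rewrite ler_norml; lra.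
Qed.

Lemma measurable_clamp d (T : measurableType d) (D : set T) m (f : T -> R) :
  measurable_fun D f -> measurable_fun D (fun t => clamp m (f t)).
Proof.
move=> mf; apply: measurable_maxr; first exact: measurable_cst.
by apply: measurable_minr => //; exact: measurable_cst.
Qed.

Lemma continuous_clamp (T : topologicalType) m (f : T -> R) :
  continuous f -> continuous (fun t => clamp m (f t)).
Proof.
move=> cf t; apply: (@continuous_max _ _ (cst (- m)) (fun s => Num.min m (f s))).
  exact: cst_continuous.
by apply: (@continuous_min _ _ (cst m) f); [exact: cst_continuous|exact: cf].
Qed.

Lemma L2_clamp_cvg d (T : measurableType d) (mu : {measure set T -> \bar R})
    (D : set T) (f : T -> R) : measurable D -> L2 mu D f ->
  \int[mu]_(t in D) ((f t - clamp n%:R (f t)) ^+ 2) @[n --> \oo] --> (0 : R).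
Proof.
move=> mD [mf f2i].
have <- : \int[mu]_(t in D) (cst 0 t) = 0 by rewrite Rintegral_cst// mul0r.
apply: (@dominated_cvg_Rintegral _ _ _ mu _ _ _ _ (fun t => f t ^+ 2)) => //.
- move=> n; apply: measurable_funX; apply: measurable_funB => //.
  exact: measurable_clamp.
- move=> t _; apply: cvg_near_cst; near=> n.
  rewrite clamp_id ?subrr ?expr0n//; near: n; exact: nbhs_infty_ger.
- by move=> n t _; rewrite ger0_norm ?sqr_ge0// ler_sqr_norm norm_sub_clamp_le.
Unshelve. all: by end_near. Qed.

End Clamp.

Section ContinuousDensity.
Variable R : realType.
Notation mu := (@lebesgue_measure R).
Variable D : set R.
Hypotheses (mD : measurable (D : set (measurableTypeR R))) (finD : (mu D < +oo)%E).
Implicit Types (f g : R -> R) (m e : R).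

Lemma L2_bounded_continuous_approx f m e : measurable_fun D f ->
  (forall x, D x -> `|f x| <= m) -> 0 <= m -> 0 < e ->
  exists2 g, continuous g /\ L2 mu D g & \int[mu]_(x in D) ((f x - g x) ^+ 2) <= e.
Proof.
move=> mf fm m0 e0; have Lf : L2 mu D f.
  exact: (@L2_bounded _ _ _ mu _ mD finD m).
have fi := L2_Rintegrable mD finD Lf.
have [g_ [cg ig /fine_cvgP[gfin gcvg]]] := @approximation_continuous_integrable
  R D f mD finD fi.
have d0 : 0 < e / (2 * m + 1) by rewrite divr_gt0// ltr_wpDl// mulr_ge0.
have [j fgj] : exists j, \int[mu]_(x in D) `|f x - g_ j x| <= e / (2 * m + 1).
  move/cvgr0Pnorm_le: gcvg => /(_ _ d0)[j _ gj].
  by exists j; apply: le_trans (ler_norm _) (gj j _) => /=.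
pose g x := clamp m (g_ j x); have cont_g : continuous g by exact: continuous_clamp.
have gm x : `|g x| <= m by exact: clamp_le.
have Lg : L2 mu D g.
  by apply: (@L2_bounded _ _ _ mu _ _ _ m) => //; exact: measurable_fun_continuous.
exists g => //; have i1 : Rintegrable mu D (fun x => `|f x - g_ j x|).
  have ifg : Rintegrable mu D (fun x => f x - g_ j x).
    by apply: RintegrableB => //; exact: ig.
  exact: (integrable_norm ifg).
apply: (@le_trans _ _ ((2 * m + 1) * \int[mu]_(x in D) `|f x - g_ j x|)); last first.
  by rewrite mulrC -ler_pdivlMr// ltr_wpDl// mulr_ge0.
rewrite -RintegralZl//; apply: le_Rintegral => //; last 1 first.
- move=> x Dx; rewrite -real_normK ?num_real// expr2; apply: ler_pM => //.
    apply: le_trans (ler_normB _ _) _.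
    by have := fm x Dx; have := gm x; lra.
  by rewrite -{1}(clamp_id (fm x Dx)); exact: clamp_lipschitz.
- by have [] : L2 mu D (fun x => f x - g x) by exact: L2B.
- exact: RintegrableZ.
Qed.

Lemma L2_continuous_dense f e : L2 mu D f -> 0 < e ->
  exists2 g, continuous g /\ L2 mu D g & \int[mu]_(x in D) ((f x - g x) ^+ 2) <= e.
Proof.
move=> Lf e0; have e40 : 0 < e / 4 by lra.
have [m fm] : exists m : nat,
    \int[mu]_(x in D) ((f x - clamp m%:R (f x)) ^+ 2) <= e / 4.
  have /cvgr0Pnorm_le/(_ _ e40)[m _ small] := L2_clamp_cvg mD Lf.
  by exists m; apply: le_trans (ler_norm _) (small m _) => /=.
pose fc x := clamp m%:R (f x); have mfc : measurable_fun D fc.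
  by apply: measurable_clamp; case: Lf.
have fcm x : D x -> `|fc x| <= m%:R by move=> _; exact: clamp_le.
have [g [cg Lg] fcg] := L2_bounded_continuous_approx mfc fcm (ler0n R m) e40.
exists g => //; have Lfc : L2 mu D fc.
  exact: (@L2_bounded _ _ _ mu _ mD finD m%:R).
have [_ i1] := L2B mD Lf Lfc; have [_ i2] := L2B mD Lfc Lg; have [_ i3] := L2B mD Lf Lg.
have i1' := RintegrableZ mD 2 i1; have i2' := RintegrableZ mD 2 i2.
apply: (@le_trans _ _ (\int[mu]_(x in D)
    (2 * (f x - fc x) ^+ 2 + 2 * (fc x - g x) ^+ 2))).
  apply: le_Rintegral => //; first exact: RintegrableD.
  move=> x _; rewrite -subr_ge0.
  by rewrite (_ : _ - _ = (f x - fc x - (fc x - g x)) ^+ 2) ?sqr_ge0//; ring.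
rewrite (RintegralD mD i1' i2') !RintegralZl//.
by move: fm fcg; rewrite -/fc; lra.
Qed.

End ContinuousDensity.

Section CosineParseval.
Variable R : realType.
Notation mu := (@lebesgue_measure R).
Variables x0 x1 : R.
Hypothesis x01 : x0 < x1.
Notation D := (`]x0, x1[%classic : set R).
Notation L := (x1 - x0).
Notation ec := (ecos x0 x1).
Notation norm2 := (ecos_norm2 x0 x1).
Notation energy := (mode_energy mu D ec norm2).
Notation defect := (Bessel_defect mu D ec norm2).
Implicit Types (f : R -> R) (r s e : R) (M : nat).

Let mD : measurable (D : set (measurableTypeR R)) := measurable_itv _.
Let finD : (mu D < +oo)%E := lebesgue_measure_itv_lty x0 x1 false true.
Let Le := L2_ecos x0 x1.
Let norm2_gt0 := ecos_norm2_gt0 x01.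
Let orth := ecos_orthogonal x01.
Let ec_le1 n x (_ : D x) := ecos_le1 x0 x1 n x.
Let ec0 x (_ : D x) := ecos0 x0 x1 x.

Definition poisson_form r M f : R :=
  dirichlet_form mu D ec norm2 (poisson_multiplier r M) M f.

Lemma poisson_formE r M f : poisson_form r M f =
  2 * (defect f M.+1 +
       poisson_error r M * (\int[mu]_(x in D) (f x ^+ 2) - energy f 0) +
       \sum_(i < M.+1) (1 - r ^+ i) * energy f i).
Proof.
rewrite /poisson_form /dirichlet_form /Bessel_defect; congr (2 * _).
have -> : \sum_(i < M.+1) poisson_multiplier r M i * energy f i =
    \sum_(i < M.+1) r ^+ i * energy f i + poisson_error r M * energy f 0.
  by rewrite !big_ord_recl/= expr0; ring.
have -> : \sum_(i < M.+1) (1 - r ^+ i) * energy f i =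
    \sum_(i < M.+1) energy f i - \sum_(i < M.+1) r ^+ i * energy f i.
  by rewrite -sumrB; apply: eq_bigr => i _; rewrite mulrBl mul1r.
by rewrite /=; ring.
Qed.

Lemma energy0_le f : L2 mu D f -> energy f 0 <= \int[mu]_(x in D) (f x ^+ 2).
Proof.
by move=> Lf; have := Bessel mD Le norm2_gt0 orth 1 Lf; rewrite big_ord1.
Qed.

Lemma defect_le_poisson_form r M f : 0 < r < 1 -> L2 mu D f ->
  2 * defect f M.+1 <= poisson_form r M f.
Proof.
move=> r01 Lf; have /andP[r0 r1] := r01; rewrite poisson_formE ler_wpM2l//.
rewrite -addrA lerDl addr_ge0//.
  by rewrite mulr_ge0 ?poisson_error_ge0// subr_ge0 energy0_le.
apply: sumr_ge0 => i _; rewrite mulr_ge0 ?mode_energy_ge0//.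
by rewrite subr_ge0 exprn_ile1// ltW.
Qed.

Lemma poisson_form_ecos1 r M : (0 < M)%N ->
  poisson_form r M (ec 1) = L * (1 - r + poisson_error r M).
Proof.
move=> M0; have energyE i : energy (ec 1) i = L / 2 *+ (1 == i)%N.
  rewrite /mode_energy /fourier_coef orth; case: eqP => [<-|_].
    by rewrite !mulr1n expr2 mulfK// gt_eqF.
  by rewrite !mulr0n expr0n mul0r.
rewrite /poisson_form /dirichlet_form.
have -> : \int[mu]_(x in D) (ec 1 x ^+ 2) = L / 2 by exact: (orth 1 1).
rewrite -(prednK M0) 2!big_ord_recl big1 => [|i _]; last by rewrite energyE mulr0n mulr0.
by rewrite !energyE/= expr1; field.
Qed.

Lemma defect_continuous_small f e : continuous f -> L2 mu D f -> 0 < e ->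
  exists M, defect f M <= e.
Proof.
move=> cf Lf e0; have L0 := length_gt0 x01; pose d := e / (2 * L).
have d0 : 0 < d by rewrite divr_gt0// mulr_gt0.
have injD : {in `[x0, x1]%classic &, injective (ec 1)}.
  by move=> x y /set_mem xI /set_mem yI; exact: ecos1_inj.
have [n fn] := compact_oscillation_le (@segment_compact _ x0 x1) cf
  (smooth_continuous (smooth_ecos x0 x1 1)) injD d0.
pose s : R := Num.min 2^-1 (d / n.+1%:R).
have s0 : 0 < s by rewrite lt_min invr_gt0 ltr0n divr_gt0.
have s1 : s < 1 by rewrite gt_min invf_lt1// ltr1n.
have ns : n%:R * s <= d.
  apply: (@le_trans _ _ (n.+1%:R * s)); first by rewrite ler_wpM2r ?ler_nat ?ltW.
  by rewrite mulrC -ler_pdivlMr// ge_min lexx orbT.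
have r01 : 0 < 1 - s < 1 by rewrite subr_gt0 s1 ltrBlDr ltrDl.
have [M0 _ errM] := near_poisson_error_le r01 s0.
pose M := (maxn M0 1)%N; exists M.+1.
have err_le : poisson_error (1 - s) M <= s by apply: errM; exact: leq_maxl.
have err0 := poisson_error_ge0 M r01.
rewrite -(@ler_pM2l _ 2)//; apply: le_trans (defect_le_poisson_form M r01 Lf) _.
have Dcc x : D x -> `[x0, x1]%classic x by apply: subset_itv_oo_cc.
have := dirichlet_form_le mD Le norm2_gt0 orth finD ec_le1 ec0 Lf (Le 1)
  (fun x y _ _ => poisson_kernel_ge0 x01 M x y r01)
  (fun x y Dx Dy => fn x y (Dcc x Dx) (Dcc y Dy)).
move=> /le_trans; apply; rewrite -/(poisson_form _ _ _) poisson_form_ecos1 ?leq_maxr//.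
have eE : 2 * e = 4 * (d * L) by rewrite /d; field; rewrite gt_eqF.
have := ler_wpM2r (ltW L0) ns; have := ler_wpM2l (mulr_ge0 (ler0n R n) (ltW L0)) err_le.
have := ler_wpM2l (ltW (mulr_gt0 d0 L0)) err_le.
have := ler_wpM2l (ltW (mulr_gt0 d0 L0)) (ltW s1).
rewrite eE /=; lra.
Qed.

Lemma Parseval f : L2 mu D f -> defect f M @[M --> \oo] --> (0 : R).
Proof.
move=> Lf; apply/cvgr0Pnorm_le => e e0; have e4 : 0 < e / 4 by lra.
have [g [cg Lg] fg] := L2_continuous_dense mD finD Lf e4.
have [M gM] := defect_continuous_small cg Lg e4.
exists M => // N MN; have def0 := Bessel_defect_ge0 mD Le norm2_gt0 orth N Lf.
rewrite ger0_norm//; apply: (@le_trans _ _ (defect f M)).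
  exact: Bessel_defect_nonincreasing.
have := Bessel_defect_perturb mD Le norm2_gt0 orth M Lf Lg; lra.
Qed.

Lemma onem_exprn_le r (n : nat) : 0 <= r <= 1 -> 1 - r ^+ n <= n%:R * (1 - r).
Proof.
move=> /andP[r0 r1]; elim: n => [|n IH]; first by rewrite expr0 subrr mul0r.
rewrite exprS -natr1 mulrDl mul1r.
have rn : r ^+ n <= 1 by rewrite exprn_ile1.
have := mulr_ge0 (_ : 0 <= 1 - r) (_ : 0 <= 1 - r ^+ n).
by rewrite !subr_ge0 r1 rn => /(_ isT isT); lra.
Qed.

Lemma poisson_form_le f A s e : L2 mu D f -> 0 < s < 1 -> 0 < e ->
  (forall M, \sum_(n < M) n%:R * energy f n <= A) ->
  exists M, poisson_form (1 - s) M f <= 2 * s * A + e.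
Proof.
move=> Lf /andP[s0 s1] e0 sumA.
have r01 : 0 < 1 - s < 1 by rewrite subr_gt0 s1 ltrBlDr ltrDl.
set V := \int[mu]_(x in D) (f x ^+ 2) - energy f 0.
have V0 : 0 <= V by rewrite subr_ge0 energy0_le.
have e40 : 0 < e / 4 by lra.
have /cvgr0Pnorm_le/(_ _ e40)[M1 _ defM] := Parseval Lf.
have d0 : 0 < e / 4 / (V + 1) by rewrite divr_gt0// ltr_wpDl.
have [M2 _ errM] := near_poisson_error_le r01 d0.
pose M := maxn M1 M2; exists M; rewrite poisson_formE -/V.
have def_le : defect f M.+1 <= e / 4.
  by apply: le_trans (ler_norm _) (defM _ _); rewrite /= leqW// leq_maxl.
have err_le : poisson_error (1 - s) M * V <= e / 4.
  apply: (@le_trans _ _ (e / 4 / (V + 1) * (V + 1))).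
    apply: ler_pM => //; [exact: poisson_error_ge0| |by rewrite lerDl].
    by apply: errM; exact: leq_maxr.
  by rewrite divfK// gt_eqF// ltr_wpDl.
have sum_le : \sum_(i < M.+1) (1 - (1 - s) ^+ i) * energy f i <= s * A.
  apply: (@le_trans _ _ (s * \sum_(i < M.+1) i%:R * energy f i)); last first.
    by rewrite ler_wpM2l// ltW.
  rewrite mulr_sumr; apply: ler_sum => i _; rewrite mulrA ler_wpM2r ?mode_energy_ge0//.
  have /andP[r0 r1] := r01.
  have := @onem_exprn_le (1 - s) i; rewrite (ltW r0) (ltW r1) => /(_ isT).
  by rewrite opprB addrCA subrr addr0 mulrC.
lra.
Qed.

End CosineParseval.

Section SlobodeckijSeminorm.
Variable R : realType.
Notation mu := (@lebesgue_measure R).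
Variables x0 x1 : R.
Hypothesis x01 : x0 < x1.
Notation D := (`]x0, x1[%classic : set R).
Notation L := (x1 - x0).
Notation energy := (mode_energy mu D (ecos x0 x1) (ecos_norm2 x0 x1)).
Notation w := (freq x0 x1).
Implicit Types (x y s A : R) (n : nat).

Lemma poisson_kernel_ge_regularized s x y M : 0 < s < 1 ->
  s / (s ^+ 2 + (w * (x - y)) ^+ 2) <= 2 * L * poisson_kernel x0 x1 (1 - s) M x y.
Proof.
move=> /andP[s0 s1]; have r01 : 0 < 1 - s < 1 by rewrite subr_gt0 s1 ltrBlDr ltrDl.
apply: le_trans (poisson_kernel_ge x01 M x y r01).
have d0 := poisson_den_gt0 (w * (x - y)) r01.
have := poisson_den_le (w * (x - y)) r01; rewrite subKr => d_le.
rewrite ler_pM ?invr_ge0 ?(ltW s0) ?(ltW (lt_le_trans d0 d_le))//.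
  rewrite (_ : 1 - (1 - s) ^+ 2 = s + s * (1 - s)); last by ring.
  by rewrite lerDl mulr_ge0 ?subr_ge0 ?ltW//.
by rewrite lef_pV2 ?posrE// (lt_le_trans d0).
Qed.

Definition slobodeckij (f : R -> R) : \bar R :=
  (\int[mu]_(x in D) \int[mu]_(y in D) ((f x - f y) ^+ 2 / (x - y) ^+ 2)%:E)%E.

Definition regularized_quotient (f : R -> R) s (p : R * R) : R :=
  (f p.1 - f p.2) ^+ 2 / ((s / w) ^+ 2 + (p.1 - p.2) ^+ 2).

Let regularized_den_gt0 s x : 0 < s -> 0 < (s / w) ^+ 2 + x ^+ 2.
Proof.
by move=> s0; rewrite ltr_pwDl ?sqr_ge0// exprn_gt0// divr_gt0 ?(freq_gt0 x01).
Qed.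

Lemma regularized_quotient_ge0 f s p : 0 <= regularized_quotient f s p.
Proof. by rewrite divr_ge0 ?sqr_ge0// addr_ge0 ?sqr_ge0. Qed.

Lemma regularized_quotient_le f s M x y : 0 < s < 1 ->
  regularized_quotient f s (x, y) <= 2 * L * w ^+ 2 / s *
    ((f x - f y) ^+ 2 * poisson_kernel x0 x1 (1 - s) M x y).
Proof.
move=> s01; have /andP[s0 _] := s01; have w0 := lt0r_neq0 (freq_gt0 x01).
have := poisson_kernel_ge_regularized x y M s01.
have den0 := lt0r_neq0 (regularized_den_gt0 (x - y) s0).
have -> : s / (s ^+ 2 + (w * (x - y)) ^+ 2) =
    s / w ^+ 2 / ((s / w) ^+ 2 + (x - y) ^+ 2).
  rewrite -[in RHS]mulrA -[in RHS]invfM; congr (_ / _).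
  by rewrite [RHS]mulrDr -!exprMn [w * (s / w)]mulrC divfK.
have c0 : 0 <= w ^+ 2 / s * (f x - f y) ^+ 2.
  by rewrite mulr_ge0 ?sqr_ge0// divr_ge0 ?sqr_ge0// ltW.
rewrite /regularized_quotient /=.
move: (_ + (x - y) ^+ 2) den0 => X X0 /(ler_wpM2l c0).
rewrite (_ : w ^+ 2 / s * _ * _ = (f x - f y) ^+ 2 / X); last first.
  by have sn0 := lt0r_neq0 s0; field; rewrite ?X0 ?w0 ?sn0.
by move=> /le_trans; apply; rewrite le_eqVlt; apply/orP; left; apply/eqP; ring.
Qed.

Lemma regularized_seminorm_le f s A : L2 mu D f -> 0 < s < 1 ->
  (forall M, \sum_(n < M) n%:R * energy f n <= A) ->
  (\int[mu]_(x in D) \int[mu]_(y in D) (regularized_quotient f s (x, y))%:E <=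
   (4 * L * w ^+ 2 * A)%:E)%E.
Proof.
move=> Lf s01 sumA; have /andP[s0 s1] := s01.
pose c := 2 * L * w ^+ 2 / s.
have c0 : 0 < c.
  rewrite divr_gt0// mulr_gt0 ?exprn_gt0 ?(freq_gt0 x01)//.
  by rewrite mulr_gt0// (length_gt0 x01).
have mD : measurable (D : set (measurableTypeR R)) by exact: measurable_itv.
have finD : (mu D < +oo)%E by exact: lebesgue_measure_itv_lty.
have ec_le1 n x (_ : D x) := ecos_le1 x0 x1 n x.
have ec0 x (_ : D x) := ecos0 x0 x1 x.
apply/lee_addgt0Pr => eta eta0.
have [M form_le] := poisson_form_le x01 Lf s01 (divr_gt0 eta0 c0) sumA.
pose variation := kernel_variation mu D (ecos x0 x1) (ecos_norm2 x0 x1)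
  (poisson_multiplier (1 - s) M) M f.
have inner_le x : D x -> (\int[mu]_(y in D) (regularized_quotient f s (x, y))%:E <=
    (c * variation x)%:E)%E.
  move=> Dx; have iK : Rintegrable mu D
      (fun y => (f x - f y) ^+ 2 * poisson_kernel x0 x1 (1 - s) M x y).
    exact: (Rintegrable_sqrB_kernel mD _ (L2_ecos x0 x1) finD ec_le1).
  rewrite /variation -(Rintegral_sqrB_kernel mD (L2_ecos x0 x1) (ecos_norm2_gt0 x01)
    (ecos_orthogonal x01) finD ec_le1 ec0 _ _ Lf Dx) -RintegralZl//.
  rewrite -Rintegrable_fineK//; last exact: RintegrableZ.
  apply: ge0_le_integral_nonmeasurable => y _; rewrite lee_fin.
    exact: regularized_quotient_ge0.
  exact: regularized_quotient_le.
have iV : Rintegrable mu D variation.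
  exact: (Rintegrable_kernel_variation mD _ (L2_ecos x0 x1) finD ec_le1).
apply: (@le_trans _ _ (\int[mu]_(x in D) (c * variation x)%:E)%E).
  apply: ge0_le_integral_nonmeasurable => x Dx; last exact: inner_le.
  by apply: integral_ge0 => y _; rewrite lee_fin regularized_quotient_ge0.
rewrite Rintegrable_fineK//; last exact: RintegrableZ.
rewrite RintegralZl// /variation (Rintegral_kernel_variation mD (L2_ecos x0 x1)
  (ecos_norm2_gt0 x01) (ecos_orthogonal x01) finD ec_le1 ec0)// -EFinD lee_fin.
have := ler_wpM2l (ltW c0) form_le; rewrite mulrDr [c * (eta / c)]mulrC divfK ?gt_eqF//.
move=> /le_trans; apply; rewrite lerD2r le_eqVlt; apply/orP; left; apply/eqP.
by rewrite /c; field; rewrite gt_eqF.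
Qed.

Lemma regularized_quotient_cvg f x y :
  regularized_quotient f n.+2%:R^-1 (x, y) @[n --> \oo] -->
  (f x - f y) ^+ 2 / (x - y) ^+ 2.
Proof.
have [->|xy] := eqVneq x y.
  rewrite !subrr expr0n mul0r (_ : (fun n => _) = cst 0); first exact: cvg_cst.
  by apply/funext => n; rewrite /regularized_quotient /= subrr expr0n mul0r.
have xy0 : (x - y) ^+ 2 != 0 by rewrite sqrf_eq0 subr_eq0.
apply: cvgM; first exact: cvg_cst.
apply: cvgV => //; rewrite -[X in _ --> X]add0r; apply: cvgD; last exact: cvg_cst.
have s0 : n.+2%:R^-1 / w @[n --> \oo] --> (0 : R).
  rewrite -(mul0r w^-1); apply: cvgM; last exact: cvg_cst.
  by have := @cvg_harmonic R; rewrite -cvg_shiftS.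
rewrite -(mul0r 0); under eq_fun do rewrite expr2; exact: cvgM.
Qed.

Lemma regularized_quotient_nonincreasing f s t p : 0 < t -> t <= s ->
  regularized_quotient f s p <= regularized_quotient f t p.
Proof.
move=> t0 ts; have s0 := lt_le_trans t0 ts.
rewrite /regularized_quotient ler_wpM2l ?sqr_ge0// lef_pV2 ?posrE ?regularized_den_gt0//.
have w0 := freq_gt0 x01; have tw0 : 0 < t / w by exact: divr_gt0.
have tsw : t / w <= s / w by rewrite ler_wpM2r// invr_ge0 ltW.
by rewrite lerD2r ler_sqr// nnegrE ltW// (lt_le_trans tw0).
Qed.

Lemma measurable_regularized_quotient f s : measurable_fun setT f ->
  measurable_fun setT
    (regularized_quotient f s : measurableTypeR R * measurableTypeR R -> R).
Proof.
move=> mf; pose RR := (measurableTypeR R * measurableTypeR R)%type.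
have mfst : measurable_fun setT (fst : RR -> R) by exact: measurable_fst.
have msnd : measurable_fun setT (snd : RR -> R) by exact: measurable_snd.
apply: measurable_funM.
  apply: measurable_funX; apply: measurable_funB.
    exact: (measurableT_comp mf mfst).
  exact: (measurableT_comp mf msnd).
apply: (measurableT_comp (@measurable_fun_inv R)); apply: measurable_funD => //.
by apply: measurable_funX; exact: measurable_funB.
Qed.

Lemma slobodeckij_le_bound f A : measurable_fun setT f -> L2 mu D f ->
  (forall M, \sum_(n < M) n%:R * energy f n <= A) ->
  (slobodeckij f <= (4 * L * w ^+ 2 * A)%:E)%E.
Proof.
move=> mf Lf sumA; pose s n : R := n.+2%:R^-1.
have s_gt0 n : 0 < s n by rewrite invr_gt0.
have s_lt1 n : s n < 1 by rewrite invf_lt1 ?ltr1n.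
have mD : measurable (D : set (measurableTypeR R)) by exact: measurable_itv.
pose F n (p : measurableTypeR R * measurableTypeR R) : \bar R :=
  (regularized_quotient f (s n) p)%:E.
have limF x y : limn (F ^~ (x, y)) = ((f x - f y) ^+ 2 / (x - y) ^+ 2)%:E.
  apply: cvg_lim => //; apply: cvg_EFin; first exact: nearW.
  exact: regularized_quotient_cvg.
have -> : (slobodeckij f =
    \int[mu]_(x in D) \int[mu]_(y in D) limn (F ^~ (x, y)))%E.
  by apply: eq_integral => x _; apply: eq_integral => y _; rewrite limF.
apply: iterated_integral_lim_le => //.
- by move=> n; apply/measurable_EFinP; exact: measurable_regularized_quotient.
- by move=> n p; rewrite lee_fin regularized_quotient_ge0.
- move=> p m n mn; rewrite lee_fin regularized_quotient_nonincreasing//.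
  by rewrite lef_pV2 ?posrE ?ltr0n// ler_nat !ltnS.
- by move=> n; apply: regularized_seminorm_le => //; rewrite s_gt0 s_lt1.
Qed.

Lemma slobodeckij_le f : measurable_fun setT f -> L2 mu D f ->
  (slobodeckij f <= (4 * L * w ^+ 2)%:E * \sum_(0 <= n <oo) (n%:R * energy f n)%:E)%E.
Proof.
move=> mf Lf; have term_ge0 n : (0 <= (n%:R * energy f n)%:E)%E.
  by rewrite lee_fin mulr_ge0// mode_energy_ge0// => m; exact: ecos_norm2_gt0.
set S := (\sum_(0 <= n <oo) _)%E.
have S0 : (0 <= S)%E by apply: nneseries_ge0 => n _ _; exact: term_ge0.
have [Sy|Sy] := eqVneq S +oo%E.
  rewrite Sy gt0_muley ?leey// lte_fin mulr_gt0 ?exprn_gt0 ?(freq_gt0 x01)//.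
  by rewrite mulr_gt0// (length_gt0 x01).
have Sfin : S \is a fin_num by rewrite ge0_fin_numE// ltey.
rewrite -(fineK Sfin) -EFinM; apply: slobodeckij_le_bound => // M.
rewrite -lee_fin fineK// -sumEFin.
rewrite -(big_mkord xpredT (fun n => (n%:R * energy f n)%:E)).
by apply: nneseries_lim_ge => n _ _; exact: term_ge0.
Qed.

End SlobodeckijSeminorm.

Section RectangleSections.
Context {d1 d2 : measure_display} {T1 : measurableType d1} {T2 : measurableType d2}.
Context {R : realType}.
Variables (m1 : {sigma_finite_measure set T1 -> \bar R}).
Variables (m2 : {sigma_finite_measure set T2 -> \bar R}).
Notation m12 := (m1 \x m2)%E.
Variables (A : set T1) (B : set T2).
Hypotheses (mA : measurable A) (mB : measurable B).
Hypotheses (finA : (m1 A < +oo)%E) (finB : (m2 B < +oo)%E).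
Notation AB := (A `*` B).
Implicit Types (F : T1 * T2 -> R) (q : T1 -> R) (b : T2 -> R).

Let mAB : measurable AB := measurableX mA mB.

Lemma rectangle_measure_lty : (m12 AB < +oo)%E.
Proof.
rewrite product_measure1E//.
by apply: lte_mul_pinfty; rewrite ?ge0_fin_numE ?measure_ge0.
Qed.

Definition section_extension F (z : T2) (x : T1) : R := (F \_ AB) (x, z).

Definition section_coef F q (z : T2) : R :=
  \int[m1]_(x in A) (section_extension F z x * q x).

Lemma section_extension_in F x z : A x -> B z -> section_extension F z x = F (x, z).
Proof. by move=> Ax Bz; rewrite /section_extension patchE mem_set. Qed.

Lemma restrict_rectangle_out1 F x z : ~ A x -> (F \_ AB) (x, z) = 0.
Proof. by move=> Ax; rewrite patchE memNset// => -[]. Qed.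

Lemma restrict_rectangle_out2 F x z : ~ B z -> (F \_ AB) (x, z) = 0.
Proof. by move=> Bz; rewrite patchE memNset// => -[]. Qed.

Section OneFunction.
Variable F : T1 * T2 -> R.
Hypothesis LF : L2 m12 AB F.

Lemma measurable_restrict_rectangle : measurable_fun setT (F \_ AB).
Proof. by apply/(measurable_restrictT _ _).1 => //; case: LF. Qed.

Lemma measurable_section_extension z : measurable_fun setT (section_extension F z).
Proof.
by apply: (measurableT_comp measurable_restrict_rectangle); exact: pair2_measurable.
Qed.

Let measurable_section z : measurable_fun A (section_extension F z).
Proof. by apply: measurable_funTS; exact: measurable_section_extension. Qed.

Let section_sqr_ge0 z : (0 <= \int[m1]_(x in A) (section_extension F z x ^+ 2)%:E)%E.
Proof. by apply: integral_ge0 => x _; rewrite lee_fin sqr_ge0. Qed.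

Lemma measurable_section_sqr : measurable_fun setT
  (fun z => \int[m1]_(x in A) (section_extension F z x ^+ 2)%:E)%E.
Proof.
pose G (p : T2 * T1) : \bar R := (section_extension F p.1 p.2 ^+ 2)%:E.
apply: (@measurable_section_integral _ _ _ _ _ m1 _ mA G) => [|p].
  apply/measurable_EFinP; apply: measurable_funX.
  apply: (measurableT_comp measurable_restrict_rectangle); exact: measurable_swap.
by rewrite lee_fin sqr_ge0.
Qed.

Lemma integral_section_sqr :
  (\int[m2]_(z in B) \int[m1]_(x in A) (section_extension F z x ^+ 2)%:E =
   \int[m12]_(p in AB) (F p ^+ 2)%:E)%E.
Proof.
pose G (p : T1 * T2) : \bar R := ((F \_ AB) p ^+ 2)%:E.
have mG : measurable_fun setT G.
  apply/measurable_EFinP; apply: measurable_funX.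
  exact: measurable_restrict_rectangle.
have G0 p : (0 <= G p)%E by rewrite lee_fin sqr_ge0.
have -> : (\int[m12]_(p in AB) (F p ^+ 2)%:E = \int[m12]_p G p)%E.
  rewrite integral_mkcond; apply: eq_integral => p _.
  by rewrite /G !patchE; case: ifP => // _; rewrite expr0n.
rewrite (fubini_tonelli2 G mG G0) /fubini_G.
rewrite [RHS](@integralT_support _ _ _ _ B) => [|z Bz]; last first.
  by rewrite integral0_eq// => x _; rewrite /G restrict_rectangle_out2 ?expr0n.
apply: eq_integral => z _; apply/esym/integralT_support => x Ax.
by rewrite /G restrict_rectangle_out1 ?expr0n.
Qed.

Lemma integral_section_sqr_lty :
  (\int[m2]_(z in B) \int[m1]_(x in A) (section_extension F z x ^+ 2)%:E < +oo)%E.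
Proof. by have := integral_sqr_lty mAB LF; rewrite integral_section_sqr. Qed.

Lemma ae_section_L2 : {ae m2, forall z, B z -> L2 m1 A (section_extension F z)}.
Proof.
have i : m2.-integrable B
    (fun z => \int[m1]_(x in A) (section_extension F z x ^+ 2)%:E)%E.
  apply/integrableP; split.
    by apply: measurable_funTS; exact: measurable_section_sqr.
  under eq_integral do rewrite gee0_abs//.
  exact: integral_section_sqr_lty.
apply: filterS (integrable_ae mB i) => z zf Bz; apply: L2P => //.
by rewrite ltey_eq zf.
Qed.

Variables (q : T1 -> R) (Q : R).
Hypotheses (mq : measurable_fun setT q) (q_le : forall x, `|q x| <= Q).

Let Lq : L2 m1 A q.
Proof. by apply: (@L2_bounded _ _ _ m1 _ mA finA Q) => //; exact: measurable_funTS. Qed.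

Lemma section_coef_sqr_le z : L2 m1 A (section_extension F z) ->
  ((section_coef F q z ^+ 2)%:E <= (\int[m1]_(x in A) (q x ^+ 2))%:E *
    \int[m1]_(x in A) (section_extension F z x ^+ 2)%:E)%E.
Proof.
move=> LS; rewrite Rintegrable_fineK//; last by case: LS.
by rewrite -EFinM lee_fin mulrC; exact: Cauchy_Schwarz_Rintegral.
Qed.

Let integrable_extension_mul : m12.-integrable setT
  (fun p : T1 * T2 => ((F \_ AB) p * q p.1)%:E).
Proof.
have Lq12 : L2 m12 AB (fun p => q p.1).
  apply: (@L2_bounded _ _ _ m12 _ mAB rectangle_measure_lty Q) => //.
  by apply: measurable_funTS; apply: measurableT_comp => //; exact: measurable_fst.
have := Rintegrable_L2M mAB LF Lq12; rewrite /Rintegrable => /(integrable_mkcond _ mAB).1.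
apply: eq_integrable => // p _; rewrite /= !patchE.
by case: ifP => // _; rewrite mul0r.
Qed.

Lemma measurable_section_coef : measurable_fun setT (section_coef F q).
Proof.
have mG := measurable_fubini_G integrable_extension_mul.
have -> : section_coef F q =
    fine \o (fun z => \int[m1]_x ((F \_ AB) (x, z) * q x)%:E)%E.
  apply/funext => z /=; congr fine; apply/esym/integralT_support => x Ax.
  by rewrite restrict_rectangle_out1 ?mul0r.
exact: measurableT_comp mG.
Qed.

Lemma L2_section_coef : L2 m2 B (section_coef F q).
Proof.
apply: L2P; first by apply: measurable_funTS; exact: measurable_section_coef.
set c := \int[m1]_(x in A) (q x ^+ 2).
have c0 : 0 <= c by apply: Rintegral_ge0 => x _; exact: sqr_ge0.
apply: (@le_lt_trans _ _ (\int[m2]_(z in B)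
    (c%:E * \int[m1]_(x in A) (section_extension F z x ^+ 2)%:E))%E).
  apply: ae_ge0_le_integral => //.
  - by move=> z _; rewrite lee_fin sqr_ge0.
  - apply/measurable_EFinP; apply: measurable_funX; apply: measurable_funTS.
    exact: measurable_section_coef.
  - by move=> z _; rewrite mule_ge0 ?lee_fin.
  - by apply: measurable_funTS; apply: measurable_funeM; exact: measurable_section_sqr.
  by apply: filterS ae_section_L2 => z LS Bz; exact/section_coef_sqr_le/LS.
rewrite ge0_integralZl//; last by apply: measurable_funTS; exact: measurable_section_sqr.
by rewrite lte_mul_pinfty ?lee_fin//; exact: integral_section_sqr_lty.
Qed.

Lemma Rintegral_section_coef b b_max : measurable_fun setT b ->
  (forall z, `|b z| <= b_max) ->
  \int[m12]_(p in AB) (F p * (q p.1 * b p.2)) =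
  \int[m2]_(z in B) (section_coef F q z * b z).
Proof.
move=> mb b_le; pose f (p : T1 * T2) : \bar R := ((F \_ AB) p * q p.1 * b p.2)%:E.
have fi : m12.-integrable setT f.
  have mb2 : measurable_fun setT (fun p : T1 * T2 => b p.2).
    by apply: measurableT_comp => //; exact: measurable_snd.
  exact: (RintegrableMb (D := setT) _ integrable_extension_mul mb2 (fun p _ => b_le p.2)).
rewrite /Rintegral; congr fine.
have -> : (\int[m12]_(p in AB) (F p * (q p.1 * b p.2))%:E = \int[m12]_p f p)%E.
  rewrite integral_mkcond; apply: eq_integral => p _.
  by rewrite /f !patchE; case: ifP => _; rewrite ?mulrA// !mul0r.
rewrite -(integral21_prod_meas1 fi) /fubini_G (@integralT_support _ _ _ _ B); last first.
  move=> z Bz; rewrite integral0_eq// => x _.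
  by rewrite /f restrict_rectangle_out2// !mul0r.
apply: ae_eq_integral => //.
- by apply: measurable_funTS; exact: measurable_fubini_G fi.
- apply/measurable_EFinP; apply: measurable_funTS; apply: measurable_funM => //.
  exact: measurable_section_coef.
apply: filterS ae_section_L2 => z LS Bz.
have iS := Rintegrable_L2M mA (LS Bz) Lq; have iSb := RintegrableZ mA (b z) iS.
rewrite (@integralT_support _ _ _ _ A) => [|x Ax]; last first.
  by rewrite /f restrict_rectangle_out1// !mul0r.
rewrite /section_coef -(RintegralZr _ mA iS) -Rintegrable_fineK//.
by apply: eq_Rintegrable iSb => // x _; rewrite mulrC.
Qed.

End OneFunction.

Lemma Bessel_section_coef F (e : nat -> T1 -> R) (c : nat -> R) (Q : R) M :
  L2 m12 AB F -> (forall n, measurable_fun setT (e n)) ->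
  (forall n x, `|e n x| <= Q) -> (forall n, 0 < c n) ->
  (forall m n, \int[m1]_(x in A) (e m x * e n x) = c n *+ (m == n)) ->
  \sum_(n < M) (\int[m2]_(z in B) (section_coef F (e n) z ^+ 2)) / c n <=
  \int[m12]_(p in AB) (F p ^+ 2).
Proof.
move=> LF me e_le c0 orth.
have Le n : L2 m1 A (e n).
  by apply: (@L2_bounded _ _ _ m1 _ mA finA Q) => //; exact: measurable_funTS.
have ic n : Rintegrable m2 B (fun z => (c n)^-1 * section_coef F (e n) z ^+ 2).
  by apply: RintegrableZ => //; case: (L2_section_coef LF (me n) (e_le n)).
have -> : \sum_(n < M) (\int[m2]_(z in B) (section_coef F (e n) z ^+ 2)) / c n =
    \int[m2]_(z in B) (\sum_(n < M) (c n)^-1 * section_coef F (e n) z ^+ 2).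
  rewrite Rintegral_sum//; apply: eq_bigr => n _; rewrite RintegralZl// 1?mulrC//.
  by case: (L2_section_coef LF (me n) (e_le n)).
have isum := Rintegrable_sum mB (index_enum 'I_M) (fun n : 'I_M => ic n).
rewrite -lee_fin -Rintegrable_fineK// -Rintegrable_fineK//; last by case: LF.
rewrite -(integral_section_sqr LF); apply: ae_ge0_le_integral => //.
- move=> z _; rewrite lee_fin sumr_ge0// => n _.
  by rewrite mulr_ge0 ?sqr_ge0// invr_ge0 ltW.
- by case/integrableP: isum.
- by move=> z _; apply: integral_ge0 => x _; rewrite lee_fin sqr_ge0.
- by apply: measurable_funTS; exact: measurable_section_sqr.
apply: filterS (ae_section_L2 LF) => z LS Bz; have {}LS := LS Bz.
rewrite Rintegrable_fineK//; last by case: LS.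
rewrite lee_fin; apply: le_trans (Bessel mA Le c0 orth M LS).
by rewrite le_eqVlt; apply/orP; left; apply/eqP; apply: eq_bigr => n _; rewrite mulrC.
Qed.

End RectangleSections.

Section TensorTestFunctions.
Variable R : realType.
Implicit Types (a b : R -> R).

Lemma dx_tensor a b : smooth a ->
  dx (fun p : R * R => a p.1 * b p.2) = (fun p : R * R => derive1 a p.1 * b p.2).
Proof.
by move=> sa; apply/funext => p; rewrite /dx/= derive1Mr//; exact: smooth_derivable.
Qed.

Lemma dz_tensor a b : smooth b ->
  dz (fun p : R * R => a p.1 * b p.2) = (fun p : R * R => a p.1 * derive1 b p.2).
Proof.
by move=> sb; apply/funext => p; rewrite /dz/= derive1Ml//; exact: smooth_derivable.
Qed.

Lemma Ck_tensor k a b : smooth a -> smooth b ->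
  Ck k (fun p : R * R => a p.1 * b p.2).
Proof.
elim: k a b => [|k IH] a b sa sb.
all: have cab : continuous (fun p : R * R => a p.1 * b p.2).
1,3: move=> p; apply: (@continuousM _ _ (a \o fst) (b \o snd));
  [apply: continuous_comp; [exact: cvg_fst|exact: smooth_continuous]
  |apply: continuous_comp; [exact: cvg_snd|exact: smooth_continuous]].
  by [].
split=> //; split; last first.
  by rewrite dx_tensor// dz_tensor//; split; apply: IH => //; exact: smooth_derive1.
move=> p; split => /=.
  by apply: (@derivableM _ _ a (cst (b p.2))) => //; exact: smooth_derivable.
by apply: (@derivableM _ _ (cst (a p.1)) b) => //; exact: smooth_derivable.
Qed.

Lemma test_fun_tensor (x0 x1 : R) a b : test_fun_itv x0 x1 a ->
  test_fun_itv (-1) 1 b -> test_fun x0 x1 (fun p : R * R => a p.1 * b p.2).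
Proof.
move=> [sa [da da0 aout]] [sb [db db0 bout]]; split=> [k|]; first exact: Ck_tensor.
exists (Num.min da db); split; first by rewrite lt_min da0.
have [dda ddb] : Num.min da db <= da /\ Num.min da db <= db.
  by rewrite !ge_min !lexx orbT.
move=> p pout.
have [/andP[? ?]|/aout ->] := boolP (x0 + da <= p.1 <= x1 - da); last by rewrite mul0r.
have [/andP[? ?]|/bout ->] := boolP (-1 + db <= p.2 <= 1 - db); last by rewrite mulr0.
by exfalso; apply: pout; split; apply/andP; split; lra.
Qed.

End TensorTestFunctions.

Section IntervalCutoffs.
Variable R : realType.
Variables l r : R.
Hypothesis lr : l < r.
Notation D := (`]l, r[%classic : set R).
Implicit Types (q : R -> R) (x : R) (m : nat).

Definition cutoff_width m : R := (r - l) / m.+4%:R.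

Definition cutoff m : R -> R :=
  plateau (l + cutoff_width m) (r - 2 * cutoff_width m) (cutoff_width m).

Lemma cutoff_width_gt0 m : 0 < cutoff_width m.
Proof. by rewrite divr_gt0 ?subr_gt0. Qed.

Lemma cutoff_width_le m : 4 * cutoff_width m <= r - l.
Proof.
rewrite mulrA ler_pdivrMr// mulrC ler_wpM2l ?subr_ge0 ?(ltW lr)//.
by rewrite ler_nat.
Qed.

Lemma near_cutoff_width x : D x ->
  \forall m \near \oo, l + 2 * cutoff_width m < x < r - 2 * cutoff_width m.
Proof.
rewrite /= in_itv /= => /andP[lx xr]; have L0 : 0 < r - l by rewrite subr_gt0.
pose d := Num.min (x - l) (r - x) / (2 * (r - l)).
have d0 : 0 < d by rewrite divr_gt0 ?lt_min ?subr_gt0 ?lx ?xr// mulr_gt0.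
have := near_natSinv_lt d0; apply: filterS => m md.
have : 2 * cutoff_width m < Num.min (x - l) (r - x).
  rewrite /cutoff_width mulrA mulrC -ltr_pdivlMr; last by rewrite mulr_gt0.
  by apply: le_lt_trans md; rewrite lef_pV2 ?posrE// ler_nat; lia.
by rewrite lt_min => /andP[? ?]; apply/andP; split; lra.
Qed.

Lemma smooth_cutoff m : smooth (cutoff m).
Proof. exact: smooth_plateau. Qed.

Lemma cutoff_le1 m x : `|cutoff m x| <= 1.
Proof. exact: plateau_le1. Qed.

Lemma test_fun_itv_cutoffM m q : smooth q ->
  test_fun_itv l r (fun x => cutoff m x * q x).
Proof.
move=> sq; have e0 := cutoff_width_gt0 m; have e4 := cutoff_width_le m.
have tc : test_fun_itv l r (cutoff m) by apply: test_fun_itv_plateau => //; lra.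
rewrite (_ : (fun x => _) = fun x => q x * cutoff m x).
  exact: test_fun_itvM.
by apply/funext => x; rewrite mulrC.
Qed.

Lemma cutoff_cvg x : D x -> cutoff m x @[m --> \oo] --> (1 : R).
Proof.
move=> Dx; apply: cvg_near_cst; apply: filterS (near_cutoff_width Dx) => m /andP[? ?].
have e0 := cutoff_width_gt0 m; apply: plateau_in => //.
by apply/andP; split; lra.
Qed.

Lemma derive1_cutoffM m q x : smooth q ->
  derive1 (fun x => cutoff m x * q x) x =
  derive1 (cutoff m) x * q x + cutoff m x * derive1 q x.
Proof.
move=> sq.
have dM := is_deriveM (smooth_is_derive x (smooth_cutoff m)) (smooth_is_derive x sq).
by rewrite derive1E [LHS]derive_val /GRing.scale /= addrC [q x * _]mulrC.
Qed.

(* [q] vanishes at both end points, which compensates the blow-up of the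
   derivative of the cutoff *)
Lemma derive1_cutoff_mul_bounded q K : 0 <= K ->
  (forall x, `|q x| <= K * `|x - l|) -> (forall x, `|q x| <= K * `|r - x|) ->
  exists C, forall m x, `|derive1 (cutoff m) x * q x| <= C.
Proof.
move=> K0 ql qr; have [M M0 rampM] := derive1_ramp_bounded R.
exists (2 * M * K + 2 * M * K) => m x; have e0 := cutoff_width_gt0 m.
have Me0 : 0 <= M / cutoff_width m by rewrite divr_ge0 ?ltW.
have MKE : 2 * M * K = M / cutoff_width m * (K * (2 * cutoff_width m)).
  by have := lt0r_neq0 e0; move: (cutoff_width m) => e en0; field.
rewrite /cutoff derive1_plateauE mulrBl; apply: le_trans (ler_normB _ _) _.
have MK0 : 0 <= 2 * M * K by rewrite !mulr_ge0// ltW.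
have ramp_mul_le c :
    (c <= x <= c + cutoff_width m -> `|q x| <= K * (2 * cutoff_width m)) ->
    `|derive1 (ramp c (cutoff_width m)) x * q x| <= 2 * M * K.
  have [xc|xc _] := boolP (c <= x <= c + cutoff_width m).
    by move=> /(_ isT) qx; rewrite MKE normrM; apply: ler_pM => //; exact: rampM.
  by rewrite derive1_ramp_out// mul0r normr0.
apply: lerD; apply: ramp_mul_le => /andP[? ?].
  by apply: le_trans (ql x) _; rewrite ler_wpM2l// ler_norml; apply/andP; split; lra.
by apply: le_trans (qr x) _; rewrite ler_wpM2l// ler_norml; apply/andP; split; lra.
Qed.

Lemma derive1_cutoff_cvg0 x : D x -> derive1 (cutoff m) x @[m --> \oo] --> (0 : R).
Proof.
move=> Dx; apply: cvg_near_cst; apply: filterS (near_cutoff_width Dx) => m /andP[? ?].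
have e0 := cutoff_width_gt0 m.
rewrite /cutoff derive1_plateauE !derive1_ramp_out ?subr0//.
- by rewrite negb_and -!ltNge; apply/orP; left; lra.
- by rewrite negb_and -!ltNge; apply/orP; right; lra.
Qed.

Lemma derive1_cutoffM_cvg q x : smooth q -> D x ->
  derive1 (fun x => cutoff m x * q x) x @[m --> \oo] --> derive1 q x.
Proof.
move=> sq Dx.
have : derive1 (cutoff m) x * q x + cutoff m x * derive1 q x @[m --> \oo] -->
    0 * q x + 1 * derive1 q x.
  apply: cvgD; apply: cvgM; try exact: cvg_cst; first exact: derive1_cutoff_cvg0.
  exact: cutoff_cvg.
rewrite mul0r add0r mul1r; apply: cvg_trans; apply: near_eq_cvg; apply: nearW => m.
by rewrite derive1_cutoffM.
Qed.

End IntervalCutoffs.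

Section WeakCoefficients.
Variable R : realType.
Notation mu := (@lebesgue_measure R).
Notation mu2 := (mu \x mu)%E.
Variables x0 x1 : R.
Hypothesis x01 : x0 < x1.
Notation D := (`]x0, x1[%classic : set R).
Notation I := (`]-1, 1[%classic : set R).
Notation Om := (Omega x0 x1).
Notation RR := (measurableTypeR R * measurableTypeR R)%type.
Notation w := (freq x0 x1).
Notation ec := (ecos x0 x1).
Notation es := (esin x0 x1).
Implicit Types (F G K : R * R -> R) (a b q : R -> R).

Lemma OmegaE : Om = D `*` I.
Proof. by apply/seteqP; split=> -[x z] /=; rewrite !in_itv. Qed.

Definition coef F q (z : R) : R := section_coef mu D I F q z.

Let mD : measurable (D : set (measurableTypeR R)) := measurable_itv _.
Let mI : measurable (I : set (measurableTypeR R)) := measurable_itv _.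
Let finD : (mu D < +oo)%E := lebesgue_measure_itv_lty x0 x1 false true.
Let finI : (mu I < +oo)%E := lebesgue_measure_itv_lty (-1) 1 false true.

Lemma measurable_Omega : measurable (Om : set RR).
Proof. by rewrite OmegaE; exact: measurableX. Qed.

Lemma Omega_measure_lty : (mu2 (Om : set RR) < +oo)%E.
Proof. by rewrite OmegaE; exact: rectangle_measure_lty. Qed.

Lemma L2_coef F q (Q : R) : L2 mu2 (Om : set RR) F -> smooth q ->
  (forall x, `|q x| <= Q) -> L2 mu I (coef F q).
Proof.
rewrite OmegaE => LF sq qQ; apply: (L2_section_coef mD mI finD finI LF _ qQ).
exact: measurable_fun_smooth.
Qed.

Lemma Rintegral_coef F q b (Q B : R) : L2 mu2 (Om : set RR) F -> smooth q ->
  (forall x, `|q x| <= Q) -> smooth b -> (forall z, `|b z| <= B) ->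
  \int[mu2]_(p in Om) (F p * (q p.1 * b p.2)) = \int[mu]_(z in I) (coef F q z * b z).
Proof.
rewrite OmegaE => LF sq qQ sb bB.
by apply: (Rintegral_section_coef mD mI finD finI LF _ qQ _ bB);
  exact: measurable_fun_smooth.
Qed.

Lemma Rintegral_tensor_cvg F (a : nat -> R -> R) q b (A Q B : R) :
  L2 mu2 (Om : set RR) F -> (forall m, smooth (a m)) ->
  (forall m x, `|a m x| <= A) -> (forall x, D x -> a m x @[m --> \oo] --> q x) ->
  smooth q -> (forall x, `|q x| <= Q) -> smooth b -> (forall z, `|b z| <= B) ->
  \int[mu2]_(p in Om) (F p * (a m p.1 * b p.2)) @[m --> \oo] -->
  \int[mu]_(z in I) (coef F q z * b z).
Proof.
move=> LF sa aA aq sq qQ sb bB; rewrite -(Rintegral_coef LF sq qQ sb bB).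
have iF := L2_Rintegrable measurable_Omega Omega_measure_lty LF.
have mF : measurable_fun (Om : set RR) F by case: LF.
apply: (@dominated_cvg_Rintegral _ _ _ mu2 _ measurable_Omega _ _
  (fun p => (A * B) * `|F p|)).
- move=> m; apply: measurable_funM => //; apply: measurable_funTS.
  have ma : measurable_fun setT (a m) by exact: measurable_fun_smooth.
  have mb : measurable_fun setT b by exact: measurable_fun_smooth.
  apply: measurable_funM.
    by apply: (measurableT_comp ma); exact: measurable_fst.
  by apply: (measurableT_comp mb); exact: measurable_snd.
- apply: RintegrableZ; first exact: measurable_Omega.
  exact: (integrable_norm iF).
- move=> -[x z]; rewrite OmegaE => -[/= Dx _].
  by apply: cvgM; [exact: cvg_cst|apply: cvgM; [exact: aq|exact: cvg_cst]].
- by move=> m [x z] _; rewrite !normrM mulrC ler_wpM2r//; apply: ler_pM.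
Qed.

Definition weak_dz_tensor F G := forall a b, test_fun_itv x0 x1 a ->
  test_fun_itv (-1) 1 b ->
  \int[mu2]_(p in Om) (F p * (a p.1 * derive1 b p.2)) =
  - (\int[mu2]_(p in Om) (G p * (a p.1 * b p.2))).

Lemma weak_dz_tensorP F G : weak_dz x0 x1 F G -> weak_dz_tensor F G.
Proof.
move=> FG a b ta tb; have := FG _ (test_fun_tensor ta tb).
by rewrite dz_tensor; [rewrite /Rintegral => ->; rewrite fineN|case: tb].
Qed.

Lemma weak_dzz_tensorP F G H : weak_dz x0 x1 F G -> weak_dzz x0 x1 F H ->
  weak_dz_tensor G H.
Proof.
move=> FG FH a b ta tb; have tb' := test_fun_itv_derive1 tb.
apply: oppr_inj; rewrite opprK -(weak_dz_tensorP FG ta tb').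
have := FH _ (test_fun_tensor ta tb).
by rewrite !dz_tensor; [rewrite /Rintegral => ->|case: tb'|case: tb].
Qed.

Lemma weak_deriv_coef F G q (Q : R) : L2 mu2 (Om : set RR) F ->
  L2 mu2 (Om : set RR) G -> smooth q -> (forall x, `|q x| <= Q) ->
  weak_dz_tensor F G -> weak_deriv (-1) 1 (coef F q) (coef G q).
Proof.
move=> LF LG sq qQ FG b tb; have tb' := test_fun_itv_derive1 tb.
have N11 : -1 <= 1 :> R by lra.
have [B _ bB] := test_fun_itv_bounded N11 tb.
have [B' _ bB'] := test_fun_itv_bounded N11 tb'.
pose a m x := cutoff x0 x1 m x * q x.
have sa m : smooth (a m) by apply: smoothM => //; exact: smooth_cutoff.
have aQ m x : `|a m x| <= Q.
  by rewrite normrM -[leRHS]mul1r; apply: ler_pM => //; exact: cutoff_le1.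
have aq x : D x -> a m x @[m --> \oo] --> q x.
  move=> Dx; rewrite -[X in _ --> X]mul1r; apply: cvgM; last exact: cvg_cst.
  exact: cutoff_cvg.
have cvgF := Rintegral_tensor_cvg LF sa aQ aq sq qQ (proj1 tb') bB'.
have cvgG := Rintegral_tensor_cvg LG sa aQ aq sq qQ (proj1 tb) bB.
apply: (cvg_unique _ cvgF) => //; apply: (cvg_trans _ (cvgN cvgG)).
apply: near_eq_cvg; apply: nearW => m.
exact: esym (FG (a m) b (test_fun_itv_cutoffM x01 m sq) tb).
Qed.

Lemma weak_z_dx_coef F K q b (C Q Q' : R) : L2 mu2 (Om : set RR) F ->
  L2 mu2 (Om : set RR) K -> weak_z_dx x0 x1 F K -> smooth q ->
  (forall x, `|q x| <= Q) -> (forall x, `|derive1 q x| <= Q') -> 0 <= C ->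
  (forall x, `|q x| <= C * `|x - x0|) -> (forall x, `|q x| <= C * `|x1 - x|) ->
  test_fun_itv (-1) 1 b ->
  \int[mu]_(z in I) (coef F (derive1 q) z * (z * b z)) =
  - (\int[mu]_(z in I) (coef K q z * b z)).
Proof.
move=> LF LK FK sq qQ qQ' C0 ql qr tb; have N11 : -1 <= 1 :> R by lra.
have tzb := test_fun_itvM (@smooth_id R) tb.
have [B _ bB] := test_fun_itv_bounded N11 tb.
have [B' _ bB'] := test_fun_itv_bounded N11 tzb.
pose a m x := cutoff x0 x1 m x * q x.
have sa m : smooth (a m) by apply: smoothM => //; exact: smooth_cutoff.
have aQ m x : `|a m x| <= Q.
  by rewrite normrM -[leRHS]mul1r; apply: ler_pM => //; exact: cutoff_le1.
have aq x : D x -> a m x @[m --> \oo] --> q x.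
  move=> Dx; rewrite -[X in _ --> X]mul1r; apply: cvgM; last exact: cvg_cst.
  exact: cutoff_cvg.
have [A cutA] := derive1_cutoff_mul_bounded x01 C0 ql qr.
have daA m x : `|derive1 (a m) x| <= A + Q'.
  rewrite derive1_cutoffM//; apply: le_trans (ler_normD _ _) _; apply: lerD => //.
  by rewrite normrM -[leRHS]mul1r; apply: ler_pM => //; exact: cutoff_le1.
have daq x : D x -> derive1 (a m) x @[m --> \oo] --> derive1 q x.
  exact: derive1_cutoffM_cvg.
have cvgF := Rintegral_tensor_cvg LF (fun m => smooth_derive1 (sa m)) daA daq
  (smooth_derive1 sq) qQ' (proj1 tzb) bB'.
have cvgK := Rintegral_tensor_cvg LK sa aQ aq sq qQ (proj1 tb) bB.
apply: (cvg_unique _ cvgF) => //; apply: (cvg_trans _ (cvgN cvgK)).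
apply: near_eq_cvg; apply: nearW => m.
have := FK _ (test_fun_tensor (test_fun_itv_cutoffM x01 m sq) tb).
rewrite (dx_tensor _ (sa m)) => /(congr1 fine); rewrite fineN => FKm.
apply: etrans (esym FKm) _; congr fine.
by apply: eq_integral => p _; rewrite [p.2 * _]mulrCA.
Qed.

Lemma norm_esin_le_left n x : `|es n x| <= n%:R * w * `|x - x0|.
Proof.
have w0 := ltW (freq_gt0 x01).
rewrite esinE mulrA -[X in _ <= X * _]ger0_norm; last by rewrite mulr_ge0.
by rewrite -normrM norm_sin_le.
Qed.

Lemma norm_esin_le_right n x : `|es n x| <= n%:R * w * `|x1 - x|.
Proof.
have w0 := ltW (freq_gt0 x01); have es1 := esin_right x01 n.
rewrite esinE (_ : n%:R * (w * (x - x0)) =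
  n%:R * (w * (x1 - x0)) - n%:R * w * (x1 - x)); last by ring.
rewrite sinB -esinE es1 mul0r sub0r normrN normrM.
apply: (@le_trans _ _ `|sin (n%:R * w * (x1 - x))|).
  by rewrite ler_piMl// cos_max.
rewrite -[X in _ <= X * _]ger0_norm; last by rewrite mulr_ge0.
by rewrite -normrM norm_sin_le.
Qed.

Lemma coef_derive1_esin F n z : L2 mu D (section_extension D I F z) ->
  coef F (derive1 (es n)) z = n%:R * w * coef F (ec n) z.
Proof.
move=> LS; rewrite /coef /section_coef -RintegralZl//; last first.
  by apply: Rintegrable_L2M => //; exact: L2_ecos.
by apply: eq_Rintegral => x _; rewrite derive1_esin mulrCA.
Qed.

Lemma ae_z_coef F K n : L2 mu2 (Om : set RR) F ->
  L2 mu2 (Om : set RR) K -> weak_z_dx x0 x1 F K ->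
  {ae mu, forall z, I z -> n%:R * w * (z * coef F (ec n) z) = - coef K (es n) z}.
Proof.
move=> LF LK FK; have w0 := ltW (freq_gt0 x01).
have nw0 : 0 <= n%:R * w by rewrite mulr_ge0.
have ses := smooth_esin x0 x1 n; have es1 := esin_le1 x0 x1 n.
have es1' x : `|derive1 (es n) x| <= n%:R * w.
  by rewrite derive1_esin normrM ger0_norm// ler_piMr// ecos_le1.
have LcF := L2_coef LF (smooth_derive1 ses) es1'; have LcK := L2_coef LK ses es1.
have iF : Rintegrable mu I (fun z => coef F (derive1 (es n)) z * z).
  apply: (@RintegrableMb _ _ _ mu _ mI 1) => //; first exact: L2_itv_Rintegrable.
  by move=> z; rewrite /= in_itv /= ler_norml => /andP[/ltW -> /ltW ->].
have iK := L2_itv_Rintegrable LcK; have iFK := RintegrableD mI iF iK.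
have ae0 : {ae mu, forall z, I z -> coef F (derive1 (es n)) z * z + coef K (es n) z = 0}.
  apply: (ae_eq0_test_fun iFK) => b tb; have N11 : -1 <= 1 :> R by lra.
  have [B _ bB] := test_fun_itv_bounded N11 tb.
  have mb : measurable_fun I b by apply: measurable_fun_smooth; case: tb.
  have iFb := RintegrableMb mI iF mb (fun z _ => bB z).
  have iKb := RintegrableMb mI iK mb (fun z _ => bB z).
  under eq_Rintegral do rewrite mulrDl.
  rewrite (RintegralD mI iFb iKb); apply/eqP; rewrite addr_eq0; apply/eqP.
  rewrite -(weak_z_dx_coef LF LK FK ses es1 es1' nw0 (norm_esin_le_left n)
    (norm_esin_le_right n) tb).
  by apply: eq_Rintegral => z _; rewrite mulrA.
have LFom : L2 mu2 (D `*` I) F by rewrite -OmegaE.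
have := ae_section_L2 mD mI LFom.
apply: (@filterS2 _ _ (ae_filter_ringOfSetsType mu)) ae0 => z eq0 LS Iz.
apply/eqP; rewrite -addr_eq0; apply/eqP; rewrite -[RHS](eq0 Iz).
by rewrite (coef_derive1_esin _ (LS Iz)); ring.
Qed.

Lemma coef_interpolation phi g h k n : (0 < n)%N ->
  L2 mu2 (Om : set RR) phi -> L2 mu2 (Om : set RR) g ->
  L2 mu2 (Om : set RR) h -> L2 mu2 (Om : set RR) k ->
  weak_dz x0 x1 phi g -> weak_dzz x0 x1 phi h -> weak_z_dx x0 x1 phi k ->
  n%:R * (\int[mu]_(z in I) (`|z| * coef g (ec n) z ^+ 2)) <=
  interpolation_cst R * (w ^- 2 * (\int[mu]_(z in I) coef k (es n) z ^+ 2) +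
    \int[mu]_(z in I) coef h (ec n) z ^+ 2).
Proof.
move=> n0 Lp Lg Lh Lk pg ph pk; have wn0 := lt0r_neq0 (freq_gt0 x01).
have sec := smooth_ecos x0 x1 n; have ec1 := ecos_le1 x0 x1 n.
have Lcp := L2_coef Lp sec ec1; have Lcg := L2_coef Lg sec ec1.
have Lch := L2_coef Lh sec ec1.
have LcK := L2_coef Lk (smooth_esin x0 x1 n) (esin_le1 x0 x1 n).
have ug := weak_deriv_coef Lp Lg sec ec1 (weak_dz_tensorP pg).
have gh := weak_deriv_coef Lg Lh sec ec1 (weak_dzz_tensorP pg ph).
have n1 : 1 <= n%:R :> R by rewrite ler1n.
apply: le_trans (degenerate_interpolation Lcp Lcg Lch ug gh n1) _.
rewrite ler_wpM2l ?interpolation_cst_ge0// lerD2r.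
have iz := Rintegrable_sqr_sqr Lcp; have [_ ik] := LcK.
rewrite -(RintegralZl _ mI iz) -(RintegralZl _ mI ik).
apply: ae_le_Rintegral; [exact: mI|exact: RintegrableZ|exact: RintegrableZ|].
apply: filterS_ae (ae_z_coef n Lp Lk pk) => z zcoef Iz.
rewrite -[X in _ <= _ * X]sqrrN -(zcoef Iz) le_eqVlt; apply/orP; left; apply/eqP.
by field.
Qed.

End WeakCoefficients.

Section HalfNorm.
Variable R : realType.
Notation mu := (@lebesgue_measure R).
Variables a b : R.
Notation D := (`]a, b[%classic : set R).
Notation RR := (measurableTypeR R * measurableTypeR R)%type.
Implicit Types (f g : R -> R) (c : R).

Let mD : measurable (D : set (measurableTypeR R)) := measurable_itv _.

Lemma H12norm2E f : H12norm2 a b f =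
  (\int[mu]_(x in D) (f x ^+ 2)%:E + slobodeckij a b f)%E.
Proof. by []. Qed.

Lemma slobodeckij_ge0 f : (0 <= slobodeckij a b f)%E.
Proof.
by do 2 (apply: integral_ge0 => ? _); rewrite lee_fin divr_ge0// sqr_ge0.
Qed.

Lemma H12norm2_ge0 f : (0 <= H12norm2 a b f)%E.
Proof.
rewrite H12norm2E adde_ge0 ?slobodeckij_ge0//; apply: integral_ge0 => x _.
by rewrite lee_fin sqr_ge0.
Qed.

Lemma eq_H12norm2 f g : (forall x, D x -> f x = g x) ->
  H12norm2 a b f = H12norm2 a b g.
Proof.
move=> fg; congr (_ + _)%E; first by apply: eq_integral => x /set_mem/fg ->.
by apply: eq_integral => x /set_mem/fg ->; apply: eq_integral => y /set_mem/fg ->.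
Qed.

Lemma measurable_slobodeckij_quotient f : measurable_fun setT f ->
  measurable_fun setT
    (fun p : RR => ((f p.1 - f p.2) ^+ 2 / (p.1 - p.2) ^+ 2)%:E).
Proof.
move=> mf; have mfst : measurable_fun setT (fst : RR -> R) by exact: measurable_fst.
have msnd : measurable_fun setT (snd : RR -> R) by exact: measurable_snd.
apply/measurable_EFinP; apply: measurable_funM.
  apply: measurable_funX; apply: measurable_funB.
    exact: (measurableT_comp mf mfst).
  exact: (measurableT_comp mf msnd).
apply: (measurableT_comp (@measurable_fun_inv R)).
by apply: measurable_funX; exact: measurable_funB.
Qed.

Lemma H12norm2Z c f : measurable_fun setT f ->
  H12norm2 a b (fun x => c * f x) = ((c ^+ 2)%:E * H12norm2 a b f)%E.
Proof.
move=> mf; pose Q (p : RR) : \bar R := ((f p.1 - f p.2) ^+ 2 / (p.1 - p.2) ^+ 2)%:E.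
have mQ : measurable_fun setT Q by exact: measurable_slobodeckij_quotient.
have Q0 p : (0 <= Q p)%E by rewrite lee_fin divr_ge0 ?sqr_ge0.
have mQx x : measurable_fun setT (fun y => Q (x, y)).
  by apply: (measurableT_comp mQ); exact: pair1_measurable.
rewrite !H12norm2E ge0_muleDr ?slobodeckij_ge0//; last first.
  by apply: integral_ge0 => x _; rewrite lee_fin sqr_ge0.
congr (_ + _)%E.
  rewrite -ge0_integralZl_EFin ?sqr_ge0//.
  - by apply: eq_integral => x _; rewrite exprMn EFinM.
  - by move=> x _; rewrite lee_fin sqr_ge0.
  - by apply/measurable_EFinP; apply: measurable_funX; exact: measurable_funTS.
rewrite -[RHS]ge0_integralZl_EFin ?sqr_ge0//; last 2 first.
- by move=> x _; apply: integral_ge0 => y _; exact: (Q0 (x, y)).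
- by apply: measurable_funTS; exact: (measurable_section_integral mu mD mQ Q0).
apply: eq_integral => x _; rewrite -ge0_integralZl_EFin ?sqr_ge0//.
- by apply: eq_integral => y _; rewrite -mulrBr exprMn -mulrA EFinM.
- by move=> y _; exact: (Q0 (x, y)).
- by apply: measurable_funTS; exact: mQx.
Qed.

End HalfNorm.

Section WeightedSlices.
Variable R : realType.
Notation mu := (@lebesgue_measure R).
Notation mu2 := (mu \x mu)%E.
Variables x0 x1 : R.
Hypothesis x01 : x0 < x1.
Notation L := (x1 - x0).
Notation D := (`]x0, x1[%classic : set R).
Notation I := (`]-1, 1[%classic : set R).
Notation Om := (Omega x0 x1).
Notation RR := (measurableTypeR R * measurableTypeR R)%type.
Notation w := (freq x0 x1).
Notation ec := (ecos x0 x1).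
Variable g : R * R -> R.
Hypothesis Lg : L2 mu2 (Om : set RR) g.
Notation slice := (section_extension D I g).

Let mD : measurable (D : set (measurableTypeR R)) := measurable_itv _.
Let mI : measurable (I : set (measurableTypeR R)) := measurable_itv _.
Let LgDI : L2 mu2 (D `*` I) g. Proof. by rewrite -OmegaE. Qed.

Let measurable_slice z : measurable_fun setT (slice z).
Proof. exact: (measurable_section_extension mD mI LgDI). Qed.

Lemma measurable_slobodeckij_slice :
  measurable_fun setT (fun z => slobodeckij x0 x1 (slice z)).
Proof.
have mg := measurable_restrict_rectangle mD mI LgDI.
pose Q (p : RR * measurableTypeR R) : \bar R :=
  ((slice p.1.1 p.1.2 - slice p.1.1 p.2) ^+ 2 / (p.1.2 - p.2) ^+ 2)%:E.
have Q0 p : (0 <= Q p)%E by rewrite lee_fin divr_ge0// sqr_ge0.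
have m11 : measurable_fun setT (fun p : RR * measurableTypeR R => p.1.1).
  by apply: (measurableT_comp (f := fst)); exact: measurable_fst.
have m12 : measurable_fun setT (fun p : RR * measurableTypeR R => p.1.2).
  by apply: (measurableT_comp (f := snd)); [exact: measurable_snd|exact: measurable_fst].
have m2 : measurable_fun setT (fun p : RR * measurableTypeR R => p.2).
  exact: measurable_snd.
have mQ : measurable_fun setT Q.
  apply/measurable_EFinP; apply: measurable_funM.
    apply: measurable_funX; apply: measurable_funB.
      by apply: (measurableT_comp mg); exact: measurable_fun_pair.
    by apply: (measurableT_comp mg); exact: measurable_fun_pair.
  apply: (measurableT_comp (@measurable_fun_inv R)).
  by apply: measurable_funX; exact: measurable_funB.
have mQy := measurable_section_integral mu mD mQ Q0.
apply: (measurable_section_integral mu mD mQy) => p.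
by apply: integral_ge0 => y _; exact: Q0.
Qed.

Lemma measurable_H12norm2_slice :
  measurable_fun setT (fun z => H12norm2 x0 x1 (slice z)).
Proof.
apply: emeasurable_funD; first exact: (measurable_section_sqr mD mI LgDI).
exact: measurable_slobodeckij_slice.
Qed.

Lemma H12norm2_weighted_slice z : I z ->
  H12norm2 x0 x1 (fun x => Num.sqrt `|z| * g (x, z)) =
  (`|z|%:E * H12norm2 x0 x1 (slice z))%E.
Proof.
move=> Iz; rewrite -[in RHS](sqr_sqrtr (normr_ge0 z)) -H12norm2Z//.
by apply: eq_H12norm2 => x Dx; rewrite section_extension_in.
Qed.

Let measurable_normr_EFin (E : set R) : measurable_fun E (fun z : R => `|z|%:E).
Proof.
apply/measurable_EFinP; apply: measurable_fun_continuous => z.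
exact: norm_continuous.
Qed.

Lemma measurable_H12norm2_weighted : measurable_fun I
  (fun z => H12norm2 x0 x1 (fun x => Num.sqrt `|z| * g (x, z))).
Proof.
have weightedE : {in I, (fun z => `|z|%:E * H12norm2 x0 x1 (slice z))%E =1
    (fun z => H12norm2 x0 x1 (fun x => Num.sqrt `|z| * g (x, z)))}.
  by move=> z /set_mem Iz; rewrite H12norm2_weighted_slice.
apply: (@eq_measurable_fun _ _ _ _ _ _ _ weightedE).
apply: emeasurable_funM; first exact: measurable_normr_EFin.
by apply: measurable_funTS; exact: measurable_H12norm2_slice.
Qed.

Definition weighted_energy n z : R :=
  n%:R / ecos_norm2 x0 x1 n * (`|z| * coef x0 x1 g (ec n) z ^+ 2).

Lemma weighted_energy_ge0 n z : 0 <= weighted_energy n z.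
Proof.
by rewrite mulr_ge0 ?divr_ge0 ?(ltW (ecos_norm2_gt0 x01 n))// mulr_ge0 ?sqr_ge0.
Qed.

Let weighted_energyE n z : weighted_energy n z =
  `|z| * (n%:R * mode_energy mu D ec (ecos_norm2 x0 x1) (slice z) n).
Proof.
rewrite -[mode_energy _ _ _ _ _ _]/(coef x0 x1 g (ec n) z ^+ 2 / ecos_norm2 x0 x1 n).
by rewrite /weighted_energy; ring.
Qed.

Let L2_coef_ecos n : L2 mu I (coef x0 x1 g (ec n)).
Proof. by apply: L2_coef => //; [exact: smooth_ecos|exact: ecos_le1]. Qed.

Lemma Rintegrable_weighted_energy n : Rintegrable mu I (weighted_energy n).
Proof. by apply: RintegrableZ => //; exact: Rintegrable_norm_sqr. Qed.

Let weight_cst_ge0 : 0 <= 4 * L * w ^+ 2.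
Proof. by apply: mulr_ge0 (sqr_ge0 _); apply: mulr_ge0 (ltW (length_gt0 x01)). Qed.

Lemma ae_weighted_slobodeckij_le : {ae mu, forall z, I z ->
  (`|z|%:E * slobodeckij x0 x1 (slice z) <=
   (4 * L * w ^+ 2)%:E * \sum_(0 <= n <oo) (weighted_energy n z)%:E)%E}.
Proof.
apply: filterS_ae (ae_section_L2 mD mI LgDI) => z LS Iz.
have z0 : (0 <= `|z|%:E)%E by rewrite lee_fin.
apply: le_trans (lee_wpmul2l z0 (slobodeckij_le x01 (measurable_slice z) (LS Iz))) _.
rewrite muleCA -nneseriesZl => [|n _]; last first.
  by rewrite lee_fin mulr_ge0// mode_energy_ge0// => m; exact: ecos_norm2_gt0.
rewrite lee_wpmul2l ?lee_fin ?weight_cst_ge0//.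
apply: lee_nneseries => [n _ _|n _]; last by rewrite weighted_energyE EFinM.
by rewrite -EFinM -weighted_energyE lee_fin weighted_energy_ge0.
Qed.

Lemma integral_weighted_slobodeckij_le (B : R) :
  (forall M, \sum_(n < M) (\int[mu]_(z in I) weighted_energy n z) <= B) ->
  (\int[mu]_(z in I) (`|z|%:E * slobodeckij x0 x1 (slice z)) <=
   (4 * L * w ^+ 2 * B)%:E)%E.
Proof.
move=> sumB; have t0 n z : (0 <= (weighted_energy n z)%:E)%E.
  by rewrite lee_fin weighted_energy_ge0.
have mt n : measurable_fun I (EFin \o weighted_energy n).
  apply/measurable_EFinP; exact: measurable_Rintegrable (Rintegrable_weighted_energy n).
have mts : measurable_fun I (fun z => \sum_(0 <= n <oo) (weighted_energy n z)%:E)%E.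
  exact: (@ge0_emeasurable_sum _ _ _ _ (fun n z => (weighted_energy n z)%:E) xpredT
    (fun n z _ _ => t0 n z) (fun n _ => mt n)).
have S0 z : (0 <= \sum_(0 <= n <oo) (weighted_energy n z)%:E)%E.
  by apply: nneseries_ge0.
apply: (@le_trans _ _ (\int[mu]_(z in I)
    ((4 * L * w ^+ 2)%:E * \sum_(0 <= n <oo) (weighted_energy n z)%:E))%E).
  apply: ae_ge0_le_integral ae_weighted_slobodeckij_le => //.
  - by move=> z _; rewrite mule_ge0 ?slobodeckij_ge0.
  - apply: measurable_funTS; apply: emeasurable_funM; first exact: measurable_normr_EFin.
    exact: measurable_slobodeckij_slice.
  - by move=> z _; rewrite mule_ge0 ?lee_fin.
  - exact: measurable_funeM.
rewrite ge0_integralZl_EFin// [leRHS]EFinM lee_wpmul2l ?lee_fin ?weight_cst_ge0//.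
rewrite integral_nneseries//.
apply: lime_le.
  by apply: is_cvg_nneseries => n _ _; apply: integral_ge0 => z _.
apply: nearW => M; rewrite big_mkord.
rewrite (eq_bigr (fun n : 'I_M => (\int[mu]_(z in I) weighted_energy n z)%:E)).
  by rewrite sumEFin lee_fin; exact: sumB.
by move=> n _; rewrite Rintegrable_fineK//; exact: Rintegrable_weighted_energy.
Qed.

Lemma integral_H12norm2_weighted_le :
  (\int[mu]_(z in I) H12norm2 x0 x1 (fun x => (Num.sqrt `|z| * g (x, z))%R) <=
   (\int[mu2]_(p in Om) (g p ^+ 2))%:E +
   \int[mu]_(z in I) (`|z|%:E * slobodeckij x0 x1 (slice z)))%E.
Proof.
have slice0 z : (0 <= \int[mu]_(x in D) (slice z x ^+ 2)%:E)%E.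
  by apply: integral_ge0 => x _; rewrite lee_fin sqr_ge0.
have -> : (\int[mu]_(z in I) H12norm2 x0 x1 (fun x => (Num.sqrt `|z| * g (x, z))%R) =
    \int[mu]_(z in I) (`|z|%:E * \int[mu]_(x in D) (slice z x ^+ 2)%:E +
                       `|z|%:E * slobodeckij x0 x1 (slice z)))%E.
  apply: eq_integral => z /set_mem Iz.
  by rewrite H12norm2_weighted_slice// H12norm2E ge0_muleDr ?slobodeckij_ge0.
rewrite ge0_integralD//; first last.
- apply: measurable_funTS; apply: emeasurable_funM; first exact: measurable_normr_EFin.
  exact: measurable_slobodeckij_slice.
- by move=> z _; rewrite mule_ge0 ?slobodeckij_ge0.
- apply: measurable_funTS; apply: emeasurable_funM; first exact: measurable_normr_EFin.
  exact: (measurable_section_sqr mD mI LgDI).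
- by move=> z _; rewrite mule_ge0.
apply: leeD => //.
rewrite -(Rintegrable_fineK (measurable_Omega x0 x1)); last by case: Lg.
rewrite OmegaE -(integral_section_sqr mD mI LgDI).
apply: ge0_le_integral_nonmeasurable => z; first by move=> _; rewrite mule_ge0.
rewrite /= in_itv /= => /andP[z1 z2].
by rewrite -[leRHS]mul1e lee_wpmul2r// lee_fin ler_norml (ltW z1) (ltW z2).
Qed.

End WeightedSlices.

Section HalfNormEstimate.
Variable R : realType.
Notation mu := (@lebesgue_measure R).
Notation mu2 := (mu \x mu)%E.
Variables x0 x1 : R.
Hypothesis x01 : x0 < x1.
Notation L := (x1 - x0).
Notation D := (`]x0, x1[%classic : set R).
Notation I := (`]-1, 1[%classic : set R).
Notation Om := (Omega x0 x1).
Notation RR := (measurableTypeR R * measurableTypeR R)%type.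
Notation w := (freq x0 x1).
Notation ec := (ecos x0 x1).
Notation es := (esin x0 x1).
Notation sqr_integral F := (\int[mu2]_(p in Om) (F p ^+ 2)).
Implicit Types (F : R * R -> R).

Let mD : measurable (D : set (measurableTypeR R)) := measurable_itv _.
Let mI : measurable (I : set (measurableTypeR R)) := measurable_itv _.
Let finD : (mu D < +oo)%E := lebesgue_measure_itv_lty x0 x1 false true.
Let finI : (mu I < +oo)%E := lebesgue_measure_itv_lty (-1) 1 false true.

Let sqr_integral_ge0 F : 0 <= sqr_integral F.
Proof. by apply: Rintegral_ge0 => p _; exact: sqr_ge0. Qed.

Lemma L2_on_L2 F : L2_on Om F -> L2 mu2 (Om : set RR) F.
Proof. by move=> [mF Fy]; apply: L2P => //; exact: measurable_Omega. Qed.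

Lemma L2normE F : L2 mu2 (Om : set RR) F ->
  L2norm Om F = (Num.sqrt (sqr_integral F))%:E.
Proof.
move=> LF; rewrite /L2norm unlock.
have -> : (\int[leb2 (R:=R)]_x `|(EFin \o F \_ Om) x| `^ 2 =
    \int[mu2]_(p in Om) (F p ^+ 2)%:E)%E.
  rewrite [RHS]integral_mkcond; apply: eq_integral => p _ /=.
  rewrite powR_mulrn// real_normK ?num_real// !patchE.
  by case: ifP => // _; rewrite expr0n.
rewrite (Rintegrable_fineK (measurable_Omega x0 x1)); last by case: LF.
by rewrite poweR_EFin powR12_sqrt.
Qed.

Lemma sum_coef_ecos_le F M : L2 mu2 (Om : set RR) F ->
  \sum_(n < M) (\int[mu]_(z in I) (coef x0 x1 F (ec n.+1) z ^+ 2)) / (L / 2) <=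
  sqr_integral F.
Proof.
rewrite OmegaE => LF.
have := Bessel_section_coef mD mI finD finI M.+1 LF
  (fun n => measurable_fun_smooth (smooth_ecos x0 x1 n))
  (ecos_le1 x0 x1) (ecos_norm2_gt0 x01) (ecos_orthogonal x01).
apply: le_trans; rewrite big_ord_recl lerDr divr_ge0 ?(ltW (ecos_norm2_gt0 x01 0))//.
by apply: Rintegral_ge0 => z _; exact: sqr_ge0.
Qed.

Lemma sum_coef_esin_le F M : L2 mu2 (Om : set RR) F ->
  \sum_(n < M) (\int[mu]_(z in I) (coef x0 x1 F (es n.+1) z ^+ 2)) / (L / 2) <=
  sqr_integral F.
Proof.
rewrite OmegaE => LF; have L20 : 0 < L / 2 by rewrite divr_gt0 ?(length_gt0 x01).
exact: (Bessel_section_coef mD mI finD finI M LF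
  (fun n => measurable_fun_smooth (smooth_esin x0 x1 n.+1))
  (fun n => esin_le1 x0 x1 n.+1) (fun _ => L20) (esin_orthogonal x01)).
Qed.

Lemma sum_weighted_energy_le phi g h k M : inZ0 x0 x1 phi g h k ->
  \sum_(n < M) (\int[mu]_(z in I) weighted_energy x0 x1 g n z) <=
  interpolation_cst R * (w ^- 2 * sqr_integral k + sqr_integral h).
Proof.
move=> [/L2_on_L2 Lp /L2_on_L2 Lg /L2_on_L2 Lh /L2_on_L2 Lk [pg ph pk]].
have K0 := interpolation_cst_ge0 R.
have L20 : 0 < L / 2 by rewrite divr_gt0 ?(length_gt0 x01).
have w20 : 0 <= w ^- 2 by rewrite invr_ge0 sqr_ge0.
case: M => [|M]; first by rewrite big_ord0 mulr_ge0// addr_ge0 ?mulr_ge0.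
have iE n := Rintegrable_norm_sqr (L2_coef Lg (smooth_ecos x0 x1 n) (ecos_le1 x0 x1 n)).
rewrite big_ord_recl /= [X in X + _](_ : _ = 0) ?add0r; last first.
  by rewrite /weighted_energy RintegralZl//; [rewrite mul0r mul0r|exact: iE].
apply: (@le_trans _ _ (\sum_(n < M) interpolation_cst R *
    (w ^- 2 * ((\int[mu]_(z in I) (coef x0 x1 k (es n.+1) z ^+ 2)) / (L / 2)) +
     (\int[mu]_(z in I) (coef x0 x1 h (ec n.+1) z ^+ 2)) / (L / 2)))).
  apply: ler_sum => n _; rewrite /weighted_energy RintegralZl//; last exact: iE.
  rewrite mulrAC ler_pdivrMr//.
  apply: le_trans (coef_interpolation x01 (ltn0Sn n) Lp Lg Lh Lk pg ph pk) _.
  rewrite -[ecos_norm2 _ _ _]/(L / 2); move: (L / 2) (lt0r_neq0 L20) => c c0.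
  by rewrite -[leRHS]mulrA (mulrDl _ _ c) -(mulrA (w ^- 2)) !divfK.
rewrite -mulr_sumr big_split -mulr_sumr /= ler_wpM2l// lerD ?sum_coef_ecos_le//.
by rewrite ler_wpM2l ?sum_coef_esin_le.
Qed.

Definition half_norm_cst : R := 1 + 4 * L * interpolation_cst R * (1 + w ^+ 2).

Lemma half_norm_cst_ge1 : 1 <= half_norm_cst.
Proof.
rewrite lerDl mulr_ge0 ?addr_ge0 ?sqr_ge0// mulr_ge0 ?interpolation_cst_ge0//.
by rewrite mulr_ge0 ?(ltW (length_gt0 x01)).
Qed.

Lemma integral_H12norm2_le phi g h k : inZ0 x0 x1 phi g h k ->
  (\int[mu]_(z in I) H12norm2 x0 x1 (fun x => (Num.sqrt `|z| * g (x, z))%R) <=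
   (half_norm_cst * (sqr_integral g + sqr_integral h + sqr_integral k))%:E)%E.
Proof.
move=> Z0; have [_ /L2_on_L2 Lg _ _ _] := Z0.
apply: le_trans (integral_H12norm2_weighted_le Lg) _.
have slob_le := integral_weighted_slobodeckij_le x01 Lg
  (fun M => sum_weighted_energy_le M Z0).
apply: le_trans (leeD (lexx _) slob_le) _; rewrite -EFinD lee_fin /half_norm_cst.
have wn0 := lt0r_neq0 (freq_gt0 x01); have K0 := interpolation_cst_ge0 R.
have g0 := sqr_integral_ge0 g; have h0 := sqr_integral_ge0 h.
have k0 := sqr_integral_ge0 k; move: g0 h0 k0.
move: (sqr_integral g) (sqr_integral h) (sqr_integral k) => G H K G0 H0 K0'.
have c0 : 0 <= 4 * L * interpolation_cst R.
  by rewrite mulr_ge0// mulr_ge0 ?(ltW (length_gt0 x01)).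
have -> : 4 * L * w ^+ 2 * (interpolation_cst R * (w ^- 2 * K + H)) =
    4 * L * interpolation_cst R * (K + w ^+ 2 * H) by field.
have w2 := sqr_ge0 w; move: (w ^+ 2) w2 (4 * L * _) c0 => v v0 c c0.
have := mulr_ge0 c0 G0; have := mulr_ge0 c0 H0; have := mulr_ge0 (mulr_ge0 c0 v0) G0.
have := mulr_ge0 (mulr_ge0 c0 v0) K0'; nra.
Qed.

Lemma sqrtr_addr_le (s t : R) : 0 <= s -> 0 <= t ->
  Num.sqrt (s + t) <= Num.sqrt s + Num.sqrt t.
Proof.
move=> s0 t0; rewrite -(@ler_pXn2r _ 2%N) ?nnegrE ?addr_ge0 ?sqrtr_ge0//.
rewrite sqrrD !sqr_sqrtr ?addr_ge0//.
by rewrite -addrA lerD2l lerDr mulrn_wge0// mulr_ge0 ?sqrtr_ge0.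
Qed.

Lemma half_norm_le phi g h k : inZ0 x0 x1 phi g h k ->
  ((\int[mu]_(z in I) H12norm2 x0 x1 (fun x => (Num.sqrt `|z| * g (x, z))%R)) `^ 2^-1 <=
   (Num.sqrt half_norm_cst)%:E * Z0norm x0 x1 phi g h k)%E.
Proof.
move=> Z0; have := integral_H12norm2_le Z0.
case: Z0 => [/L2_on_L2 Lp /L2_on_L2 Lg /L2_on_L2 Lh /L2_on_L2 Lk _].
set N := (\int[mu]_(z in I) _)%E.
have N0 : (0 <= N)%E by apply: integral_ge0 => z _; exact: H12norm2_ge0.
have g0 := sqr_integral_ge0 g; have h0 := sqr_integral_ge0 h.
have k0 := sqr_integral_ge0 k.
have c0 : 0 <= half_norm_cst by apply: le_trans half_norm_cst_ge1.
rewrite /Z0norm !L2normE// -!EFinD -EFinM.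
case: N N0 => [r| |]// r0; rewrite !lee_fin in r0 * => r_le.
rewrite powR12_sqrt//; apply: le_trans (ler_wsqrtr r_le) _.
rewrite sqrtrM//; apply: ler_wpM2l; first exact: sqrtr_ge0.
apply: le_trans (sqrtr_addr_le (addr_ge0 g0 h0) k0) _.
have := sqrtr_addr_le g0 h0; have := sqrtr_ge0 (sqr_integral phi).
move: (Num.sqrt _) (Num.sqrt _) (Num.sqrt _) (Num.sqrt _) (Num.sqrt _) => ? ? ? ? ?; lra.
Qed.

Lemma ae_inH12_weighted g : L2 mu2 (Om : set RR) g ->
  (\int[mu]_(z in I) H12norm2 x0 x1 (fun x => (Num.sqrt `|z| * g (x, z))%R) < +oo)%E ->
  {ae mu, forall z, I z -> inH12 x0 x1 (fun x => Num.sqrt `|z| * g (x, z))}.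
Proof.
move=> Lg Hy; have LgDI : L2 mu2 (D `*` I) g by rewrite -OmegaE.
have iH : mu.-integrable I
    (fun z => H12norm2 x0 x1 (fun x => (Num.sqrt `|z| * g (x, z))%R)).
  apply/integrableP; split; first exact: measurable_H12norm2_weighted.
  by under eq_integral do rewrite gee0_abs ?H12norm2_ge0//.
apply: filterS_ae (integrable_ae mI iH) => z zf Iz.
split; last by rewrite ltey_eq (zf Iz).
have mS : measurable_fun D (fun x => Num.sqrt `|z| * section_extension D I g z x).
  apply: measurable_funTS; apply: measurable_funM; first exact: measurable_cst.
  exact: (measurable_section_extension mD mI LgDI).
by apply: eq_measurable_fun mS => x /set_mem Dx; rewrite section_extension_in.
Qed.

End HalfNormEstimate.

Unset Implicit Arguments.

Theorem lemmaB12 (R : realType) (x0 x1 : R) (hx : x0 < x1) :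
  exists C : R, 0 < C /\
  forall phi g h k : R * R -> R,
    inZ0 x0 x1 phi g h k ->
    let w : R * R -> R := fun p => Num.sqrt `|p.2| * g p in
    [/\ {ae leb R, forall z : R, (@zI R) z ->
                     inH12 x0 x1 (fun x => w (x, z))},
        measurable_fun ((@zI R)) (fun z : R => H12norm2 x0 x1 (fun x => w (x, z))),
        (\int[leb R]_(z in (@zI R)) H12norm2 x0 x1 (fun x => w (x, z)) < +oo)%E
      & ((\int[leb R]_(z in (@zI R)) H12norm2 x0 x1 (fun x => w (x, z)))
            `^ (2^-1) <= C%:E * Z0norm x0 x1 phi g h k)%E].
Proof.
exists (Num.sqrt (half_norm_cst x0 x1)); split.
  by rewrite sqrtr_gt0; apply: lt_le_trans (half_norm_cst_ge1 hx).
move=> phi g h k Z0 w; have [_ /L2_on_L2 Lg _ _ _] := Z0.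
have finite_norm := le_lt_trans (integral_H12norm2_le hx Z0) (ltry _).
split.
- exact: ae_inH12_weighted Lg finite_norm.
- exact: measurable_H12norm2_weighted Lg.
- exact: finite_norm.
- exact: (half_norm_le hx Z0).
Qed.
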